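(* Let $\alpha\in(0,2)$, $\nu\in\mathfrak{A}^\alpha$, and let $w=w_\nu$ be an O-RV function at zero with indices $p_1,q_1$ such that conditions A and C hold: \textbf{A.} $0<p_1\le q_1<1$ if $\alpha\in(0,1)$; $1\le p_1\le q_1<2$ if $\alpha=1$; $1<p_1\le q_1<2$ if $\alpha\in(1,2)$. \textbf{C.} There is $N_0>2$ such that $\int_1^\infty w(t)^{1/q_1}\frac{dt}{t^{N_0}}<\infty$. Let $\beta\in(0,q_1^{-1})$. Then the norms $|u|_\beta$ and $|u|_{\beta,\infty}$ are equivalent on $C_b^\infty(\mathbf{R}^d)$: there is $C>0$, depending only on $d,\beta,N$ (and the fixed measure $\nu$), such that $$C^{-1}|u|_\beta\le|u|_{\beta,\infty}\le C|u|_\beta,\qquad u\in C_b^\infty(\mathbf{R}^d).$$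
   Context: Lévy measures. $\mathbf{R}^d_0=\mathbf{R}^d\setminus\{0\}$. For $\alpha\in(0,2)$, $\mathfrak{A}^\alpha$ is the class of nonnegative measures $\nu$ on $\mathbf{R}^d_0$ with $\int (|y|^2\wedge 1)\,d\nu<\infty$ and $\alpha=\inf\{\sigma<2:\int_{|y|\le1}|y|^\sigma d\nu<\infty\}$, such that in addition $\int_{|y|>1}|y|\,d\nu<\infty$ if $\alpha\in(1,2)$, and $\int_{R<|y|\le R'}y\,d\nu=0$ for all $0<R<R'<\infty$ if $\alpha=1$. Put $\delta_\nu(r)=\nu(\{|y|>r\})$, assumed $>0$ for all $r>0$, and $w(r)=w_\nu(r)=\delta_\nu(r)^{-1}$, $r>0$. $w$ is an O-RV function at zero if $r_1(\varepsilon)=\limsup_{x\to0}\frac{w(\varepsilon x)}{w(x)}<\infty$ for every $\varepsilon>0$; then the limits $p_1=\lim_{\varepsilon\to0}\frac{\log r_1(\varepsilon)}{\log\varepsilon}$ and $q_1=\lim_{\varepsilon\to\infty}\frac{\log r_1(\varepsilon)}{\log\varepsilon}$ exist and $p_1\le q_1$. Norms. $C_b^\infty(\mathbf{R}^d)$ is the set of bounded smooth functions with all derivatives bounded. $|u|_0=\sup_x|u(x)|$, $[u]_\beta=\sup_{x,\,h\ne0}\frac{|u(x+h)-u(x)|}{w(|h|)^\beta}$, $|u|_\beta=|u|_0+[u]_\beta$. $\mathcal{F}\varphi(\xi)=\int e^{-i2\pi x\cdot\xi}\varphi(x)dx$. Fix $N>1$ and $\phi\in C_0^\infty(\mathbf{R}^d)$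 with $\operatorname{supp}\phi=\{1/N\le|\xi|\le N\}$, $\phi>0$ in the interior of its support and $\sum_{j=-\infty}^\infty\phi(N^{-j}\xi)=1$ for $\xi\ne0$. Put $\varphi_j=\mathcal{F}^{-1}[\phi(N^{-j}\cdot)]$ for $j\ge1$, $\varphi_0=\mathcal{F}^{-1}[1-\sum_{j\ge1}\phi(N^{-j}\cdot)]$, and $|u|_{\beta,\infty}=\sup_{j\ge0}w(N^{-j})^{-\beta}|u*\varphi_j|_0$. *)

(* Defs.v *)
From HB Require Import structures.
From mathcomp Require Import all_boot all_order all_algebra.
From mathcomp Require Import complex.

From mathcomp Require Import all_classical all_reals all_analysis measurable_realfun ring.

Set Implicit Arguments.
Unset Strict Implicit.
Unset Printing Implicit Defensive.

Import Order.TTheory GRing.Theory Num.Theory.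
Import numFieldNormedType.Exports.

Local Open Scope classical_set_scope.
Local Open Scope ring_scope.
(* 'rV[R]_n is equipped with its Borel sigma-algebra. *)
Definition borel_rV_display : measure_display.
Proof. exact: default_measure_display. Qed.

Section borel_rV.
Context {R : realType} {n : nat}.

Let borel0 : <<s (@open 'rV[R]_n) >> set0.
Proof. exact: sigma_algebra0. Qed.

Let borelC A : <<s (@open 'rV[R]_n) >> A -> <<s (@open 'rV[R]_n) >> (~` A).
Proof. exact: sigma_algebraC. Qed.

Let borel_bigcup (F : _^nat) : (forall i, <<s (@open 'rV[R]_n) >> (F i)) ->
  <<s (@open 'rV[R]_n) >> (\bigcup_i (F i)).
Proof. exact: sigma_algebra_bigcup. Qed.

HB.instance Definition _ := @isMeasurable.Build borel_rV_display
  'rV[R]_n <<s (@open 'rV[R]_n) >> borel0 borelC borel_bigcup.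

End borel_rV.

Section borel_rV_theory.
Context {R : realType} {n : nat}.

Lemma continuous_measurable_rV (f : 'rV[R]_n -> R) :
  continuous f -> measurable_fun [set: 'rV[R]_n] f.
Proof.
move=> /continuousP cf; apply: (measurability _ (RGenOInfty.measurableE R)).
move=> _ [_ [x ->] <-]; rewrite setTI; apply: sub_sigma_algebra.
by apply: cf; exact: interval_open.
Qed.

Lemma measurable_fun_rV d (T : measurableType d) (f : T -> 'rV[R]_n) :
  (forall i, measurable_fun [set: T] (fun x => f x ord0 i)) ->
  measurable_fun [set: T] f.
Proof.
move=> mf; apply: (measurability (@open 'rV[R]_n)) => // _ [U oU <-].
rewrite setTI.
pose B (p : 'rV[rat]_n * nat) : set 'rV[R]_n :=
  [set v | forall i, `|v ord0 i - ratr (p.1 ord0 i)| < p.2.+1%:R^-1].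
pose G p := if `[< B p `<=` U >] then B p else set0.
have -> : U = \bigcup_p G p.
  apply/seteqP; split=> [v Uv|v [p _]]; last first.
    by rewrite /G; case: asboolP => // BU /BU.
  have /nbhs_ballP[e e0 eU] : nbhs v U by exact: open_nbhs_nbhs.
  have [k ke] : exists k : nat, k.+1%:R^-1 < e / 2.
    have [k] : exists k : nat, 0 + k.+1%:R^-1 < e / 2.
      by apply: ltr_add_invr; rewrite divr_gt0.
    by rewrite add0r; exists k.
  have qv i : exists q : rat, `|v ord0 i - ratr q| < k.+1%:R^-1.
    have /rat_in_itvoo[q] : v ord0 i - k.+1%:R^-1 < v ord0 i + k.+1%:R^-1.
      by rewrite ltrD2l (@lt_trans _ _ 0)// ?oppr_lt0 invr_gt0.
    rewrite in_itv/= => /andP[q1 q2]; exists q.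
    by rewrite ltr_distlC q1.
  have [q vq] := choice qv.
  exists (\row_i q i, k) => //; rewrite /G asboolT.
    by move=> i; rewrite mxE; exact: vq.
  move=> z zB; apply: eU; split=> // i j; rewrite ord1 /ball/=.
  have -> : v ord0 j - z ord0 j =
      (v ord0 j - ratr (q j)) - (z ord0 j - ratr (q j)) by ring.
  rewrite (le_lt_trans (ler_normB _ _))// [e]splitr ltrD//.
    exact: lt_trans ke.
  by apply: lt_trans ke; have := zB j; rewrite mxE.
rewrite preimage_bigcup; apply: countable_bigcupT_measurable => // p.
rewrite /G; case: asboolP => _; last by rewrite preimage_set0.
have -> : f @^-1` B p = \bigcap_(i in [set: 'I_n])
    ((fun x => f x ord0 i - ratr (p.1 ord0 i)) @^-1`
       `](- p.2.+1%:R^-1), p.2.+1%:R^-1[%classic).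
  apply/seteqP; split=> [x Bx i _|x Bx i] /=.
    by rewrite in_itv/= -ltr_norml; exact: Bx.
  by have := Bx i I; rewrite /= in_itv/= -ltr_norml.
apply: fin_bigcap_measurable => // i _.
rewrite -[X in measurable X]setTI.
have : measurable_fun [set: T] (fun x => f x ord0 i - ratr (p.1 ord0 i)).
  by apply: measurable_funB => //; exact: mf.
by apply => //; exact: measurable_itv.
Qed.

End borel_rV_theory.

Section lebesgue_rV.
Context {R : realType}.

Definition cons_rV n (p : R * 'rV[R]_n) : 'rV[R]_n.+1 :=
  row_mx (const_mx p.1 : 'rV_1) p.2.

Lemma measurable_cons_rV n :
  measurable_fun [set: measurableTypeR R * 'rV[R]_n] (@cons_rV n).
Proof.
apply: measurable_fun_rV => i.
rewrite /cons_rV; under eq_fun do rewrite mxE.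
case: splitP => j _.
  by under eq_fun do rewrite mxE; exact: measurable_fst.
apply: (@measurableT_comp _ _ _ _ _ _ (fun v : 'rV[R]_n => v ord0 j)) => //.
by apply: continuous_measurable_rV; exact: coord_continuous.
Qed.

Section step.
Variables (n : nat) (mu : {sigma_finite_measure set 'rV[R]_n -> \bar R}).

Definition lebesgue_rVS : set 'rV[R]_n.+1 -> \bar R :=
  pushforward (lebesgue_measure \x mu)%E (@cons_rV n).

HB.instance Definition _ := Measure.copy lebesgue_rVS
  (measure_function_pushforward__canonical__measure_function_Measure
    (lebesgue_measure \x mu)%E (@measurable_cons_rV n)).

Let lebesgue_rVS_sigma_finite : sigma_finite [set: 'rV[R]_n.+1] lebesgue_rVS.
Proof.
have /sigma_finiteP[F [TF ndF Foo]] :=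
  sigma_finiteT (@lebesgue_measure R : {sigma_finite_measure set _ -> \bar R}).
have /sigma_finiteP[G [TG ndG Goo]] := sigma_finiteT mu.
pose h (v : 'rV[R]_n.+1) : measurableTypeR R * 'rV[R]_n :=
  (v ord0 ord0, \row_i v ord0 (rshift 1 i)).
have mh : measurable_fun [set: 'rV[R]_n.+1] h.
  apply/measurable_fun_pairP; split => /=.
    by apply: continuous_measurable_rV; exact: coord_continuous.
  apply: measurable_fun_rV => i; rewrite /comp/=; under eq_fun do rewrite mxE.
  by apply: continuous_measurable_rV; exact: coord_continuous.
have hK : cancel (@cons_rV n) h.
  move=> [x v]; rewrite /h /cons_rV; congr pair => /=.
    have := row_mxEl (const_mx x : 'rV[R]_1) v ord0 ord0.
    by rewrite (_ : lshift n ord0 = ord0 :> 'I_(1 + n)) ?mxE//; exact/val_inj.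
  by apply/rowP => i; rewrite mxE; exact: (@row_mxEr _ 1 1 n).
exists (fun k => h @^-1` (F k `*` G k)).
  apply/seteqP; split=> // v _.
  have [k _ Fk] : (\bigcup_k F k) (h v).1 by rewrite -TF.
  have [l _ Gl] : (\bigcup_k G k) (h v).2 by rewrite -TG.
  exists (maxn k l) => //; split.
  - by move: Fk; exact/subsetPset/ndF/leq_maxl.
  - by move: Gl; exact/subsetPset/ndG/leq_maxr.
move=> k; have [mF Fk] := Foo k; have [mG Gk] := Goo k; split.
  by rewrite -[X in measurable X]setTI; apply: mh => //; exact: measurableX.
rewrite /lebesgue_rVS /pushforward -comp_preimage.
rewrite (_ : h \o _ = id); last by apply/funext => p /=; rewrite hK.
rewrite preimage_id product_measure1E//.
by rewrite lte_mul_pinfty// ge0_fin_numE.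
Qed.

HB.instance Definition _ := Measure_isSigmaFinite.Build _ _ _ lebesgue_rVS
  lebesgue_rVS_sigma_finite.

End step.

(* The n-fold product of the one-dimensional Lebesgue measure. *)
Fixpoint lebesgue_rV n : {sigma_finite_measure set 'rV[R]_n -> \bar R} :=
  match n with
  | 0 => dirac (0 : 'rV[R]_0)
  | n'.+1 => lebesgue_rVS (lebesgue_rV n')
  end.

End lebesgue_rV.

Section euclidean.
Context {R : realType} {d : nat}.
Implicit Types x y : 'rV[R]_d.

Definition dotp x y : R := \sum_(i < d) x ord0 i * y ord0 i.

(* The library norm [`|x|] on ['rV_d] is the max norm. *)
Definition enorm x : R := Num.sqrt (dotp x x).

End euclidean.

Section levy_measures.
Context {R : realType} {d : nat}.

(* Measures on R^d minus the origin are encoded as Borel measures on R^d that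
   do not charge the origin. *)
Definition levy_class (alpha : R) (nu : {measure set 'rV[R]_d -> \bar R}) :=
  [/\ nu [set 0] = 0%E,
      (\int[nu]_(y in [set y | y != 0%R])
         (Num.min (enorm y ^+ 2) 1)%:E < +oo)%E,
      alpha%:E = ereal_inf [set s%:E | s in [set s : R | s < 2 /\
        (\int[nu]_(y in [set y | y != 0%R /\ (enorm y <= 1)%R])
           (enorm y `^ s)%:E < +oo)%E]],
      1 < alpha < 2 ->
        (\int[nu]_(y in [set y | (1 < enorm y)%R]) (enorm y)%:E < +oo)%E
    & alpha = 1 -> forall r1 r2 : R, 0 < r1 -> r1 < r2 -> forall i : 'I_d,
        (\int[nu]_(y in [set y | (r1 < enorm y <= r2)%R])
           (y ord0 i)%:E = 0)%E].

Definition levy_tail (nu : {measure set 'rV[R]_d -> \bar R}) (r : R) : \bar R :=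
  nu [set y | r < enorm y].

(* Tails of measures in [levy_class] are finite, so [fine] loses nothing. *)
Definition levy_scale (nu : {measure set 'rV[R]_d -> \bar R}) (r : R) : R :=
  (fine (levy_tail nu r))^-1.

End levy_measures.

Section orv.
Context {R : realType}.
Implicit Type w : R -> R.

Definition orv_r1 w (e : R) : \bar R :=
  limf_esup (fun x : R => (w (e * x) / w x)%:E) 0^'+.

Definition orv_at_zero w := forall e : R, 0 < e -> (orv_r1 w e < +oo)%E.

(* Both limits exist whenever [w] is positive, monotone and O-RV at zero. *)
Definition orv_p1 w : R := lim (ln (fine (orv_r1 w e)) / ln e @[e --> 0^'+]).

Definition orv_q1 w : R := lim (ln (fine (orv_r1 w e)) / ln e @[e --> +oo]).

Definition cond_A (alpha : R) w :=
  [/\ alpha < 1 -> [/\ 0 < orv_p1 w, orv_p1 w <= orv_q1 w & orv_q1 w < 1],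
      alpha = 1 -> [/\ 1 <= orv_p1 w, orv_p1 w <= orv_q1 w & orv_q1 w < 2]
    & 1 < alpha -> [/\ 1 < orv_p1 w, orv_p1 w <= orv_q1 w & orv_q1 w < 2]].

Definition cond_C w := exists N0 : R, 2 < N0 /\
  (\int[lebesgue_measure]_(t in `[1%R, +oo[)
     (w t `^ (orv_q1 w)^-1 / t `^ N0)%:E < +oo)%E.

End orv.

Section smooth.
Context {R : realType} {d : nat}.
Implicit Type f : 'rV[R]_d -> R.

Definition partial (s : seq 'I_d) f : 'rV[R]_d -> R :=
  foldr (fun i g => 'D_(delta_mx ord0 i) g) f s.

(* All iterated partial derivatives exist and are Frechet differentiable, which
   is equivalent to being C^infinity; ['D_v] is total, hence the explicit
   differentiability requirement at each stage. *)
Definition smooth f := forall s x, differentiable (partial s f) x.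

Definition Cb_infty f := smooth f /\ forall s, bounded_fun (partial s f).

Definition supp f : set 'rV[R]_d := closure [set x | f x != 0].

End smooth.

Section fourier.
Context {R : realType} {d : nat}.
Local Open Scope complex_scope.

Definition expi (t : R) : R[i] := cos t +i* sin t.

Definition cintegral (f : 'rV[R]_d -> R[i]) : R[i] :=
  (\int[lebesgue_rV d]_x complex.Re (f x)) +i*
  (\int[lebesgue_rV d]_x complex.Im (f x)).

(* Inverse of f |-> (xi |-> \int e^(- i 2 pi x.xi) f(x) dx). *)
Definition inv_fourier (f : 'rV[R]_d -> R[i]) (x : 'rV[R]_d) : R[i] :=
  cintegral (fun xi => expi (2 * pi * dotp x xi) * f xi).

Definition convolution (u : 'rV[R]_d -> R) (f : 'rV[R]_d -> R[i])
    (x : 'rV[R]_d) : R[i] :=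
  cintegral (fun y => (u (x - y))%:C * f y).

End fourier.

Section littlewood_paley.
Context {R : realType} {d : nat}.
Local Open Scope complex_scope.

(* The last clause is the sum over all integers j of phi (N^(-j) xi); [\esum]
   is meant for nonnegative terms, and phi >= 0 follows from the other
   clauses. *)
Definition lp_generator (N : R) (phi : 'rV[R]_d -> R) :=
  [/\ smooth phi,
      compact (supp phi),
      supp phi = [set xi | N^-1 <= enorm xi <= N],
      (forall xi, (supp phi)° xi -> 0 < phi xi)
    & forall xi, xi != 0 ->
        \esum_(j in [set: int]) (phi ((N ^ (- j)) *: xi))%:E = 1%E].

Definition lp_symbol (N : R) (phi : 'rV[R]_d -> R) (j : nat)
    (xi : 'rV[R]_d) : R :=
  if j is 0%N then 1 - limn (fun n => \sum_(1 <= k < n) phi (N ^- k *: xi))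
  else phi (N ^- j *: xi).

(* phi is not assumed even, so the kernels are complex-valued in general. *)
Definition lp_kernel (N : R) (phi : 'rV[R]_d -> R) (j : nat) :
    'rV[R]_d -> R[i] :=
  inv_fourier (fun xi => (lp_symbol N phi j xi)%:C).

End littlewood_paley.

(* The norms are extended-real suprema, so that an infinite supremum is not
   confused with a finite value. *)
Section norms.
Context {R : realType} {d : nat}.
Implicit Types (w : R -> R) (u : 'rV[R]_d -> R).

Definition sup_norm u : \bar R := ereal_sup [set `|u x|%:E | x in setT].

Definition holder_seminorm w (beta : R) u : \bar R :=
  ereal_sup [set (`|u (p.1 + p.2) - u p.1| / w (enorm p.2) `^ beta)%:E
            | p in [set p : 'rV[R]_d * 'rV[R]_d | p.2 != 0]].

Definition holder_norm w (beta : R) u : \bar R :=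
  (sup_norm u + holder_seminorm w beta u)%E.

Definition besov_norm w (beta N : R) (phi : 'rV[R]_d -> R) u : \bar R :=
  ereal_sup [set ((w (N ^- j) `^ (- beta))%:E *
    sup_norm (fun x => ComplexField.Normc.normc (convolution u (lp_kernel N phi j) x)))%E
    | j in [set: nat]].

End norms.

(* Main.v *)
Require Import Defs.
From mathcomp Require Import all_boot all_order all_algebra.
From mathcomp Require Import all_classical all_reals all_analysis.
From mathcomp Require Import measurable_realfun complex ring lra.

Set Implicit Arguments.
Unset Strict Implicit.
Unset Printing Implicit Defensive.

Import Order.TTheory GRing.Theory Num.Theory.
Import numFieldNormedType.Exports.

Local Open Scope classical_set_scope.
Local Open Scope ring_scope.

(* Write M_j for the sup norm of u * phi_j and chi for the symbol of phi_0, so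
   that phi_j is a difference of two dilates of the kernel of chi. That kernel has
   integral chi(0) = 1 and decays faster than any power.

   Besov norm <= Hoelder norm: as phi_j has integral zero for j >= 1, M_j is at
   most the integral of |u(x - y) - u(x)| |phi_j(y)|. Since w(e x) <= C e^q w(x) for
   e >= 1, with beta q < 1, the increment is at most
   C |u|_beta w(N^-j)^beta (1 + N^j |y|).

   Hoelder norm <= Besov norm: u is the sum of the u * phi_j. Since phi_j is
   reproduced by convolution with a dilate of the kernel of chi, the increment of
   u * phi_j over h is at most C M_j (N^j |h|)^t with beta q < t < 1, and also at
   most 2 M_j. If N^-k is comparable to |h|, the first bound for j <= k and the
   second for j > k, together with w(e x) <= C e^p w(x) for e <= 1, bound the j-th
   increment by w(|h|)^beta times a two-sided geometric sequence in j - k. *)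

(** * Lebesgue integration on row vectors *)

(** The resolution of u rests on Fourier inversion for chi: the partial sum up to j = J is the
    convolution of u with the kernel of chi(N^-J .), an approximate identity because that kernel has
    integral chi(0) = 1. Inversion is proved with Abel means built from products of one-dimensional
    kernels, so that it reduces to explicit integrals on the line.

    As phi need not be even, the kernels are complex. They are carried as cosine integrals with a
    free phase: the phases 0 and -pi/2 give the real and imaginary parts, and the real part of a
    complex convolution is a difference of two real ones.

    The exponents q and p are not the indices. The index q_1 is an infimum that may not be attained,
    so q is taken strictly between q_1 and 1/beta; from p_1 > 0 only some positive p is extracted.
    The resulting bounds hold near zero and are extended to (0, 1] by monotonicity; increments over
    longer distances are bounded by twice the sup norm. Kernels are estimated in the max norm while
    w is evaluated at the Euclidean norm; the two differ by a factor of at most d. *)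

Section integration.
Context {R : realType}.
Notation mu := (@lebesgue_measure R).

Lemma ge0_integral_rVS n (f : 'rV[R]_n.+1 -> \bar R) :
  measurable_fun setT f -> (forall x, 0 <= f x)%E ->
  (\int[lebesgue_rV n.+1]_x f x =
   \int[mu]_x \int[lebesgue_rV n]_v f (cons_rV (x, v)))%E.
Proof.
move=> mf f0.
rewrite [LHS](_ : _ = \int[pushforward (mu \x lebesgue_rV n)%E (@cons_rV R
  n)]_x f x)%E//.
rewrite ge0_integral_pushforward//=; last exact: measurable_cons_rV.
rewrite preimage_setT fubini_tonelli1//.
apply: measurableT_comp => //; exact: measurable_cons_rV.
Qed.

Lemma measurable_slice_rV n (f : 'rV[R]_n.+1 -> \bar R) :
  measurable_fun setT f -> (forall x, 0 <= f x)%E ->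
  measurable_fun [set: measurableTypeR R]
    (fun x => \int[lebesgue_rV n]_v f (cons_rV (x, v)))%E.
Proof.
move=> mf f0.
apply: (measurable_fun_fubini_tonelli_F (m2 := lebesgue_rV n)
  (fun p : measurableTypeR R * 'rV[R]_n => f (cons_rV p))) => //.
apply: measurableT_comp => //; exact: measurable_cons_rV.
Qed.

(** Uniqueness of Lebesgue measure: [c] times the image measure under x |-> c x + a gives every
    half-open interval its length. *)
Lemma lebesgue_measure_affine (c a : R) (A : set R) : 0 < c -> measurable A ->
  (c%:E * mu ((fun x => c * x + a)%R @^-1` A) = mu A)%E.
Proof.
move=> c0 mA.
have maff : measurable_fun [set: measurableTypeR R] (fun x : measurableTypeR R
  => c * x + a : measurableTypeR R).
  apply: continuous_measurable_fun => x; apply: cvgD; last exact: cvg_cst.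
  by apply: cvgM; [exact: cvg_cst|exact: cvg_id].
pose nu0 := pushforward mu (fun x : measurableTypeR R =>
  c * x + a : measurableTypeR R).
pose nu1 : {measure set (measurableTypeR R) -> \bar R} :=
  measure_function_pushforward__canonical__measure_function_Measure mu maff.
pose nu2 := mscale (NngNum (ltW c0)) nu1.
have -> : (c%:E * mu ((fun x => c * x + a)%R @^-1` A))%E = nu2 A by [].
apply/esym/lebesgue_measure_unique => // _ [[p q]] _ <-.
rewrite /nu2/= /mscale/= /nu0 /pushforward.
rewrite (_ : _ @^-1` _ = `](p - a) / c, (q - a) / c]%classic); last first.
  apply/seteqP; split => x /=; rewrite !in_itv/= ltr_pdivrMr// ler_pdivlMr//;
  by rewrite ltrBlDr lerBrDr mulrC.
rewrite !lebesgue_measure_itv/= !lte_fin ltr_pM2r ?invr_gt0// ltrD2r.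
case: ifPn => _; last by rewrite mule0.
rewrite -EFinB -EFinM; congr EFin; field; exact: lt0r_neq0.
Qed.

Lemma ge0_integral_affine (c a : R) (f : R -> \bar R) : 0 < c ->
  measurable_fun [set: R] f -> (forall x, 0 <= f x)%E ->
  (c%:E * \int[mu]_x f (c * x + a)%R = \int[mu]_x f x)%E.
Proof.
move=> c0 mf f0.
have maff : measurable_fun [set: measurableTypeR R] (fun x : measurableTypeR R
  => c * x + a : measurableTypeR R).
  apply: continuous_measurable_fun => x; apply: cvgD; last exact: cvg_cst.
  by apply: cvgM; [exact: cvg_cst|exact: cvg_id].
pose nu0 := pushforward mu (fun x : measurableTypeR R =>
  c * x + a : measurableTypeR R).
pose nu1 : {measure set (measurableTypeR R) -> \bar R} :=
  measure_function_pushforward__canonical__measure_function_Measure mu maff.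
have -> : (\int[mu]_x f (c * x + a)%R = \int[nu1]_x f x)%E.
  by rewrite /nu1/= ge0_integral_pushforward//= preimage_setT.
rewrite -(@ge0_integral_mscale _ _ _ nu1 setT measurableT (NngNum (ltW c0)))//.
apply: eq_measure_integral => // A mA _.
exact: lebesgue_measure_affine.
Qed.

Lemma cons_rV_affine n (c x : R) (v : 'rV[R]_n) (a : 'rV[R]_n.+1) :
  c *: cons_rV (x, v) + a =
  cons_rV (c * x + a ord0 ord0, c *: v + \row_i a ord0 (rshift 1 i)).
Proof.
apply/rowP => i; rewrite /cons_rV/= !mxE.
case: splitP => j ij; rewrite !mxE; congr (_ + a _ _); apply/val_inj;
  by rewrite /= ij// ord1.
Qed.

Lemma continuous_affine_rV n (c : R) (a : 'rV[R]_n) :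
  continuous (fun x : 'rV[R]_n => c *: x + a).
Proof.
move=> x; apply: (@continuousD R _ _ (GRing.scale c) (cst a) x);
  last exact: cst_continuous.
exact: scaler_continuous.
Qed.

Lemma measurable_affine_rV n (c : R) (a : 'rV[R]_n) :
  measurable_fun [set: 'rV[R]_n] (fun x : 'rV[R]_n => c *: x + a).
Proof.
apply: measurable_fun_rV => i; apply: continuous_measurable_rV => x.
apply: (@continuous_comp _ _ _ (fun x : 'rV[R]_n =>
  c *: x + a) (fun v : 'rV[R]_n => v ord0 i)).
  exact: continuous_affine_rV.
exact: coord_continuous.
Qed.

(** The map acts on each coordinate separately, so peeling off coordinates reduces to the line; the
    Jacobian is one factor [c] per coordinate. *)
Lemma ge0_integral_rV_affine n (c : R) (a : 'rV[R]_n) (f : 'rV[R]_n -> \bar R) :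
  0 < c -> measurable_fun setT f -> (forall x, 0 <= f x)%E ->
  ((c ^+ n)%:E * \int[lebesgue_rV n]_x f (c *: x + a)%R =
   \int[lebesgue_rV n]_x f x)%E.
Proof.
move=> c0; elim: n a f => [|n IH] a f mf f0.
  rewrite expr0 mul1e; apply: eq_integral => x _; congr f.
  by apply/rowP => -[].
have mfa : measurable_fun setT (fun x : 'rV[R]_n.+1 => f (c *: x + a)).
  by apply: measurableT_comp => //; exact: measurable_affine_rV.
rewrite ge0_integral_rVS// (ge0_integral_rVS mf)//.
rewrite -[RHS](ge0_integral_affine (a ord0 ord0) c0); last 2 first.
  exact: (measurable_slice_rV mf f0).
  by move=> x; exact: integral_ge0.
rewrite exprS EFinM -muleA; congr (_ * _)%E.
rewrite -ge0_integralZl//; last 3 first.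
- exact: (measurable_slice_rV mfa).
- by move=> x _; exact: integral_ge0.
- by rewrite lee_fin exprn_ge0// ltW.
apply: eq_integral => x _.
rewrite -(IH (\row_i a ord0 (rshift 1 i)) (fun v =>
  f (cons_rV (c * x + a ord0 ord0, v))))//.
  congr (_ * _)%E; apply: eq_integral => v _.
  by rewrite cons_rV_affine.
apply: measurableT_comp => //.
exact: (measurableT_comp (@measurable_cons_rV R n) (measurable_pair1 _)).
Qed.

End integration.

(** * Product weights and the integration of decaying functions *)

Section weight.
Context {R : realType}.
Notation mu := (@lebesgue_measure R).

(** Takes the place of powers of 1 + |x|: it dominates the norm, and as a product over coordinates
    it has a reciprocal whose integral is computed by induction on the dimension. *)
Definition weight n (x : 'rV[R]_n) : R := \prod_(i < n) (1 + x ord0 i ^+ 2).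

Lemma weight_ge1 n (x : 'rV[R]_n) : 1 <= weight x.
Proof.
rewrite /weight; elim/big_ind : _ => // [a b a1 b1|i _].
  by rewrite -[1]mulr1 ler_pM.
by rewrite lerDl sqr_ge0.
Qed.

Lemma weight_gt0 n (x : 'rV[R]_n) : 0 < weight x.
Proof. exact: lt_le_trans (weight_ge1 x). Qed.

Lemma continuous_weight n : continuous (@weight n).
Proof.
apply: continuous_big => [|i _ x]; first exact: mul_continuous.
apply: (@continuousD R R _ (cst 1) (fun x : 'rV[R]_n => x ord0 i ^+ 2)).
  exact: cst_continuous.
apply: (@continuous_comp _ _ _ (fun v : 'rV[R]_n => v ord0 i) (fun x : R =>
  x ^+ 2)).
  exact: coord_continuous.
exact: exprn_continuous.
Qed.

Lemma measurable_weightV n : measurable_fun [set: 'rV[R]_n] (fun x =>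
  (weight x)^-1).
Proof.
apply: continuous_measurable_rV => x; apply: continuousV.
  exact: lt0r_neq0 (weight_gt0 x).
exact: continuous_weight.
Qed.

Lemma weight_cons n x (v : 'rV[R]_n) :
  weight (cons_rV (x, v)) = (1 + x ^+ 2) * weight v.
Proof.
rewrite /weight (big_ord_recl n) /cons_rV/=; congr (_ * _).
  by rewrite mxE; case: splitP => j jE; rewrite ?mxE// ; case: j jE => -[].
apply: eq_bigr => i _; congr (1 + _ ^+ 2).
rewrite (_ : lift _ _ = rshift 1 i :> 'I_(1 + n)); last exact/val_inj.
by rewrite (@row_mxEr _ 1 1 n).
Qed.

Lemma integral_oneDsqrV : (\int[mu]_x ((1 + x ^+ 2)^-1)%:E = pi%:E)%E.
Proof.
rewrite ge0_symfun_integralT; last 3 first.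
- by move=> x; rewrite invr_ge0 addr_ge0// sqr_ge0.
- exact: continuous_oneDsqrV.
- by move=> x /=; rewrite sqrrN.
by rewrite -set_itvcy integral0y_oneDsqr -EFinM mulrC divfK.
Qed.

Lemma integral_weightV n : (\int[lebesgue_rV n]_x ((weight x)^-1)%:E = (pi ^+
  n)%:E)%E.
Proof.
elim: n => [|n IH].
  rewrite /= integral_dirac//; last first.
    by apply/measurable_EFinP; exact: measurable_weightV.
  by rewrite diracT mul1e /weight big_ord0 invr1 expr0.
rewrite ge0_integral_rVS; last 2 first.
- by apply/measurable_EFinP; exact: measurable_weightV.
- by move=> x; rewrite lee_fin invr_ge0 ltW// weight_gt0.
under eq_integral => x _.
  under eq_integral => v _ do rewrite weight_cons invfM EFinM.
  rewrite ge0_integralZl//; last 3 first.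
  - by apply/measurable_EFinP; exact: measurable_weightV.
  - by move=> v _; rewrite lee_fin invr_ge0 ltW// weight_gt0.
  - by rewrite lee_fin invr_ge0 addr_ge0// sqr_ge0.
  rewrite IH.
  over.
rewrite ge0_integralZr//; last 3 first.
- apply/measurable_EFinP; apply: continuous_measurable_fun.
  exact: continuous_oneDsqrV.
- by move=> v _; rewrite lee_fin invr_ge0 addr_ge0// sqr_ge0.
- by rewrite lee_fin exprn_ge0// pi_ge0.
by rewrite integral_oneDsqrV -EFinM exprS.
Qed.

Definition decaying n (f : 'rV[R]_n -> R) := measurable_fun setT f /\
  exists C, forall x, `|f x| <= C / weight x.

Lemma integrable_weightV n C :
  (lebesgue_rV n).-integrable setT (EFin \o (fun x => C / weight x)).
Proof.
apply/integrableP; split.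
  apply/measurable_EFinP; apply: measurable_funM => //;
    exact: measurable_weightV.
under eq_integral => x _.
  rewrite /= normrM (ger0_norm (_ : 0 <= (weight x)^-1));
    last by rewrite invr_ge0 ltW// weight_gt0.
  rewrite EFinM; over.
rewrite ge0_integralZl//; last 2 first.
- by apply/measurable_EFinP; exact: measurable_weightV.
- by move=> v _; rewrite lee_fin invr_ge0 ltW// weight_gt0.
by rewrite integral_weightV -EFinM ltry.
Qed.

Lemma integrable_decaying n (f : 'rV[R]_n -> R) : decaying f ->
  (lebesgue_rV n).-integrable setT (EFin \o f).
Proof.
move=> [mf [C fC]]; apply: (le_integrable _ _ _ (@integrable_weightV n C)) =>
  //.
  exact/measurable_EFinP.
move=> x _ /=; rewrite lee_fin (le_trans (fC x))// ler_norm//.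
Qed.

Lemma Rintegral_weightV n C : \int[lebesgue_rV n]_x (C / weight x) = C * pi ^+
  n.
Proof.
rewrite RintegralZl//; last first.
  by have := @integrable_weightV n 1; apply: eq_integrable => // x _ /=;
    rewrite mul1r.
by rewrite /Rintegral integral_weightV.
Qed.

Lemma le_Rintegral_decaying n (f : 'rV[R]_n -> R) C :
  measurable_fun setT f -> (forall x, `|f x| <= C / weight x) ->
  `|\int[lebesgue_rV n]_x f x| <= C * pi ^+ n.
Proof.
move=> mf fC; have df : decaying f by split => //; exists C.
apply: (le_trans (le_normr_Rintegral _ _)) => //;
  first exact: integrable_decaying.
rewrite -Rintegral_weightV; apply: le_Rintegral => //.
  apply: integrable_decaying; split; first exact: measurableT_comp.
  by exists C => x; rewrite normr_id.
exact: integrable_weightV.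
Qed.

(** Finite products force [A] and [B] to be finite, as [k] is positive. This carries the change of
    variables from positive and negative parts to real-valued integrals. *)
Lemma fine_mulB (k : R) (A B A' B' : \bar R) : 0 < k ->
  (k%:E * A)%E = A' -> (k%:E * B)%E = B' ->
  A' \is a fin_num -> B' \is a fin_num -> k * fine (A - B) = fine (A' - B').
Proof.
move=> k0 <- <-; case: A => [x||]; case: B => [y||];
  rewrite ?gt0_muley ?gt0_muleNy ?lte_fin// => _ _.
by rewrite -EFinB -!EFinM -EFinB/= mulrBr.
Qed.

Lemma Rintegral_affine n (c : R) (a : 'rV[R]_n) (f : 'rV[R]_n -> R) :
  0 < c -> (lebesgue_rV n).-integrable setT (EFin \o f) ->
  c ^+ n * \int[lebesgue_rV n]_x f (c *: x + a) = \int[lebesgue_rV n]_x f x.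
Proof.
move=> c0 fi; have mf : measurable_fun setT (EFin \o f) by case/integrableP :
  fi.
have ffin := integrable_pos_fin_num measurableT fi.
have ffin' := integrable_neg_fin_num measurableT fi.
have Ep := ge0_integral_rV_affine a c0 (measurable_funepos mf) (funepos_ge0 _).
have En := ge0_integral_rV_affine a c0 (measurable_funeneg mf) (funeneg_ge0 _).
rewrite /Rintegral [in LHS]integralE [in RHS]integralE.
under [X in (X - _)%E]eq_integral do rewrite (funepos_comp (EFin \o f) (fun x
  => c *: x + a)).
under [X in (_ - X)%E]eq_integral do rewrite (funeneg_comp (EFin \o f) (fun x
  => c *: x + a)).
by apply: (fine_mulB _ Ep En) => //; exact: exprn_gt0.
Qed.

Lemma Rintegral_translate n (a : 'rV[R]_n) (f : 'rV[R]_n -> R) :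
  (lebesgue_rV n).-integrable setT (EFin \o f) ->
  \int[lebesgue_rV n]_x f (x + a) = \int[lebesgue_rV n]_x f x.
Proof.
move=> fi; rewrite -(Rintegral_affine a ltr01 fi) expr1n mul1r.
by under [in RHS]eq_Rintegral do rewrite scale1r.
Qed.

Lemma integrable_affine n (c : R) (a : 'rV[R]_n) (f : 'rV[R]_n -> R) :
  0 < c -> (lebesgue_rV n).-integrable setT (EFin \o f) ->
  (lebesgue_rV n).-integrable setT (EFin \o (fun x => f (c *: x + a))).
Proof.
move=> c0 /integrableP[mf fi]; apply/integrableP; split.
  by apply: (measurableT_comp mf); exact: measurable_affine_rV.
have c0n : 0 < c ^+ n by exact: exprn_gt0.
have m : measurable_fun setT (abse \o (EFin \o f)) by exact: measurableT_comp.
have := ge0_integral_rV_affine a c0 m (fun x => abse_ge0 _).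
move: fi => /[swap] /= <-; case: (\int[_]__ _)%E => [r||]//.
  by move=> _; exact: ltry.
by rewrite gt0_muley// lte_fin.
Qed.

(** Peetre's inequality for this weight. In each coordinate 2 (1 + a^2) (1 + b^2) exceeds 1 + (a +
    b)^2 by a sum of squares plus 1. *)
Lemma weightD n (x y : 'rV[R]_n) : weight (x + y) <= 2 ^+ n * (weight x *
  weight y).
Proof.
rewrite /weight -[X in _ ^+ X](card_ord n) -prodr_const -!big_split/=.
apply: ler_prod => i _; rewrite mxE; apply/andP; split.
  by rewrite addr_ge0// sqr_ge0.
set a := x _ _; set b := y _ _.
rewrite -subr_ge0 (_ : _ - _ = 1 + (a - b) ^+ 2 + 2 * (a * b) ^+ 2);
  last by ring.
by apply: addr_ge0; [apply: addr_ge0 => //;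
  exact: sqr_ge0|apply: mulr_ge0 => //; exact: sqr_ge0].
Qed.

Lemma weightN n (x : 'rV[R]_n) : weight (- x) = weight x.
Proof. by apply: eq_bigr => i _; rewrite mxE sqrrN. Qed.

Lemma norm_le_weight n (x : 'rV[R]_n) : `|x| <= weight x.
Proof.
rewrite [leLHS]/Num.Def.normr/= mx_normrE; apply: bigmax_le;
  first exact: ltW (weight_gt0 x).
move=> [i j] _ /=; rewrite ord1.
rewrite /weight (bigD1 j)//=.
apply: (@le_trans _ _ (1 + x ord0 j ^+ 2)).
  rewrite -[X in 1 + X]real_normK ?num_real//; set a := `|_|.
  rewrite -subr_ge0 (_ : _ - _ = (a - 2^-1) ^+ 2 + 3 / 4); last by field.
  by rewrite addr_ge0 ?sqr_ge0.
rewrite ler_peMr ?addr_ge0 ?sqr_ge0//.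
elim/big_ind : _ => // [a b a1 b1|k _].
  by rewrite -[1]mulr1 ler_pM.
by rewrite lerDl sqr_ge0.
Qed.

End weight.

(** * Fubini for real integrands dominated by a product of one-variable functions *)

Section dominated_products.
Context d1 d2 (T1 : measurableType d1) (T2 : measurableType d2) (R : realType).
Variables (m1 : {sigma_finite_measure set T1 -> \bar R})
          (m2 : {sigma_finite_measure set T2 -> \bar R}).
Variables (f : T1 -> T2 -> R) (a : T1 -> R) (b : T2 -> R).
Hypothesis mf : measurable_fun [set: T1 * T2] (fun p => f p.1 p.2).
Hypothesis ia : m1.-integrable setT (EFin \o a).
Hypothesis ib : m2.-integrable setT (EFin \o b).
Hypothesis fab : forall x y, `|f x y| <= a x * b y.

(** The bound holds at every point, so every slice is integrable and not just almost every one; the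
    real inner integrals are never default values. *)
Lemma integrable_slice1 x : m2.-integrable setT (EFin \o f x).
Proof.
have := @integrableZl _ _ _ m2 setT measurableT (a x) _ ib.
apply: le_integrable => //.
  by apply/measurable_EFinP; exact: (measurableT_comp mf (measurable_pair1 x)).
by move=> y _ /=; rewrite lee_fin (le_trans (fab x y))// ler_norm.
Qed.

Lemma integrable_slice2 y : m1.-integrable setT (EFin \o f ^~ y).
Proof.
have := @integrableZr _ _ _ m1 setT measurableT (b y) _ ia.
apply: le_integrable => //.
  by apply/measurable_EFinP; exact: (measurableT_comp mf (measurable_pair2 y)).
by move=> x _ /=; rewrite lee_fin (le_trans (fab x y))// ler_norm.
Qed.

Lemma integrable_dominated_prod :
  (m1 \x m2)%E.-integrable setT (fun p => (f p.1 p.2)%:E).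
Proof.
apply/integrable12ltyP; first exact/measurable_EFinP.
have ianorm : m1.-integrable setT (fun x => `|a x|%:E).
  exact: (integrable_abse ia).
apply: (@le_lt_trans _ _ (\int[m1]_x ((`|a x|)%:E * \int[m2]_y `|b y|%:E))%E).
  apply: ge0_le_integral => //.
  - by move=> x _; exact: integral_ge0.
  - apply: (@measurable_fun_fubini_tonelli_F _ _ _ _ _ m2 (fun p =>
    `|(f p.1 p.2)%:E|%E)) => //.
    by apply: measurableT_comp => //; exact/measurable_EFinP.
  - apply: emeasurable_funM => //; exact: measurable_int ianorm.
  - move=> x _; rewrite -ge0_integralZl//; last first.
      exact: measurable_int (integrable_abse ib).
    apply: ge0_le_integral => //.
    + by apply: measurableT_comp => //; exact: measurable_int
      (integrable_slice1 x).
    + by apply: emeasurable_funM => //; exact: measurable_int (integrable_abse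
      ib).
    + move=> y _; rewrite -EFinM lee_fin (le_trans (fab x y))//.
      by rewrite -normrM ler_norm.
have fb : (\int[m2]_y `|b y|%:E)%E \is a fin_num.
  exact: (integrable_fin_num measurableT (integrable_abse ib)).
rewrite -(fineK fb) ge0_integralZr//; last 2 first.
- exact: measurable_int ianorm.
- by rewrite lee_fin fine_ge0// integral_ge0.
have fa := integrable_fin_num measurableT ianorm.
by rewrite -(fineK fa) -EFinM ltry.
Qed.

Lemma RintegralE1 :
  \int[m1]_x \int[m2]_y f x y = fine (\int[m1 \x m2]_p (f p.1 p.2)%:E)%E.
Proof.
rewrite -(integral12_prod_meas1 integrable_dominated_prod)/fubini_F/=.
congr fine; apply: eq_integral => x _; rewrite /Rintegral fineK//.
exact: (integrable_fin_num measurableT (integrable_slice1 x)).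
Qed.

Lemma RintegralE2 :
  \int[m2]_y \int[m1]_x f x y = fine (\int[m1 \x m2]_p (f p.1 p.2)%:E)%E.
Proof.
rewrite -(integral21_prod_meas1 integrable_dominated_prod)/fubini_G/=.
congr fine; apply: eq_integral => y _; rewrite /Rintegral fineK//.
exact: (integrable_fin_num measurableT (integrable_slice2 y)).
Qed.

Lemma Rintegral_Fubini :
  \int[m1]_x \int[m2]_y f x y = \int[m2]_y \int[m1]_x f x y.
Proof. by rewrite RintegralE1 RintegralE2. Qed.

End dominated_products.

Section steps.
Context {R : realType}.
Notation mu := (@lebesgue_measure R).

Lemma Rintegral_rVS n (f : 'rV[R]_n.+1 -> R) a b :
  measurable_fun setT f -> mu.-integrable setT (EFin \o a) ->
  (lebesgue_rV n).-integrable setT (EFin \o b) ->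
  (forall x v, `|f (cons_rV (x, v))| <= a x * b v) ->
  \int[lebesgue_rV n.+1]_x f x =
   \int[mu]_x \int[lebesgue_rV n]_v f (cons_rV (x, v)).
Proof.
move=> mf ia ib fab.
have mfc : measurable_fun [set: measurableTypeR R * 'rV[R]_n]
    (fun p => f (cons_rV (p.1, p.2))).
  rewrite (_ : (fun p => _) = f \o @cons_rV R n); last by apply/funext => -[].
  apply: measurableT_comp => //; exact: measurable_cons_rV.
rewrite (RintegralE1 mfc ia ib fab) /Rintegral; congr fine.
rewrite [LHS](_ : _ = \int[pushforward (mu \x lebesgue_rV n)%E (@cons_rV R
  n)]_x (f x)%:E)%E//.
rewrite integral_pushforward//.
- exact: measurable_cons_rV.
- exact/measurable_EFinP.
- rewrite preimage_setT (_ : (_ \o _) = fun p => (f (cons_rV (p.1, p.2)))%:E);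
  last first.
    by apply/funext => -[].
  exact: (integrable_dominated_prod mfc ia ib fab).
Qed.

Lemma Rintegral_cvg n (f_ : nat -> 'rV[R]_n -> R) (f : 'rV[R]_n -> R) C :
  (forall k, measurable_fun setT (f_ k)) ->
  (forall x, f_ ^~ x @ \oo --> f x) ->
  (forall k x, `|f_ k x| <= C / weight x) ->
  \int[lebesgue_rV n]_x f_ k x @[k --> \oo] --> \int[lebesgue_rV n]_x f x.
Proof.
move=> mf_ f_f f_C.
have mf : measurable_fun setT f.
  by apply: (@measurable_fun_cvg _ _ _ _ f_) => // x _; exact: f_f.
have fC x : `|f x| <= C / weight x.
  by apply: (cvgr_to_le (cvg_norm (@f_f x))); exact: nearW.
have intf : (lebesgue_rV n).-integrable setT (EFin \o f).
  by apply: integrable_decaying; split => //; exists C.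
have intf_ k : (lebesgue_rV n).-integrable setT (EFin \o f_ k).
  by apply: integrable_decaying; split => //; exists C.
apply: fine_cvg; rewrite fineK; last exact: (integrable_fin_num measurableT
  intf).
apply: (@dominated_cvg _ _ _ (lebesgue_rV n) setT measurableT
  (fun k x => (f_ k x)%:E) (fun x => (f x)%:E) (fun x => (C / weight x)%:E)) =>
    //.
- by move=> k; exact/measurable_EFinP.
- by move=> x _; apply/cvg_EFin; [exact: nearW|exact: f_f].
- exact: integrable_weightV.
- by move=> k x _; rewrite lee_fin.
Qed.

End steps.

(** * Iterated partial derivatives *)

Section calculus.
Context {R : realType} {n : nat}.
Implicit Types (f g : 'rV[R]_n -> R) (s : seq 'I_n).

Lemma derive_affine f (c : R) (a v x : 'rV[R]_n) : differentiable f (c *: x +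
  a) ->
  'D_v (fun x => f (c *: x + a)) x = c * 'D_v f (c *: x + a).
Proof.
move=> df.
have dA : is_diff x (fun x : 'rV[R]_n => c *: x + a) (fun v => c *: v).
  by apply: is_diff_eq; apply/funext => y /=; rewrite fctE addr0.
have dc : differentiable (fun x => f (c *: x + a)) x.
  exact: (@differentiable_comp _ _ _ _ (fun x => c *: x + a) f).
rewrite (deriveE v dc).
by rewrite (@diff_comp _ _ _ _ (fun x =>
  c *: x + a) f)//= diff_val linearZ -deriveE.
Qed.

Lemma differentiable_comp_affine f (c : R) (a x : 'rV[R]_n) :
  differentiable f (c *: x + a) -> differentiable (fun x => f (c *: x + a)) x.
Proof.
by move=> df; apply: (@differentiable_comp _ _ _ _ (fun x => c *: x + a) f).
Qed.

Lemma partial_affine f s (c : R) (a : 'rV[R]_n) : smooth f ->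
  partial s (fun x => f (c *: x + a)) = (fun x =>
    c ^+ size s * partial s f (c *: x + a)).
Proof.
move=> sf; elim: s => [|i s IH] /=; first by apply/funext => x;
  rewrite expr0 mul1r.
rewrite -/(partial s _) IH; apply/funext => x.
have dg : derivable (fun x => partial s f (c *: x + a)) x (delta_mx ord0 i).
  exact/diff_derivable/differentiable_comp_affine.
transitivity (c ^+ size s * 'D_(delta_mx ord0 i) (fun x =>
  partial s f (c *: x + a)) x).
  exact: (deriveZ _ dg).
by rewrite derive_affine// exprS mulrCA mulrA.
Qed.

Lemma partialB f g s : smooth f -> smooth g ->
  partial s (fun x => f x - g x) = (fun x => partial s f x - partial s g x).
Proof.
move=> sf sg; elim: s => [//|i s IH] /=.
rewrite -/(partial s _) IH; apply/funext => x.
by rewrite (@deriveB _ _ _ (partial s f) (partial s g))//; exact/diff_derivable.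
Qed.

Lemma smoothB f g : smooth f -> smooth g -> smooth (fun x => f x - g x).
Proof. by move=> sf sg s x; rewrite partialB//; exact: differentiableB. Qed.

Lemma smooth_affine f (c : R) (a : 'rV[R]_n) : smooth f -> smooth (fun x =>
  f (c *: x + a)).
Proof.
move=> sf s x; rewrite partial_affine//.
apply: (@differentiableZ _ _ _ (fun x => partial s f (c *: x + a))).
exact: differentiable_comp_affine.
Qed.

Lemma smooth_continuous f : smooth f -> continuous f.
Proof. by move=> sf x; apply: differentiable_continuous;
  exact: (sf [::] x). Qed.

Lemma near_eq_partial f g s (x : 'rV[R]_n) :
  (\near x, f x = g x) -> \near x, partial s f x = partial s g x.
Proof.
elim: s => [//|i s IH] /= /IH /near_join fg.
near=> y; rewrite -/(partial s _); apply: near_eq_derive; near: y; exact: fg.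
Unshelve. all: by end_near. Qed.

(** Mean value theorem on the line through [x] in direction [v], for either sign of [t]. *)
Lemma normr_increment_le f (B : R) (v x : 'rV[R]_n) (t : R) :
  (forall x, differentiable f x) -> (forall x, `|'D_v f x| <= B) ->
  `|f (x + t *: v) - f x| <= B * `|t|.
Proof.
move=> df fB; pose F (s : R) := f (x + s *: v).
have dF (s : R) : is_derive s 1 F ('D_v f (x + s *: v)).
  have dA : is_diff s (fun s : R => x + s *: v) (fun h => h *: v).
    by apply: is_diff_eq; rewrite add0r.
  have dFs : differentiable F s.
    by apply: (@differentiable_comp _ _ _ _ (fun s : R => x + s *: v) f).
  apply: DeriveDef; first exact: diff_derivable.
  rewrite deriveE// (@diff_comp _ _ _ _ (fun s : R =>
    x + s *: v) f)//= diff_val.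
  by rewrite scale1r -deriveE.
have cF : continuous F.
  by move=> s; apply: differentiable_continuous; apply/derivable1_diffP;
    exact: ex_derive.
have F0 : F 0 = f x by rewrite /F scale0r addr0.
rewrite -[f x]F0 -/(F t).
have [t0|t0|<-] := ltgtP 0 t; last by rewrite subrr normr0 mulr0.
- have [c _ ->] := MVT t0 (fun r _ => dF r) (continuous_subspaceT cF).
  by rewrite subr0 normrM ler_wpM2r.
- have [c _ E] := MVT t0 (fun r _ => dF r) (continuous_subspaceT cF).
  by rewrite distrC E normrM sub0r normrN ler_wpM2r.
Qed.

End calculus.

(** * Oscillatory integrals of real symbols *)

Section phase.
Context {R : realType} {n : nat}.
Implicit Types (x y z : 'rV[R]_n).

Lemma dotpDl x y z : dotp (x + y) z = dotp x z + dotp y z.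
Proof. by rewrite /dotp -big_split/=; apply: eq_bigr => i _;
  rewrite mxE mulrDl. Qed.

Lemma dotpC x y : dotp x y = dotp y x.
Proof. by apply: eq_bigr => i _; rewrite mulrC. Qed.

Lemma dotpDr x y z : dotp x (y + z) = dotp x y + dotp x z.
Proof. by rewrite dotpC dotpDl !(dotpC x). Qed.

Lemma dotpZl c x y : dotp (c *: x) y = c * dotp x y.
Proof. by rewrite /dotp mulr_sumr; apply: eq_bigr => i _;
  rewrite mxE mulrA. Qed.

Lemma dotpNl x y : dotp (- x) y = - dotp x y.
Proof. by rewrite -scaleN1r dotpZl mulN1r. Qed.

Lemma dotpZr c x y : dotp x (c *: y) = c * dotp x y.
Proof. by rewrite dotpC dotpZl dotpC. Qed.

Lemma dotp_delta x i : dotp x (delta_mx ord0 i) = x ord0 i.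
Proof.
rewrite /dotp (bigD1 i)//= big1 ?addr0 => [|j ji]; rewrite mxE ?eqxx ?mulr1//=.
by rewrite (negbTE ji) mulr0.
Qed.

Lemma norm_coord_le x i : `|x ord0 i| <= `|x|.
Proof.
rewrite [leRHS]/Num.Def.normr/= mx_normrE.
exact: (le_bigmax _ (fun ij : 'I_1 * 'I_n => `|x ij.1 ij.2|) (ord0, i)).
Qed.

Lemma norm_dotp_le x y : `|dotp x y| <= n%:R * (`|x| * `|y|).
Proof.
rewrite (le_trans (ler_norm_sum _ _ _))//.
rewrite mulr_natl -[X in _ *+ X](card_ord n) -sumr_const; apply: ler_sum => i _.
by rewrite normrM ler_pM// norm_coord_le.
Qed.

Lemma norm_cosB (a b : R) : `|cos a - cos b| <= `|a - b|.
Proof.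
wlog ab : a b / a < b.
  move=> H; have [|ba|->] := ltgtP a b; first exact: H.
    by rewrite distrC [leRHS]distrC H.
  by rewrite !subrr.
have [c _ E] := @MVT R cos (fun r => - sin r) a b ab (fun r _ =>
  is_derive_cos r)
  (continuous_subspaceT (@continuous_cos R)).
rewrite distrC E [leRHS]distrC normrM normrN ler_piMl// ler_norml.
by rewrite sin_geN1 sin_le1.
Qed.

Lemma measurable_coord d (T : measurableType d) (f : T -> 'rV[R]_n) i :
  measurable_fun setT f -> measurable_fun setT (fun t => f t ord0 i).
Proof.
move=> mf; apply: (@measurableT_comp _ _ _ _ _ _ (fun v : 'rV[R]_n =>
  v ord0 i) _ f) => //.
by apply: continuous_measurable_rV; exact: coord_continuous.
Qed.

(** An arbitrary source space covers both the integrands in [xi] alone and the joint integrands in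
    (y, xi) to which Fubini is applied. *)
Lemma measurable_phase d (T : measurableType d) (f g : T -> 'rV[R]_n) (h : T ->
  R) :
  measurable_fun setT f -> measurable_fun setT g -> measurable_fun setT h ->
  measurable_fun setT (fun t => cos (2 * pi * dotp (f t) (g t) + h t)).
Proof.
move=> mf mg mh.
apply: (@measurableT_comp _ _ _ _ _ _ cos).
  apply: continuous_measurable_fun; exact: continuous_cos.
apply: measurable_funD => //; apply: measurable_funM => //.
by apply: measurable_sum => i; apply: measurable_funM; exact: measurable_coord.
Qed.

Lemma measurable_phase1 z (th : R) :
  measurable_fun setT (fun xi : 'rV[R]_n => cos (2 * pi * dotp z xi + th)).
Proof. exact: measurable_phase. Qed.

Lemma measurable_cos_comp (h : R -> R) : measurable_fun [set: R] h ->
  measurable_fun [set: R] (cos \o h).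
Proof.
move=> mh; apply: measurableT_comp => //.
apply: continuous_measurable_fun; exact: continuous_cos.
Qed.

End phase.

Section wave.
Context {R : realType} {n : nat}.
Implicit Types (m : 'rV[R]_n -> R) (x y z a : 'rV[R]_n) (th : R).
Local Notation L := (lebesgue_rV n).

(* The transform with symbol [m] has real part [wave m 0] and imaginary part
   [wave m (- (pi / 2))]; keeping the phase as a parameter treats both at
   once. *)
Definition wave m th z := \int[L]_xi (m xi * cos (2 * pi * dotp z xi + th)).

Lemma decaying_phase m th z : decaying m ->
  decaying (fun xi => m xi * cos (2 * pi * dotp z xi + th)).
Proof.
move=> [mm [C mC]]; split.
  by apply: measurable_funM => //; exact: measurable_phase1.
exists C => x; rewrite normrM (le_trans _ (mC x))// ler_piMr//.
by rewrite ler_norml cos_geN1 cos_le1.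
Qed.

Lemma decayingB m m' : decaying m -> decaying m' -> decaying (fun x =>
  m x - m' x).
Proof.
move=> [mm [C mC]] [mm' [C' mC']]; split; first exact: measurable_funB.
exists (C + C') => x; rewrite mulrDl (le_trans (ler_normB _ _))//.
by rewrite lerD.
Qed.

Lemma decaying_shift m a : decaying m -> decaying (fun x => m (x + a)).
Proof.
move=> [mm [C mC]]; split.
  apply: (@measurableT_comp _ _ _ _ _ _ m) => //.
  have := @measurable_affine_rV R n 1 a.
  by under eq_fun do rewrite scale1r.
exists (C * 2 ^+ n * weight a) => x; rewrite (le_trans (mC _))//.
have C0 : 0 <= C.
  have := le_trans (normr_ge0 _) (mC 0).
  by rewrite pmulr_lge0// invr_gt0 weight_gt0.
rewrite ler_pdivlMr ?weight_gt0// mulrAC ler_pdivrMr ?weight_gt0//.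
rewrite -!mulrA ler_wpM2l// (_ : x = (x + a) + (- a)); last by rewrite addrK.
by rewrite (le_trans (weightD _ _))// weightN addrK mulrCA mulrC mulrA.
Qed.

Lemma decayingZ (c : R) m : decaying m -> decaying (fun x => c * m x).
Proof.
move=> [mm [C mC]]; split; first exact: measurable_funM.
by exists (`|c| * C) => x; rewrite normrM -mulrA ler_wpM2l.
Qed.

Lemma wave_le m th z C : measurable_fun setT m -> (forall x,
  `|m x| <= C / weight x) ->
  `|wave m th z| <= C * pi ^+ n.
Proof.
move=> mm mC; apply: le_Rintegral_decaying.
  by apply: measurable_funM => //; exact: measurable_phase1.
move=> x; rewrite normrM (le_trans _ (mC x))// ler_piMr//.
by rewrite ler_norml cos_geN1 cos_le1.
Qed.

Lemma waveB m m' th z : decaying m -> decaying m' ->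
  wave (fun x => m x - m' x) th z = wave m th z - wave m' th z.
Proof.
move=> dm dm'; rewrite /wave -RintegralB//.
- by apply: eq_Rintegral => x _; rewrite mulrBl.
- exact/integrable_decaying/decaying_phase.
- exact/integrable_decaying/decaying_phase.
Qed.

(** A translation of the symbol is a change of phase depending on [z]; this is the modulation rule,
    kept real by the phase parameter. *)
Lemma wave_shift m a th z : decaying m ->
  wave (fun x => m (x + a)) th z = wave m (th - 2 * pi * dotp z a) z.
Proof.
move=> dm; rewrite /wave -[RHS](Rintegral_translate a); last first.
  exact/integrable_decaying/decaying_phase.
by apply: eq_Rintegral => x _; congr (_ * cos _); rewrite dotpDr; ring.
Qed.

Lemma waveNpi m th z :
  decaying m -> wave m (th - pi) z = - wave m th z.
Proof.
move=> dm; rewrite -[RHS]mulN1r /wave -RintegralZl//; last first.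
  exact/integrable_decaying/decaying_phase.
by apply: eq_Rintegral => x _; rewrite addrA cosB cospi sinpi; ring.
Qed.

Lemma wave_scale m c th z : 0 < c -> decaying (fun x => m (c^-1 *: x)) ->
  wave (fun x => m (c^-1 *: x)) th z = c ^+ n * wave m th (c *: z).
Proof.
move=> c0 dm; rewrite /wave -(Rintegral_affine 0 c0); last first.
  exact/integrable_decaying/decaying_phase.
congr (_ * _); apply: eq_Rintegral => x _.
by rewrite addr0 scalerA mulVf ?gt_eqF// scale1r dotpZl dotpZr.
Qed.

(** Addition formula for the cosine: every phase is a combination of the real part (phase 0) and the
    imaginary part (phase - pi / 2). *)
Lemma wave_phase m th z : decaying m ->
  wave m th z = cos th * wave m 0 z - sin th * wave m (- (pi / 2)) z.
Proof.
move=> dm; rewrite /wave -!RintegralZl//; last 2 first.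
- exact/integrable_decaying/decaying_phase.
- exact/integrable_decaying/decaying_phase.
rewrite -RintegralB//; last 2 first.
- exact/integrable_decaying/decayingZ/decaying_phase.
- exact/integrable_decaying/decayingZ/decaying_phase.
apply: eq_Rintegral => x _.
by rewrite addr0 cosD cosB cos_pihalf sin_pihalf; ring.
Qed.

(** The cosine is 1-Lipschitz, so an increment of [z] costs one factor |x| on the symbol, which the
    second hypothesis pays for. *)
Lemma wave_lip m th z a C : measurable_fun setT m ->
  (forall x, `|x| * `|m x| <= C / weight x) -> decaying m ->
  `|wave m th (z + a) - wave m th z| <= 2 * pi * n%:R * C * pi ^+ n * `|a|.
Proof.
move=> mm mC dm; rewrite /wave -RintegralB//; last 2 first.
- exact/integrable_decaying/decaying_phase.
- exact/integrable_decaying/decaying_phase.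
rewrite [leRHS]mulrAC; apply: le_Rintegral_decaying.
  apply: measurable_funB; apply: measurable_funM => //;
    exact: measurable_phase1.
move=> x; rewrite -mulrBr normrM.
apply: (@le_trans _ _ (`|m x| * (2 * pi * (n%:R * (`|a| * `|x|))))).
  rewrite ler_wpM2l// (le_trans (norm_cosB _ _))// opprD addrACA subrr addr0.
  rewrite -mulrBr dotpDl addrAC subrr add0r normrM ger0_norm;
    last by rewrite mulr_ge0// pi_ge0.
  by rewrite ler_wpM2l ?mulr_ge0// ?pi_ge0// norm_dotp_le.
rewrite [leLHS](_ : _ = (2 * pi * n%:R * `|a|) * (`|x| * `|m x|)); last by ring.
rewrite [leRHS](_ : _ = (2 * pi * n%:R * `|a|) * (C / weight x)); last by ring.
by rewrite ler_wpM2l// !mulr_ge0// pi_ge0.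
Qed.

End wave.

(** * Rapid decay of the transforms of test functions *)

Section decay.
Context {R : realType} {n : nat}.
Implicit Types (m : 'rV[R]_n -> R) (x y z : 'rV[R]_n) (th : R) (p : 'I_n * R).

Definition fdiff m p := fun x => m (x + p.2 *: delta_mx ord0 p.1) - m x.

Definition fdiffs m (s : seq ('I_n * R)) := foldl fdiff m s.

Lemma smooth_shift m (a : 'rV[R]_n) : smooth m -> smooth (fun x => m (x + a)).
Proof.
move=> /(@smooth_affine _ _ _ 1 a).
by under eq_fun do rewrite scale1r.
Qed.

Lemma smooth_fdiff m p : smooth m -> smooth (fdiff m p).
Proof. by move=> sm; apply: smoothB => //; exact: smooth_shift. Qed.

Lemma partial_fdiff m p s : smooth m -> partial s (fdiff m p) = fdiff (partial
  s m) p.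
Proof.
move=> sm; rewrite /fdiff partialB//; last exact: smooth_shift.
apply/funext => x; congr (_ - _).
have := @partial_affine _ _ m s 1 (p.2 *: delta_mx ord0 p.1) sm.
under eq_fun do rewrite scale1r.
by move=> ->; rewrite expr1n mul1r scale1r.
Qed.

(** Differences commute with partial derivatives, so by the mean value theorem each difference is
    traded for one derivative and one factor of its step. *)
Lemma fdiffs_le m s (B : R) : smooth m ->
  (forall x, `|partial (map fst s) m x| <= B) ->
  forall x, `|fdiffs m s x| <= B * \prod_(p <- s) `|p.2|.
Proof.
elim: s m B => [|p s IH] m B sm mB x; first by rewrite big_nil mulr1 mB.
rewrite big_cons mulrA; apply: IH => [|y]; first exact: smooth_fdiff.
by rewrite partial_fdiff//; apply: normr_increment_le => // {}x; exact: mB.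
Qed.

Lemma normr_delta_le (i : 'I_n) : `|delta_mx ord0 i : 'rV[R]_n| <= 1.
Proof.
rewrite [leLHS]/Num.Def.normr/= mx_normrE; apply: bigmax_le => // -[a b] _ /=.
by rewrite mxE; case: (_ && _); rewrite ?normr1 ?normr0.
Qed.

Lemma fdiffs_supp m s (rho : R) : (forall x, rho < `|x| -> m x = 0) ->
  {in s, forall p, `|p.2| <= 1} ->
  forall x, rho + (size s)%:R < `|x| -> fdiffs m s x = 0.
Proof.
elim: s m rho => [|p s IH] m rho m0 s1 x; first by rewrite addr0 => /m0.
rewrite /= -nat1r addrA => xs; apply: (IH _ (rho + 1)) => // [y yr|q qs];
  last first.
  by apply: s1; rewrite inE qs orbT.
have pt1 : `|p.2 *: delta_mx ord0 p.1 : 'rV[R]_n| <= 1.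
  rewrite normrZ -[leRHS]mulr1 ler_pM ?normr_delta_le//.
  by apply: s1; rewrite inE eqxx.
rewrite /fdiff !m0 ?subrr//; first by apply: lt_trans yr; rewrite ltrDl.
rewrite -(ltrD2r 1) (lt_le_trans yr)//.
rewrite -{1}(addrK (p.2 *: delta_mx ord0 p.1) y) (le_trans (ler_normB _ _))//.
by rewrite lerD.
Qed.

Lemma weight_le x (r : R) : `|x| <= r -> weight x <= (1 + r ^+ 2) ^+ n.
Proof.
move=> xr; rewrite -[X in _ ^+ X](card_ord n) -prodr_const.
apply: ler_prod => i _; rewrite addr_ge0 ?sqr_ge0//= lerD2l -real_normK
  ?num_real//.
by rewrite lerXn2r ?nnegrE// ?(le_trans (normr_ge0 x))//
  (le_trans (norm_coord_le _ _)).
Qed.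

Lemma bounded_supp_le m (B rho : R) : (forall x, `|m x| <= B) ->
  (forall x, rho < `|x| -> m x = 0) ->
  forall x, `|m x| <= B * (1 + rho ^+ 2) ^+ n / weight x.
Proof.
move=> mB m0 x; have B0 : 0 <= B by exact: le_trans (mB 0).
have [xr|/m0->] := leP `|x| rho.
  by rewrite ler_pdivlMr ?weight_gt0// ler_pM// ?weight_le// ltW// weight_gt0.
rewrite normr0 mulr_ge0 ?invr_ge0 ?(ltW (weight_gt0 _))// mulr_ge0//
  exprn_ge0//.
by rewrite addr_ge0// sqr_ge0.
Qed.

Definition test_fun m := [/\ smooth m, (forall s, exists B : R, forall x,
  `|partial s m x| <= B)
  & exists rho, forall x, rho < `|x| -> m x = 0].

Lemma smooth_measurable m : smooth m -> measurable_fun setT m.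
Proof. by move=> sm; apply: continuous_measurable_rV;
  exact: smooth_continuous. Qed.

Lemma test_fun_decaying m : test_fun m -> decaying m.
Proof.
move=> [sm /(_ [::])[B mB] [rho m0]]; split; first exact: smooth_measurable.
exists (B * (1 + rho ^+ 2) ^+ n); exact: bounded_supp_le.
Qed.

Lemma decaying_fdiff m p : decaying m -> decaying (fdiff m p).
Proof. by move=> dm; apply: decayingB => //; exact: decaying_shift. Qed.

(** The step is half a period of the oscillation in direction [p.1]: the shifted transform is minus
    the original one. *)
Lemma wave_fdiff m p th z : decaying m -> 2 * p.2 * z ord0 p.1 = 1 ->
  wave (fdiff m p) th z = - 2 * wave m th z.
Proof.
move=> dm pz; rewrite waveB//; last exact: decaying_shift.
rewrite wave_shift// dotpZr dotp_delta.
rewrite (_ : 2 * pi * _ = pi * (2 * p.2 * z ord0 p.1)); last by ring.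
by rewrite pz mulr1 waveNpi//; ring.
Qed.

Lemma wave_fdiffs m s th z : decaying m ->
  {in s, forall p, 2 * p.2 * z ord0 p.1 = 1} ->
  wave (fdiffs m s) th z = (- 2) ^+ size s * wave m th z.
Proof.
elim: s m => [|p s IH] m dm sz; first by rewrite expr0 mul1r.
rewrite /= IH//; last 2 first.
- exact: decaying_fdiff.
- by move=> q qs; apply: sz; rewrite inE qs orbT.
by rewrite wave_fdiff ?sz ?inE ?eqxx// exprS mulrCA mulrA.
Qed.

(* Integration by parts is replaced by finite differences: a difference of step
   [1 / (2 z_i)] in direction [i] multiplies the transform at [z] by [-2] and
   gains a factor [1 / |z_i|] on the symbol. *)
Lemma wave_decay m k : test_fun m ->
  exists C, forall th z, `|wave m th z| <= C / weight z ^+ k.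
Proof.
move=> tm; have dm := test_fun_decaying tm; case: tm => sm bm [rho m0].
(* The coordinates to be differenced depend on [z], but they form one of finitely many sets.
   Derivative bounds are chosen for each set and summed over all of them, which makes the constant
   uniform in [z]. *)
pose I (A : {set 'I_n}) := flatten [seq nseq (2 * k) i | i <- enum A].
have [B BP] := choice (fun A => bm (I A)).
(* There are at most 2 k n differences, each of step at most 1, so the support grows by at most 2 k
   n. *)
pose r := rho + (2 * k * n)%:R.
pose D A := B A * (1 + r ^+ 2) ^+ n * pi ^+ n.
have D0 A : 0 <= D A.
  rewrite !mulr_ge0 ?exprn_ge0 ?pi_ge0// ?addr_ge0 ?sqr_ge0//.
  exact: le_trans (BP A 0).
exists ((\sum_A D A) * 2 ^+ (k * n)) => th z.
(* Only coordinates of size at least 1 are differenced: there the step is at most 1/2. For the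
   others 1 + z_i^2 is at most 2, which goes into the factor 2^(k n). *)
pose A := [set i : 'I_n | 1 <= `|z ord0 i|]%SET.
pose s := flatten [seq nseq (2 * k) (i, (2 * z ord0 i)^-1) | i <- enum A].
have sA : map fst s = I A.
  rewrite /s /I map_flatten -map_comp; congr flatten; apply: eq_map => i /=.
  by rewrite map_nseq.
have s_in p : p \in s -> p.1 \in A /\ p.2 = (2 * z ord0 p.1)^-1.
  move=> /flattenP[l /mapP[i iA ->]]; rewrite mem_nseq => /andP[_ /eqP->] /=.
  by move: iA; rewrite mem_enum.
have z0 i : i \in A -> z ord0 i != 0.
  by rewrite inE => zi; rewrite -normr_gt0 (lt_le_trans _ zi).
have s1 : {in s, forall p, `|p.2| <= 1}.
  move=> p /s_in[pA ->]; rewrite normfV invf_le1; last first.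
    by rewrite normr_gt0 mulf_neq0// z0.
  rewrite normrM (ger0_norm (_ : 0 <= 2))// -[leLHS]mulr1 ler_pM//.
    by rewrite ler1n.
  by move: pA; rewrite inE.
have s2 : {in s, forall p, 2 * p.2 * z ord0 p.1 = 1}.
  move=> p /s_in[pA ->]; rewrite invfM; field; exact: z0.
have size_s : (size s <= 2 * k * n)%N.
  rewrite size_flatten /shape -map_comp sumnE big_map big_enum/=.
  under eq_bigr do rewrite size_nseq.
  by rewrite sum_nat_const mulnC leq_mul2l -[X in (_ <= X)%N](card_ord n)
    max_card orbT.
have supps x : r < `|x| -> fdiffs m s x = 0.
  move=> rx; apply: (fdiffs_supp m0 s1); apply: le_lt_trans rx.
  by rewrite lerD2l ler_nat.
have fs := @fdiffs_le m s (B A) sm; rewrite sA in fs.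
have /= dle x := bounded_supp_le (fs (BP A)) supps x.
have mfs : measurable_fun setT (fdiffs m s).
  have : smooth m by [].
  elim: (s) (m) => [|p s' IH] m' sm'; first exact: smooth_measurable.
  by apply: IH; exact: smooth_fdiff.
have := wave_le th z mfs dle; rewrite wave_fdiffs// normrM => H.
have H1 : `|wave m th z| <= `|(- 2) ^+ size s * wave m th z|.
  rewrite normrM ler_peMl// normrX normrN ger0_norm// exprn_ege1//.
  by rewrite ler1n.
rewrite normrM in H1; rewrite (le_trans H1)// (le_trans H)//.
have -> : \prod_(p <- s) `|p.2| = \prod_(i in A) (`|2 * z ord0 i|^-1) ^+ (2 *
  k).
  rewrite /s big_flatten/= big_map big_enum/=; apply: eq_bigr => i _.
  by rewrite big_nseq iter_mulr_1/= normfV.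
(* Coordinate by coordinate: in [A] one has 1 + z_i^2 <= 2 (2 z_i)^2, outside [A] one has 1 + z_i^2
   <= 2. *)
have prodA : \prod_(i in A) (`|2 * z ord0 i|^-1) ^+ (2 * k) <= 2 ^+ (k * n) /
  weight z ^+ k.
  rewrite ler_pdivlMr ?exprn_gt0 ?weight_gt0// mulrC /weight -prodrXl.
  rewrite [X in _ * X]big_mkcond/= -big_split/= exprM.
  rewrite -[X in _ <= _ ^+ X](card_ord n) -prodr_const; apply: ler_prod => i _.
  have zi0 : 0 <= 1 + z ord0 i ^+ 2 by rewrite addr_ge0 ?sqr_ge0.
  case: ifPn => [iA|]; last first.
    rewrite inE -ltNge mulr1 exprn_ge0//= => zi.
    rewrite lerXn2r ?nnegrE// -[2]/(1 + 1) lerD2l -real_normK ?num_real//.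
    by rewrite expr_le1// ltW.
  rewrite exprM -exprMn exprn_ge0 ?mulr_ge0 ?sqr_ge0//=.
  rewrite lerXn2r ?nnegrE ?mulr_ge0 ?sqr_ge0//.
  rewrite exprVn ler_pdivrMr ?exprn_gt0 ?normr_gt0 ?mulf_neq0 ?z0//.
  rewrite real_normK ?num_real//.
  move: iA; rewrite inE -(@ler_pXn2r _ 2)// ?nnegrE//
    expr1n real_normK ?num_real//.
  by move=> ?; rewrite exprMn; lra.
rewrite [leLHS](_ : _ = D A * \prod_(i in A) `|2 * z ord0 i|^-1 ^+ (2 * k));
  last first.
  by rewrite /D; ring.
rewrite -[leRHS]mulrA; apply: ler_pM => //.
  by apply: prodr_ge0 => i _; rewrite exprn_ge0// invr_ge0.
by rewrite (bigD1 A)//= lerDl sumr_ge0.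
Qed.

End decay.

(** * Fourier inversion *)

Section poisson1.
Context {R : realType}.
Notation mu := (@lebesgue_measure R).

(** Normalised to have integral 1; its Fourier transform is 1 / (1 + xi^2), which is one factor of
    the reciprocal weight. *)
Definition expabs (x : R) : R := pi * expR (- (2 * pi * `|x|)).

Lemma continuous_expabs : continuous expabs.
Proof.
move=> x; apply: cvgM; first exact: cvg_cst.
apply: (@continuous_comp _ _ _ (fun x : R => - (2 * pi * `|x|)) expR);
  last exact: continuous_expR.
apply: continuousN; apply: continuousM; first exact: cst_continuous.
exact: norm_continuous.
Qed.

Lemma expabs_le x : expabs x <= pi / (1 + x ^+ 2).
Proof.
rewrite ler_wpM2l ?pi_ge0// expRN lef_pV2 ?posrE ?expR_gt0//; last first.
  by rewrite ltr_pwDl// sqr_ge0.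
rewrite -mulrA (expRM_natl 2).
have p1 : 1 <= pi :> R by rewrite (le_trans _ (pi_ge2 R))// ler1n.
apply: (@le_trans _ _ ((1 + `|x|) ^+ 2)); last first.
  rewrite lerXn2r ?nnegrE ?addr_ge0 ?expR_ge0//.
  rewrite (le_trans _ (expR_ge1Dx _))// lerD2l ler_peMl//.
by rewrite -(@real_normK _ x) ?num_real//
  -subr_ge0 [X in 0 <= X](_ : _ = 2 * `|x|); [rewrite mulr_ge0|ring].
Qed.

(** The summand 1 keeps the integrand nonnegative, as the fundamental theorem on a half-line
    requires here; it is subtracted again in [Rintegral_expabs_cos]. *)
Lemma integral_half_exp_cos (c xi : R) : `|c| <= 1 ->
  (\int[mu]_(x in `[0%R, +oo[) (2 * pi * expR (- (2 * pi * x)) * (1 + c * cos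
    (2 * pi * x * xi)))%:E
   = (1 + c / (1 + xi ^+ 2))%:E)%E.
Proof.
move=> c1.
(* An explicit antiderivative that vanishes at infinity, found by integrating by parts twice. *)
pose F (x : R) := expR (- (2 * pi * x)) *
  (- 1 + c / (1 + xi ^+ 2) * (xi * sin (2 * pi * x * xi) - cos (2 * pi * x *
    xi))).
have xi0 : 1 + xi ^+ 2 != 0 by rewrite gt_eqF// ltr_pwDl// sqr_ge0.
have dF (x : R) : is_derive x 1 F (2 * pi * expR (- (2 * pi * x)) * (1 + c *
  cos (2 * pi * x * xi))).
  rewrite /F; apply: is_derive_eq; rewrite /GRing.scale/=; by field.
have cF : continuous F.
  by move=> x; apply: differentiable_continuous; apply/derivable1_diffP;
    exact: ex_derive.
have cf : continuous (fun x : R => 2 * pi * expR (- (2 * pi * x)) * (1 + c *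
  cos (2 * pi * x * xi))).
  move=> x; apply: differentiable_continuous; apply/derivable1_diffP;
    exact: ex_derive.
have Fy : F x @[x --> +oo] --> 0.
  pose K := 1 + `|c / (1 + xi ^+ 2)| * (`|xi| + 1).
  have K0 : 0 <= K by rewrite addr_ge0// mulr_ge0// addr_ge0.
  have KE : K * expR (- x) @[x --> +oo] --> 0.
    by rewrite -(mulr0 K); apply: cvgM; [exact: cvg_cst|exact: cvgr_expR].
  apply/cvgr0Pnorm_le => e e0; near=> x.
  have x0 : 0 <= x by near: x; exact: nbhs_pinfty_ge.
  have : `|K * expR (- x)| <= e by near: x; move/cvgr0Pnorm_le : KE; exact.
  move=> /(le_trans (ler_norm _)); apply: le_trans.
  rewrite /F normrM mulrC (ger0_norm (expR_ge0 _)); apply: ler_pM => //.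
    rewrite (le_trans (ler_normD _ _))// normrN1 lerD2l normrM ler_wpM2l//.
    rewrite (le_trans (ler_normB _ _))// lerD// ?normrM ?ler_piMr// ler_norml.
      by rewrite sin_geN1 sin_le1.
    by rewrite cos_geN1 cos_le1.
  rewrite ler_expR lerN2 ler_peMl//.
  by have := pi_ge2 R; lra.
rewrite (ge0_continuous_FTC2y _ _ Fy).
- rewrite /F !mulr0 oppr0 expR0 mul0r sin0 cos0 -EFinB; congr EFin; field;
  exact: xi0.
- move=> x x0; rewrite !mulr_ge0 ?pi_ge0 ?expR_ge0//.
  have : `|c * cos (2 * pi * x * xi)| <= 1.
    rewrite normrM -[leRHS]mulr1 ler_pM// ler_norml.
    by rewrite cos_geN1 cos_le1.
  by rewrite ler_norml -lerBlDl sub0r => /andP[].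
- exact: continuous_subspaceT.
- by move=> x _; exact: ex_derive.
- by apply: cvg_at_right_filter; exact: cF.
- by move=> x _; rewrite derive1E; exact: derive_val.
Unshelve. all: by end_near. Qed.

(** Adding the reflected integrand cancels the sine part. What remains is even, with the phase
    surviving as the coefficient [cos th], and the half-line formula applies. *)
Lemma integral_expabs_cos (th xi : R) :
  (\int[mu]_x (expabs x * (1 + cos (2 * pi * x * xi + th)))%:E =
   (1 + cos th / (1 + xi ^+ 2))%:E)%E.
Proof.
pose h x := expabs x * (1 + cos (2 * pi * x * xi + th)).
have ch : continuous h.
  move=> x; apply: continuousM; first exact: continuous_expabs.
  apply: continuousD; first exact: cst_continuous.
  apply: differentiable_continuous; apply/derivable1_diffP; exact: ex_derive.
have h0 x : 0 <= h x.
  rewrite /h; apply: mulr_ge0; first by rewrite mulr_ge0 ?pi_ge0 ?expR_ge0.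
  by rewrite -lerBlDl sub0r cos_geN1.
have mh : measurable_fun [set: R] h by exact: continuous_measurable_fun.
have chN : continuous (h \o -%R).
  by move=> x; apply: continuous_comp; [exact: opp_continuous|exact: ch].
have mhN : measurable_fun [set: R] (h \o -%R) by exact:
  continuous_measurable_fun.
have hN : (\int[mu]_x (h (- x))%:E = \int[mu]_x (h x)%:E)%E.
  transitivity (\int[pushforward mu (-%R : R ->
    measurableTypeR R)]_x (h x)%:E)%E.
    rewrite ge0_integral_pushforward//=.
    - exact/measurable_EFinP.
    - by move=> y _; rewrite lee_fin.
  by apply: eq_measure_integral => //= A mA _; exact: lebesgue_measureN.
suff : (\int[mu]_x (h x)%:E + \int[mu]_x (h x)%:E = 2%:E * (1 + cos th / (1 +
  xi ^+ 2))%:E)%E.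
  case: (integral _ _ _) => [r||]//; rewrite -EFinM -EFinD => -[H]; congr EFin.
  lra.
rewrite -{1}hN -ge0_integralD//; last 4 first.
- by move=> x _; rewrite lee_fin.
- exact/measurable_EFinP.
- by move=> x _; rewrite lee_fin.
- exact/measurable_EFinP.
under eq_integral do rewrite -EFinD.
rewrite ge0_symfun_integralT; last 3 first.
- by move=> x; rewrite addr_ge0.
- by move=> x; apply: (@continuousD R R _ (h \o -%R) h x);
  [exact: chN|exact: ch].
- by move=> x /=; rewrite opprK addrC.
congr (_ * _)%E; rewrite -set_itvcy -integral_half_exp_cos; last first.
  by rewrite ler_norml cos_geN1 cos_le1.
apply: eq_integral => x; rewrite inE/= in_itv/= andbT => x0; congr EFin.
rewrite /h /expabs normrN ger0_norm// mulrN mulNr !cosD cosN sinN; ring.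
Qed.

Lemma integral_expabs : (\int[mu]_x (expabs x)%:E = 1%:E)%E.
Proof.
(* At frequency 0 and phase pi/2 the cosine vanishes identically. *)
have := integral_expabs_cos (pi / 2) 0.
rewrite cos_pihalf mul0r addr0 => <-; apply: eq_integral => x _.
by rewrite mulr0 add0r cos_pihalf addr0 mulr1.
Qed.

Lemma expabs_ge0 x : 0 <= expabs x.
Proof. by rewrite mulr_ge0 ?pi_ge0 ?expR_ge0. Qed.

Lemma measurable_expabs : measurable_fun [set: measurableTypeR R] expabs.
Proof. apply: continuous_measurable_fun; exact: continuous_expabs. Qed.

Lemma integrable_expabs : mu.-integrable setT (EFin \o expabs).
Proof.
apply/integrableP; split; first by apply/measurable_EFinP;
  exact: measurable_expabs.
under eq_integral do rewrite /= ger0_norm ?expabs_ge0//.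
by rewrite integral_expabs ltry.
Qed.

Lemma integrable_expabs_cos (th xi : R) :
  mu.-integrable setT (EFin \o (fun x =>
    expabs x * cos (2 * pi * x * xi + th))).
Proof.
have mc : measurable_fun [set: measurableTypeR R] (fun x =>
  expabs x * cos (2 * pi * x * xi + th)).
  apply: measurable_funM; first exact: measurable_expabs.
  apply: measurable_cos_comp; apply: measurable_funD => //.
  by do 2 apply: measurable_funM => //.
apply: (le_integrable _ _ _ integrable_expabs) => //;
  first exact/measurable_EFinP.
move=> x _; rewrite /= lee_fin normrM ler_piMr// ler_norml.
by rewrite cos_geN1 cos_le1.
Qed.

Lemma Rintegral_expabs_cos (th xi : R) :
  \int[mu]_x (expabs x * cos (2 * pi * x * xi + th)) = cos th / (1 + xi ^+ 2).
Proof.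
have ic := integrable_expabs_cos th xi.
have := RintegralD measurableT integrable_expabs ic.
rewrite {2}/Rintegral integral_expabs/=.
have -> : \int[mu]_x (expabs x + expabs x * cos (2 * pi * x * xi + th)) =
    1 + cos th / (1 + xi ^+ 2).
  rewrite /Rintegral -[RHS]/(fine (1 + cos th / (1 + xi ^+ 2))%:E)
    -integral_expabs_cos.
  by congr fine; apply: eq_integral => x _; rewrite [in RHS]mulrDr mulr1.
by move/addrI.
Qed.

End poisson1.

Section poisson.
Context {R : realType}.
Notation mu := (@lebesgue_measure R).

Definition expabs_rV n (y : 'rV[R]_n) : R := \prod_(i < n) expabs (y ord0 i).

Lemma cons_rV_eta n (x : 'rV[R]_n.+1) :
  x = cons_rV (x ord0 ord0, \row_i x ord0 (rshift 1 i)).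
Proof.
apply/rowP => i; rewrite /cons_rV/= !mxE.
case: splitP => j ij; rewrite !mxE; congr (x _ _); apply/val_inj;
  by rewrite /= ij// ord1.
Qed.

Lemma cons_rV0 n (x : R) (v : 'rV[R]_n) : cons_rV (x, v) ord0 ord0 = x.
Proof. by rewrite mxE; case: splitP => j jE; rewrite ?mxE//;
  case: j jE => -[]. Qed.

Lemma cons_rV_lift n (x : R) (v : 'rV[R]_n) i : cons_rV (x,
  v) ord0 (lift ord0 i) = v ord0 i.
Proof.
rewrite (_ : lift _ _ = rshift 1 i :> 'I_(1 + n)); last exact/val_inj.
by rewrite (@row_mxEr _ 1 1 n).
Qed.

Lemma dotp_cons n (a b : R) (u v : 'rV[R]_n) :
  dotp (cons_rV (a, u)) (cons_rV (b, v)) = a * b + dotp u v.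
Proof.
rewrite /dotp big_ord_recl !cons_rV0; congr (_ + _).
by apply: eq_bigr => i _; rewrite !cons_rV_lift.
Qed.

Lemma expabs_rV_cons n (x : R) (v : 'rV[R]_n) :
  expabs_rV (cons_rV (x, v)) = expabs x * expabs_rV v.
Proof.
rewrite /expabs_rV big_ord_recl cons_rV0; congr (_ * _).
by apply: eq_bigr => i _; rewrite cons_rV_lift.
Qed.

Lemma continuous_expabs_rV n : continuous (@expabs_rV n).
Proof.
apply: continuous_big => [|i _ x]; first exact: mul_continuous.
apply: (@continuous_comp _ _ _ (fun v : 'rV[R]_n => v ord0 i) expabs).
  exact: coord_continuous.
exact: continuous_expabs.
Qed.

Lemma expabs_rV_ge0 n (y : 'rV[R]_n) : 0 <= expabs_rV y.
Proof. by apply: prodr_ge0 => i _; exact: expabs_ge0. Qed.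

Lemma expabs_rV_le n (y : 'rV[R]_n) : expabs_rV y <= pi ^+ n / weight y.
Proof.
rewrite /weight -prodfV -[X in _ ^+ X](card_ord n) -prodr_const -big_split/=.
by apply: ler_prod => i _; rewrite expabs_ge0 expabs_le.
Qed.

Lemma decaying_expabs_rV n : decaying (@expabs_rV n).
Proof.
split; first by apply: continuous_measurable_rV; exact: continuous_expabs_rV.
by exists (pi ^+ n) => y; rewrite ger0_norm ?expabs_rV_ge0 ?expabs_rV_le.
Qed.

Lemma expabs_rV0 n : expabs_rV (0 : 'rV[R]_n) = pi ^+ n.
Proof.
rewrite /expabs_rV -[X in _ ^+ X](card_ord n) -prodr_const;
  apply: eq_bigr => i _.
by rewrite mxE /expabs normr0 mulr0 oppr0 expR0 mulr1.
Qed.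

(* The Abel means used for the inversion formula: the transform of
   [\prod_i pi e^(- 2 pi |y_i|)] is [1 / weight]. *)
Lemma wave_expabs_rV n th (xi : 'rV[R]_n) :
  wave (@expabs_rV n) th xi = cos th / weight xi.
Proof.
elim: n th xi => [|n IH] th xi.
  rewrite /wave /Rintegral/= integral_dirac//; last first.
    apply/measurable_EFinP; have [] := decaying_phase th xi
      (@decaying_expabs_rV 0).
    by [].
  by rewrite diracT mul1e/= /dotp /weight /expabs_rV !big_ord0 mulr0 add0r
    mul1r invr1 mulr1.
rewrite [xi]cons_rV_eta; set xi0 := xi _ _; set xi' := \row_i _.
rewrite weight_cons /wave (@Rintegral_rVS _ _ _ expabs (@expabs_rV n));
  last 4 first.
- by have [] := decaying_phase th (cons_rV (xi0,
  xi')) (@decaying_expabs_rV n.+1).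
- exact: integrable_expabs.
- exact/integrable_decaying/decaying_expabs_rV.
- move=> x v; rewrite expabs_rV_cons normrM (ger0_norm (mulr_ge0 _ _))
  ?expabs_ge0 ?expabs_rV_ge0//.
  apply: ler_piMr; first by rewrite mulr_ge0 ?expabs_ge0 ?expabs_rV_ge0.
  by rewrite ler_norml cos_geN1 cos_le1.
transitivity (\int[mu]_x ((expabs x * cos (2 * pi * x * xi0 + th)) / weight
  xi')).
  apply: eq_Rintegral => x _.
  rewrite -mulrA -IH /wave -RintegralZl//; last first.
    exact/integrable_decaying/decaying_phase/decaying_expabs_rV.
  apply: eq_Rintegral => v _; rewrite expabs_rV_cons dotp_cons -mulrA.
  by congr (_ * (_ * cos _)); ring.
rewrite RintegralZr//; last exact: integrable_expabs_cos.
by rewrite Rintegral_expabs_cos invfM mulrA.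
Qed.

End poisson.

(** * Fourier inversion at the origin *)

Section inversion.
Context {R : realType} {n : nat}.
Implicit Types (m : 'rV[R]_n -> R) (x y z a : 'rV[R]_n) (th : R).
Local Notation L := (lebesgue_rV n).

Lemma measurable_scale (c : R) : measurable_fun setT (fun x : 'rV[R]_n =>
  c *: x).
Proof.
have := @measurable_affine_rV R n c 0.
by under eq_fun do rewrite addr0.
Qed.

Lemma decaying_dilate m (c : R) : 1 <= c -> decaying m -> decaying (fun x =>
  m (c^-1 *: x)).
Proof.
move=> c1 [mm [C mC]]; split.
  apply: (@measurableT_comp _ _ _ _ _ _ m) => //; exact: measurable_scale.
have C0 : 0 <= C.
  have := le_trans (normr_ge0 _) (mC 0).
  by rewrite pmulr_lge0// invr_gt0 weight_gt0.
have c0 : 0 < c by exact: lt_le_trans c1.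
exists (C * (c ^+ 2) ^+ n) => x; rewrite (le_trans (mC _))//.
rewrite -mulrA ler_wpM2l// ler_pdivlMr ?weight_gt0// ler_pdivrMl ?weight_gt0//.
rewrite /weight -[X in _ ^+ X](card_ord n) -prodr_const -big_split/=.
apply: ler_prod => i _; rewrite addr_ge0 ?sqr_ge0//= mxE.
rewrite mulrDl mul1r exprMn mulrAC -exprMn mulVf ?gt_eqF// expr1n mul1r.
by rewrite lerD2r exprn_ege1.
Qed.

Lemma decaying_continuous_dilate m x : {for 0, continuous m} ->
  m (k.+1%:R^-1 *: x) @[k --> \oo] --> m 0.
Proof.
move=> m0; apply: (@cvg_comp _ _ _ (fun k : nat =>
  k.+1%:R^-1 *: x) m _ (nbhs (0 : 'rV[R]_n))) => //.
rewrite -(scale0r x); apply: cvgZr_tmp; exact: cvg_harmonic.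
Qed.

(** Abel summation: the integral of the transform against the cut-off [P k] is evaluated in two
    ways, and comparing the limits leaves a common factor [pi ^+ n] to cancel. *)
Lemma wave_integral m th C : decaying m -> {for 0, continuous m} ->
  measurable_fun setT (wave m th) -> (forall y,
    `|wave m th y| <= C / weight y) ->
  \int[L]_y wave m th y = cos th * m 0.
Proof.
move=> dm m0 mw wC.
pose P k y := expabs_rV (k.+1%:R^-1 *: y) : R.
have k1 k : 1 <= k.+1%:R :> R by rewrite ler1n.
have dP k : decaying (P k) by apply: decaying_dilate => //;
  exact: decaying_expabs_rV.
have piP k y : 0 <= P k y <= pi ^+ n.
  rewrite expabs_rV_ge0 (le_trans (expabs_rV_le _))//
    ler_piMr ?exprn_ge0 ?pi_ge0//.
  by rewrite invf_le1 ?weight_gt0 ?weight_ge1.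
have [mm [B mB]] := dm.
have B0 : 0 <= B.
  have := le_trans (normr_ge0 _) (mB 0).
  by rewrite pmulr_lge0// invr_gt0 weight_gt0.
have mcos (k : nat) xi : `|m (k.+1%:R^-1 *: xi) * (cos th / weight xi)| <= B /
  weight xi.
  rewrite normrM ler_pM//.
    by rewrite (le_trans (mB _))// ler_piMr// invf_le1 ?weight_gt0 ?weight_ge1.
  have Wi : 0 <= (weight xi)^-1 by rewrite invr_ge0 (ltW (weight_gt0 _)).
  rewrite normrM (ger0_norm Wi).
  rewrite ler_piMl ?invr_ge0 ?(ltW (weight_gt0 _))// ler_norml.
  by rewrite cos_geN1 cos_le1.
pose A k := \int[L]_y (wave m th y * P k y).
(* The cut-offs converge pointwise to the value of [expabs_rV] at 0, which is [pi ^+ n]. *)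
have A1 : A k @[k --> \oo] --> \int[L]_y (wave m th y * pi ^+ n).
  apply: (@Rintegral_cvg _ _ _ _ (C * pi ^+ n)) => [k|y|k y].
  - by apply: measurable_funM => //; case: (dP k).
  - apply: cvgM; first exact: cvg_cst.
    by rewrite -expabs_rV0; apply: decaying_continuous_dilate;
      exact: continuous_expabs_rV.
  - have /andP[P0 P1] := piP k y.
    by rewrite normrM [leRHS]mulrAC ler_pM// ger0_norm.
(* Fubini moves the transform onto [P k], where it is explicit; rescaling the variable then puts the
   dilation on [m]. *)
have A2 k : A k = \int[L]_xi (m (k.+1%:R^-1 *: xi) * (cos th / weight xi)).
  have [mP [D PD]] := dP k.
  transitivity (\int[L]_xi (m xi * wave (P k) th xi)).
    transitivity (\int[L]_y \int[L]_xi (m xi * cos (2 * pi * dotp y xi + th) *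
      P k y)).
      apply: eq_Rintegral => y _; rewrite RintegralZr//.
      exact/integrable_decaying/decaying_phase.
    rewrite (@Rintegral_Fubini _ _ _ _ _ L L _ (fun y =>
      D / weight y) (fun xi => B / weight xi)).
    - apply: eq_Rintegral => xi _; rewrite -RintegralZl//; last first.
        exact/integrable_decaying/decaying_phase.
      by apply: eq_Rintegral => y _; rewrite dotpC mulrAC mulrA.
    - apply: measurable_funM; last exact: (measurableT_comp mP measurable_fst).
      apply: measurable_funM; first exact: (measurableT_comp mm measurable_snd).
      by apply: measurable_phase => //; exact: measurable_fst || exact:
        measurable_snd.
    - exact: integrable_weightV.
    - exact: integrable_weightV.
    - move=> y xi; rewrite normrM mulrC ler_pM//.
      rewrite normrM (le_trans _ (mB xi))// ler_piMr// ler_norml.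
      by rewrite cos_geN1 cos_le1.
  have c0 : 0 < k.+1%:R :> R by rewrite ltr0n.
  have cd : decaying (fun xi => m (k.+1%:R^-1 *: xi) * (cos th / weight xi)).
    split.
      apply: measurable_funM.
        exact: (measurableT_comp mm (@measurable_scale _)).
      apply: measurable_funM => //; exact: measurable_weightV.
    by exists B => xi; exact: mcos.
  rewrite -[RHS](Rintegral_affine 0 c0); last exact: integrable_decaying.
  rewrite -[RHS]RintegralZl//; last first.
    exact: (integrable_affine 0 c0 (integrable_decaying cd)).
  apply: eq_Rintegral => xi _; rewrite (wave_scale th xi c0 (dP k))
    wave_expabs_rV addr0.
  by rewrite scalerA mulVf ?gt_eqF// scale1r; ring.
(* The dilates of [m] flatten to the constant [m 0], by continuity at the origin. *)
have A3 : A k @[k --> \oo] --> \int[L]_xi (m 0 * (cos th / weight xi)).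
  rewrite (_ : A = fun k => \int[L]_xi (m (k.+1%:R^-1 *: xi) * (cos th / weight
    xi))); last first.
    exact/funext.
  apply: (@Rintegral_cvg _ _ _ _ B) => [k|xi|k xi].
  - apply: measurable_funM.
      exact: (measurableT_comp mm (@measurable_scale _)).
    apply: measurable_funM => //; exact: measurable_weightV.
  - apply: cvgM; last exact: cvg_cst.
    exact: decaying_continuous_dilate.
  - exact: mcos.
have := cvg_unique (@Rhausdorff R) A1 A3.
rewrite RintegralZr//; last by apply: integrable_decaying; split => //;
  exists C.
have -> : \int[L]_xi (m 0 * (cos th / weight xi)) = m 0 * cos th * pi ^+ n.
  by rewrite -Rintegral_weightV; apply: eq_Rintegral => xi _; rewrite mulrA.
have p0 : pi ^+ n != 0 :> R by rewrite expf_neq0// gt_eqF// pi_gt0.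
by move=> H; apply: (mulIf p0); rewrite H (mulrC (m 0)).
Qed.

End inversion.

(** * Convolutions *)

Lemma holder_continuous (R : realType) (V : normedModType R) (f : V ->
  R) (C t : R) :
  0 <= C -> 0 < t ->
  (forall y a, `|a| <= 1 -> `|f (y + a) - f y| <= C * `|a| `^ t) ->
    continuous f.
Proof.
move=> C0 t0 fC z; apply/cvgrPdist_le => e e0.
(* Dividing by [C + 1] is safe even when [C] is 0. *)
pose d := (e / (C + 1)) `^ t^-1.
have ed0 : 0 < e / (C + 1) by rewrite divr_gt0// ltr_wpDl.
have d0 : 0 < d by exact: powR_gt0.
near=> y.
have yz1 : `|y - z| <= 1 by rewrite distrC; near: y; exact: cvgr_dist_le.
have yzd : `|y - z| <= d by rewrite distrC; near: y; exact: cvgr_dist_le.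
rewrite distrC -{1}(subrK z y) [_ - z + z]addrC (le_trans (fC _ _ yz1))//.
rewrite (@le_trans _ _ ((C + 1) * d `^ t))//; last first.
  have C1 : C + 1 != 0 by rewrite lt0r_neq0// ltr_wpDl.
  by rewrite -powRrM mulVf ?lt0r_neq0// powRr1 ?(ltW ed0)// mulrC divfK.
by rewrite ler_pM ?powR_ge0 ?lerDl// ge0_ler_powR ?nnegrE// ltW.
Unshelve. all: by end_near. Qed.

Section kernels.
Context {R : realType} {n : nat}.
Implicit Types (m u f g : 'rV[R]_n -> R) (x y z a h : 'rV[R]_n) (th : R).
Local Notation L := (lebesgue_rV n).

Lemma test_fun_shift m a : test_fun m -> test_fun (fun x => m (x + a)).
Proof.
move=> [sm bm [rho m0]]; split; first exact: smooth_shift.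
  move=> s; have [B mB] := bm s; exists B => x.
  have := @partial_affine _ _ m s 1 a sm.
  under eq_fun do rewrite scale1r.
  by move=> ->; rewrite expr1n mul1r scale1r.
exists (rho + `|a|) => x xr; apply: m0; rewrite -(ltrD2r `|a|) (lt_le_trans
  xr)//.
by rewrite -{1}(addrK a x) (le_trans (ler_normB _ _)).
Qed.

Lemma test_fun_dilate m c : 0 < c -> test_fun m -> test_fun (fun x =>
  m (c^-1 *: x)).
Proof.
move=> c0 [sm bm [rho m0]]; split.
- have := @smooth_affine _ _ m c^-1 0 sm.
  by under eq_fun do rewrite addr0.
- move=> s; have [B mB] := bm s; exists (`|c^-1 ^+ size s| * B) => x.
  have := @partial_affine _ _ m s c^-1 0 sm.
  under eq_fun do rewrite addr0.
  by move=> ->; rewrite normrM ler_wpM2l// addr0.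
- exists (c * rho) => x xr; apply: m0.
  by rewrite normrZ gtr0_norm ?invr_gt0// ltr_pdivlMl.
Qed.

Lemma test_funB m1 m2 : test_fun m1 -> test_fun m2 -> test_fun (fun x =>
  m1 x - m2 x).
Proof.
move=> [sm bm [rho m0]] [sm' bm' [rho' m0']]; split; first exact: smoothB.
  move=> s; have [B mB] := bm s; have [B' mB'] := bm' s; exists (B + B') => x.
  by rewrite partialB// (le_trans (ler_normB _ _))// lerD.
exists (Num.max rho rho') => x; rewrite gt_max => /andP[r1 r2].
by rewrite m0// m0'// subr0.
Qed.

Lemma test_fun_wave_lip m : test_fun m ->
  exists C, 0 <= C /\ forall th z a, `|wave m th (z + a) - wave m th z| <= C *
    `|a|.
Proof.
move=> tm; have dm := test_fun_decaying tm;
  case: tm => sm /(_ [::])/=[B mB] [rho m0].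
(* The support radius [rho] may be negative, hence the maximum with 0. *)
pose r := Num.max rho 0; pose D := r * B * (1 + r ^+ 2) ^+ n.
have D0 : 0 <= D.
  have r0 : 0 <= r by rewrite /r le_max lexx orbT.
  have B0 : 0 <= B by exact: (le_trans (normr_ge0 _) (mB 0)).
  by rewrite !mulr_ge0// exprn_ge0// addr_ge0// sqr_ge0.
exists (2 * pi * n%:R * D * pi ^+ n); split.
  by do !apply: mulr_ge0 => //; rewrite ?exprn_ge0 ?pi_ge0.
move=> th z a; apply: wave_lip => //; first exact: smooth_measurable.
move=> x; rewrite (_ : `|x| * `|m x| = `| `|x| * m x |);
  last by rewrite normrM normr_id.
apply: (@bounded_supp_le _ _ (fun x => `|x| * m x)) => {}x; last first.
  by rewrite gt_max => /andP[/m0-> _]; rewrite mulr0.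
have r0 : 0 <= r by rewrite /r le_max lexx orbT.
have [xr|/m0->] := leP `|x| rho; last first.
  by rewrite mulr0 normr0 mulr_ge0//; exact: (le_trans (normr_ge0 _) (mB 0)).
by rewrite normrM normr_id ler_pM// le_max xr.
Qed.

Lemma measurable_wave m th : test_fun m -> measurable_fun setT (wave m th).
Proof.
move=> /test_fun_wave_lip[C [C0 mC]]; apply: continuous_measurable_rV.
apply: (@holder_continuous _ _ _ C 1) => // y a _; first by rewrite powRr1.
Qed.

Lemma decaying_wave m th : test_fun m -> decaying (wave m th).
Proof.
move=> tm; split; first exact: measurable_wave.
by have [C mC] := wave_decay 1 tm; exists C => z; exact: mC.
Qed.

Lemma test_fun_continuous m : test_fun m -> continuous m.
Proof. by case=> sm _ _; exact: smooth_continuous. Qed.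

(** Inversion at [xi] is inversion at 0 for the symbol translated by [xi], whose transform is given
    by [wave_shift]. *)
Lemma fourier_inversion m th xi : test_fun m ->
  \int[L]_y wave m (th - 2 * pi * dotp y xi) y = cos th * m xi.
Proof.
move=> tm; have tms := test_fun_shift xi tm.
have [C mC] := wave_decay 1 tms.
have := @wave_integral _ _ _ th C (test_fun_decaying tms)
  (@test_fun_continuous _ tms 0) (measurable_wave th tms) (mC th).
rewrite add0r => <-; apply: eq_Rintegral => y _.
by rewrite wave_shift//; exact: test_fun_decaying.
Qed.

Lemma decaying_wave_phase m th xi : test_fun m ->
  decaying (fun y => wave m (th - 2 * pi * dotp y xi) y).
Proof.
move=> tm; rewrite (_ : (fun y => _) = wave (fun x => m (x + xi)) th).
  exact/decaying_wave/test_fun_shift.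
by apply/funext => y; rewrite wave_shift//; exact: test_fun_decaying.
Qed.

Lemma decayingZr f c : decaying f -> decaying (fun x => f x * c).
Proof. by move=> /(decayingZ c); under eq_fun do rewrite mulrC. Qed.

Lemma cos_subpihalf (a b : R) : cos (a + (b - pi / 2)) = sin (a + b).
Proof. by rewrite addrA cosB cos_pihalf sin_pihalf mulr0 add0r mulr1. Qed.

Lemma measurable_subr x : measurable_fun setT (fun y : 'rV[R]_n => x - y).
Proof.
apply: measurable_fun_rV => i; under eq_fun do rewrite !mxE.
by apply: measurable_funB => //; exact: measurable_coord.
Qed.

(** Convolution theorem; the difference of two products is the real part of a product of complex
    kernels. After Fubini the inner integral in [y] is the inversion formula for [m2]. *)
Lemma wave_mul m1 m2 th x : decaying m1 -> test_fun m2 ->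
  wave (fun xi => m1 xi * m2 xi) th x =
  \int[L]_y (wave m1 th (x - y) * wave m2 0 y -
             wave m1 (th - pi / 2) (x - y) * wave m2 (- (pi / 2)) y).
Proof.
move=> dm1 tm2; have dm2 := test_fun_decaying tm2.
have [mm1 [B1 m1B]] := dm1; have [C wC] := wave_decay 1 tm2.
pose ph y xi := 2 * pi * dotp (x - y) xi.
pose F y xi := m1 xi * cos (ph y xi + th) * wave m2 0 y -
               m1 xi * cos (ph y xi + (th - pi / 2)) * wave m2 (- (pi / 2)) y.
have FE y xi : F y xi = m1 xi * wave m2 (ph y xi + th) y.
  by rewrite /F [in RHS]wave_phase// cos_subpihalf; ring.
transitivity (\int[L]_xi \int[L]_y F y xi).
  apply: eq_Rintegral => xi _; under eq_Rintegral do rewrite FE.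
  have -> : (fun y => m1 xi * wave m2 (ph y xi + th) y) =
      (fun y => m1 xi * wave m2 ((2 * pi * dotp x xi + th) - 2 * pi * dotp y
        xi) y).
    apply/funext => y; congr (_ * wave _ _ _); rewrite /ph dotpDl dotpNl.
    by ring.
  rewrite RintegralZl//; last exact/integrable_decaying/decaying_wave_phase.
  by rewrite fourier_inversion// -mulrA (mulrC (m2 _)).
have mph (t : R) : measurable_fun [set: 'rV[R]_n * 'rV[R]_n]
    (fun p => m1 p.2 * cos (ph p.1 p.2 + t)).
  apply: measurable_funM; first exact: (measurableT_comp mm1 measurable_snd).
  apply: measurable_phase => //.
  exact: (measurableT_comp (measurable_subr x) measurable_fst).
have mF : measurable_fun [set: 'rV[R]_n * 'rV[R]_n] (fun p => F p.1 p.2).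
  apply: measurable_funB; apply: measurable_funM => //.
    exact: (measurableT_comp (measurable_wave 0 tm2) measurable_fst).
  exact: (measurableT_comp (measurable_wave (- (pi / 2)) tm2) measurable_fst).
rewrite -(@Rintegral_Fubini _ _ _ _ _ L L F (fun y => C / weight y) (fun xi =>
  B1 / weight xi))//; last 3 first.
- exact: integrable_weightV.
- exact: integrable_weightV.
- by move=> y xi; rewrite FE normrM mulrC ler_pM//; exact: wC.
apply: eq_Rintegral => y _; rewrite /F RintegralB//; last 2 first.
- exact/integrable_decaying/decayingZr/decaying_phase.
- exact/integrable_decaying/decayingZr/decaying_phase.
rewrite !RintegralZr//.
- exact/integrable_decaying/decaying_phase.
- exact/integrable_decaying/decaying_phase.
Qed.

Definition conv u f x := \int[L]_y (u (x - y) * f y).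

Lemma decaying_conv u f x M : measurable_fun setT u -> (forall x,
  `|u x| <= M) ->
  decaying f -> decaying (fun y => u (x - y) * f y).
Proof.
move=> mu uM [mf [C fC]]; split.
  by apply: measurable_funM => //; exact: (measurableT_comp mu (measurable_subr
    x)).
by exists (M * C) => y; rewrite normrM -mulrA ler_pM.
Qed.

Lemma conv_translate u f x h M : measurable_fun setT u -> (forall x,
  `|u x| <= M) ->
  decaying f -> conv u f (x + h) = \int[L]_y (u (x - y) * f (y + h)).
Proof.
move=> mu uM df; rewrite /conv -(Rintegral_translate h); last first.
  exact/integrable_decaying/(decaying_conv _ mu uM).
by apply: eq_Rintegral => y _; rewrite opprD addrACA subrr addr0.
Qed.

(** A translation moves the increment from [u] to the kernel, so nothing but boundedness is asked of
    [u]. *)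
Lemma conv_modulus u f x h M g : measurable_fun setT u -> (forall x,
  `|u x| <= M) ->
  decaying f -> L.-integrable setT (EFin \o g) ->
  (forall y, `|f (y + h) - f y| <= g y) ->
  `|conv u f (x + h) - conv u f x| <= M * \int[L]_y g y.
Proof.
move=> mu uM df ig fg; rewrite (conv_translate _ _ mu uM)//
  /conv -RintegralB//; last 2 first.
- apply/integrable_decaying/(decaying_conv _ mu uM); exact: decaying_shift.
- exact/integrable_decaying/(decaying_conv _ mu uM).
have dd := decayingB (decaying_conv x mu uM (decaying_shift h df))
  (decaying_conv x mu uM df).
rewrite (le_trans (le_normr_Rintegral _ _))//; first exact: integrable_decaying.
rewrite -RintegralZl//; apply: le_Rintegral => //.
- have : decaying (fun y => `|u (x - y) * f (y + h) - u (x - y) * f y|).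
    case: dd => md [C dC]; split; first exact: measurableT_comp.
    by exists C => y; rewrite normr_id.
  exact: integrable_decaying.
- exact: integrableZl ig.
- by move=> y _; rewrite -mulrBr normrM ler_pM.
Qed.

Lemma weight_subV x y : (weight (x - y))^-1 <= 2 ^+ n * weight y / weight x.
Proof.
rewrite ler_pdivlMr ?weight_gt0// ler_pdivrMl ?weight_gt0// mulrCA.
by rewrite -{1}(subrK y x) weightD.
Qed.

(** To dominate the integrand by a product, [weight_subV] separates the variables of [f (z - y)] at
    the price of one factor [weight y]. This is why [g] must decay like the square of the weight. *)
Lemma conv_assoc u f g x M C D : measurable_fun setT u -> (forall x,
  `|u x| <= M) ->
  measurable_fun setT f -> (forall x, `|f x| <= C / weight x) ->
  measurable_fun setT g -> (forall x, `|g x| <= D / weight x ^+ 2) ->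
  \int[L]_z (u (x - z) * \int[L]_y (f (z - y) * g y)) =
  \int[L]_y (conv u f (x - y) * g y).
Proof.
move=> mu uM mf fC mg gD.
have M0 : 0 <= M := le_trans (normr_ge0 _) (uM 0).
have W1 y : 0 <= (weight y)^-1 <= 1.
  by rewrite invr_ge0 ltW ?weight_gt0//= invf_le1 ?weight_gt0// weight_ge1.
have C0 : 0 <= C.
  have := le_trans (normr_ge0 _) (fC 0).
  by rewrite pmulr_lge0// invr_gt0 weight_gt0.
have D0 : 0 <= D.
  have := le_trans (normr_ge0 _) (gD 0).
  by rewrite pmulr_lge0// invr_gt0 exprn_gt0// weight_gt0.
have fB y : `|f y| <= C.
  by rewrite (le_trans (fC y))// ler_piMr//; case/andP: (W1 y).
have df : decaying f by split => //; exists C.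
have dg : decaying g.
  split => //; exists D => y; rewrite (le_trans (gD y))// ler_wpM2l//.
  by rewrite lef_pV2 ?posrE ?exprn_gt0 ?weight_gt0// -[leLHS]expr1 ler_weXn2l//
    weight_ge1.
pose F z y := u (x - z) * f (z - y) * g y.
transitivity (\int[L]_z \int[L]_y F z y).
  apply: eq_Rintegral => z _; rewrite -RintegralZl//; last first.
    exact/integrable_decaying/(decaying_conv _ mf fB).
  by apply: eq_Rintegral => y _; rewrite /F mulrA.
have mF : measurable_fun [set: 'rV[R]_n * 'rV[R]_n] (fun p => F p.1 p.2).
  apply: measurable_funM; last exact: (measurableT_comp mg measurable_snd).
  apply: measurable_funM.
    apply: (measurableT_comp mu).
    exact: (measurableT_comp (measurable_subr x) measurable_fst).
  apply: (@measurableT_comp _ _ _ _ _ _ f) => //.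
  apply: measurable_fun_rV => i; under eq_fun do rewrite !mxE.
  by apply: measurable_funB; exact: measurable_coord.
rewrite (@Rintegral_Fubini _ _ _ _ _ L L F (fun y =>
  M * C * 2 ^+ n / weight y) (fun y => D / weight y))//; last 3 first.
- exact: integrable_weightV.
- exact: integrable_weightV.
- move=> z y; rewrite /F !normrM.
  apply: (@le_trans _ _ (M * (C * (2 ^+ n * weight y / weight z)) * (D / weight
    y ^+ 2))).
    rewrite ler_pM// ler_pM// (le_trans (fC _))// ler_wpM2l//.
    exact: weight_subV.
  rewrite [leLHS](_ : _ = M * C * 2 ^+ n / weight z * (D / weight y))//.
  by field; rewrite !gt_eqF ?weight_gt0.
apply: eq_Rintegral => y _; rewrite /F RintegralZr//; last first.
  rewrite (_ : _ \o _ = EFin \o (fun z => u (x - z) * f (z + - y)))//.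
  apply/integrable_decaying/(decaying_conv _ mu uM); exact: decaying_shift.
congr (_ * _).
have := @conv_translate u (fun z => f (z - y)) (x - y) y M mu uM
  (decaying_shift (- y) df).
rewrite subrK /conv => ->.
by apply: eq_Rintegral => z _; rewrite addrK.
Qed.

End kernels.

(** * Kernel estimates uniform in the dilation *)

Section bernstein.
Context {R : realType} {n : nat}.
Implicit Types (m u f g : 'rV[R]_n -> R) (x y z a h : 'rV[R]_n) (th M A : R).
Local Notation L := (lebesgue_rV n).

(* Interpolation between the Lipschitz bound and the arbitrarily fast decay. *)
Lemma wave_holder m t : test_fun m -> 0 < t < 1 ->
  exists E, 0 <= E /\ forall th z a, `|a| <= 1 ->
    `|wave m th (z + a) - wave m th z| <= E * `|a| `^ t / weight z.
Proof.
move=> tm /andP[t0 t1].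
have [C1 [C10 lip]] := test_fun_wave_lip tm.
(* Decay of order [k], raised to the power 1 - t in the interpolation, must still leave one full
   power of the weight. *)
pose k := Num.bound (1 - t)^-1.
have kt : 1 <= k%:R * (1 - t).
  rewrite -ler_pdivrMr ?subr_gt0// mul1r; apply/ltW/archi_boundP.
  by rewrite invr_ge0 subr_ge0 ltW.
have [C wC] := wave_decay k tm.
have C0 : 0 <= C.
  have := le_trans (normr_ge0 _) (wC 0 0).
  by rewrite pmulr_lge0// invr_gt0 exprn_gt0// weight_gt0.
(* Bounds the values at [z + a] and at [z]; for |a| <= 1 the weights at these points differ by at
   most 4^n, of which 2^n comes from Peetre's inequality and 2^n from [weight a]. *)
pose C2 := C * (4 ^+ n) ^+ k + C.
have C20 : 0 <= C2 by rewrite addr_ge0 ?mulr_ge0 ?exprn_ge0.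
exists (C1 `^ t * C2 `^ (1 - t)); split; first by rewrite mulr_ge0 ?powR_ge0.
move=> th z a a1; set D := `|_|.
have W0 : 0 < weight z := weight_gt0 z.
have D1 : D <= C1 * `|a| by exact: lip.
have D2 : D <= C2 / weight z ^+ k.
  rewrite (le_trans (ler_normB _ _))// mulrDl lerD// (le_trans (wC _ _))//.
  rewrite -mulrA ler_wpM2l// -!exprVn -exprMn lerXn2r ?nnegrE ?mulr_ge0
    ?invr_ge0 ?exprn_ge0 ?(ltW (weight_gt0 _))//.
  rewrite -[a]opprK (le_trans (weight_subV _ _))// weightN ler_pM2r ?invr_gt0//.
  rewrite (_ : 4 = 2 * 2) ?exprMn ?ler_wpM2l ?exprn_ge0//; last by ring.
  by rewrite (le_trans (weight_le a1))// expr1n.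
have D0 : 0 <= D by exact: normr_ge0.
move: D D0 D1 D2 => D D0 D1 D2.
have t1t : t + (1 - t) = 1 by rewrite addrC subrK.
have -> : D = D `^ t * D `^ (1 - t).
  by rewrite -powRD t1t ?powRr1// oner_eq0.
rewrite [leRHS](_ : _ = C1 `^ t * `|a| `^ t * (C2 `^ (1 - t) / weight z));
  last by ring.
rewrite ler_pM ?powR_ge0//.
  by rewrite -powRM// ge0_ler_powR ?nnegrE// ?mulr_ge0// ltW.
have t10 : 0 <= 1 - t by rewrite subr_ge0 ltW.
apply: (@le_trans _ _ ((C2 / weight z ^+ k) `^ (1 - t))).
  by rewrite ge0_ler_powR ?nnegrE// ?mulr_ge0 ?invr_ge0 ?exprn_ge0// ltW.
rewrite powRM ?invr_ge0 ?exprn_ge0 ?(ltW W0)// ler_wpM2l ?powR_ge0//.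
rewrite -powR_mulrn ?(ltW W0)// -powRN -powRrM -[leRHS]powR_inv1 ?(ltW W0)//.
by rewrite ler_powR ?weight_ge1// mulNr lerN2.
Qed.

Definition dilate (c : R) m := fun x => m (c^-1 *: x).

Lemma wave_dilate m c th z : 0 < c -> test_fun m ->
  wave (dilate c m) th z = c ^+ n * wave m th (c *: z).
Proof.
move=> c0 tm; apply: (@wave_scale R n m) => //.
exact/test_fun_decaying/test_fun_dilate.
Qed.

(* The exponent [t < 1] spares a kernel gradient; any [t > beta * q] will do. *)
Lemma bernstein m t : test_fun m -> 0 < t < 1 ->
  exists E, 0 <= E /\ forall c u M th x h, 0 < c -> measurable_fun setT u ->
    (forall x, `|u x| <= M) -> c * `|h| <= 1 ->
    `|conv u (wave (dilate c m) th) (x + h) - conv u (wave (dilate c m) th) x|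
      <= M * (E * (c * `|h|) `^ t).
Proof.
move=> tm t01; have [E [E0 wE]] := wave_holder tm t01.
exists (E * pi ^+ n); split; first by rewrite mulr_ge0// exprn_ge0// pi_ge0.
move=> c u M th x h c0 mu uM ch.
(* The majorant of the increments of the undilated kernel. The integral of c^n G(c y) does not
   depend on [c], so the dilation enters only through the factor [(c * |h|) ^ t]. *)
pose G z := E * (c * `|h|) `^ t / weight z.
have iG : L.-integrable setT (EFin \o G) by exact: integrable_weightV.
have iGc : L.-integrable setT (EFin \o (fun y => c ^+ n * G (c *: y + 0))).
  exact: (integrableZl _ _ (integrable_affine 0 c0 iG)).
have IG : \int[L]_y (c ^+ n * G (c *: y + 0)) = E * pi ^+ n * (c * `|h|) `^ t.
  rewrite RintegralZl//; last exact: integrable_affine.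
  by rewrite Rintegral_affine// Rintegral_weightV mulrAC.
rewrite -IG; apply: (conv_modulus _ mu uM) => //.
  exact/decaying_wave/test_fun_dilate.
move=> y; rewrite !wave_dilate// -mulrBr normrM ger0_norm ?exprn_ge0 ?(ltW
  c0)//.
rewrite ler_wpM2l ?exprn_ge0 ?(ltW c0)// scalerDr addr0.
have ch1 : `|c *: h| = c * `|h| by rewrite normrZ gtr0_norm.
by rewrite /G -ch1; apply: wE; rewrite ch1.
Qed.

(** By inversion at 0 the kernel has integral cos(th) m(0), so the difference is an integral of
    increments of [u] against it. In the variable z = c y the first moment is finite and free of
    [c], since 1 + |z| <= 2 weight(z) and the kernel decays like the squared weight. *)
Lemma conv_moment m : test_fun m ->
  exists D, 0 <= D /\ forall c u M A th x, 0 < c -> measurable_fun setT u ->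
    (forall x, `|u x| <= M) -> (forall y,
      `|u (x - y) - u x| <= A * (1 + c * `|y|)) ->
    `|conv u (wave (dilate c m) th) x - cos th * m 0 * u x| <= A * D.
Proof.
move=> tm; have [C wC] := wave_decay 2 tm.
have C0 : 0 <= C.
  have := le_trans (normr_ge0 _) (wC 0 0).
  by rewrite pmulr_lge0// invr_gt0 exprn_gt0// weight_gt0.
exists (2 * C * pi ^+ n); split; first by rewrite !mulr_ge0// exprn_ge0//
  pi_ge0.
move=> c u M A th x c0 mu uM uA.
have tmc := test_fun_dilate c0 tm.
have dw := decaying_wave th tmc.
have -> : cos th * m 0 * u x = \int[L]_y (u x * wave (dilate c m) th y).
  rewrite RintegralZl//; last exact: integrable_decaying.
  have := fourier_inversion th 0 tmc.
  rewrite scaler0 => <-; rewrite mulrC; congr (_ * _).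
  apply: eq_Rintegral => y _; congr (wave _ _ _).
  by rewrite /dotp big1 ?mulr0 ?subr0// => i _; rewrite mxE mulr0.
rewrite /conv -RintegralB//; last 2 first.
- exact/integrable_decaying/(decaying_conv _ mu uM).
- exact/integrable_decaying/decayingZ.
have dd := decayingB (decaying_conv x mu uM dw) (decayingZ (u x) dw).
rewrite (le_trans (le_normr_Rintegral _ _))//; first exact: integrable_decaying.
have A0 : 0 <= A.
  have := le_trans (normr_ge0 _) (uA 0).
  by rewrite normr0 mulr0 addr0 mulr1.
pose G z := A * (2 * C) / weight z.
have iG : L.-integrable setT (EFin \o G) by exact: integrable_weightV.
have iGc : L.-integrable setT (EFin \o (fun y => c ^+ n * G (c *: y + 0))).
  exact: (integrableZl _ _ (integrable_affine 0 c0 iG)).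
have IG : \int[L]_y (c ^+ n * G (c *: y + 0)) = A * (2 * C * pi ^+ n).
  rewrite RintegralZl//; last exact: integrable_affine.
  by rewrite Rintegral_affine// Rintegral_weightV; ring.
rewrite -IG; apply: le_Rintegral => //.
- have : decaying (fun y => `|u (x - y) * wave (dilate c m) th y - u x * wave
  (dilate c m) th y|).
    case: dd => md [B dB]; split; first exact: measurableT_comp.
    by exists B => y; rewrite normr_id.
  exact: integrable_decaying.
- move=> y _; rewrite -mulrBl normrM wave_dilate// normrM.
  rewrite (ger0_norm (exprn_ge0 _ (ltW c0))) addr0 mulrCA.
  rewrite ler_wpM2l ?exprn_ge0 ?(ltW c0)//.
  set z := c *: y.
  have cy : c * `|y| = `|z| by rewrite /z normrZ gtr0_norm.
  apply: (@le_trans _ _ (A * (1 + `|z|) * (C / weight z ^+ 2))).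
    by rewrite ler_pM// -cy.
  rewrite [leRHS](_ : _ = A * (2 * weight z) * (C / weight z ^+ 2)); last first.
    by rewrite /G; field; rewrite gt_eqF ?weight_gt0.
  rewrite ler_wpM2r ?mulr_ge0 ?invr_ge0 ?exprn_ge0 ?(ltW (weight_gt0 _))//.
  rewrite ler_wpM2l// mulr_natl mulr2n lerD ?weight_ge1//.
  exact: norm_le_weight.
Qed.

(** Approximate identity. Rescaling moves the dilation from the kernel to [u], after which a single
    majorant serves all [k]. *)
Lemma conv_dilate_cvg m u M (c : nat -> R) x : test_fun m ->
  continuous u -> (forall x, `|u x| <= M) -> (forall k, 0 < c k) ->
  (c k)^-1 @[k --> \oo] --> 0 ->
  conv u (wave (dilate (c k) m) 0) x @[k --> \oo] --> m 0 * u x.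
Proof.
move=> tm cu uM c0 cy.
have mu := continuous_measurable_rV cu.
have [C wC] := wave_decay 1 tm.
have mwave := measurable_wave 0 tm.
have -> : (fun k => conv u (wave (dilate (c k) m) 0) x) =
    (fun k => \int[L]_z (u (x - (c k)^-1 *: z) * wave m 0 z)).
  apply/funext => k.
  have dF : decaying (fun z => u (x - (c k)^-1 *: z) * wave m 0 z).
    split.
      apply: measurable_funM => //.
      apply: (measurableT_comp mu).
      exact: (measurableT_comp (measurable_subr x) (measurable_scale _)).
    by exists (M * C) => z; rewrite normrM -mulrA ler_pM//; exact: wC.
  rewrite -(Rintegral_affine 0 (c0 k)); last exact: integrable_decaying.
  rewrite -RintegralZl//; last first.
    exact: (integrable_affine 0 (c0 k) (integrable_decaying dF)).
  apply: eq_Rintegral => y _; rewrite wave_dilate// addr0.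
  by rewrite scalerA mulVf ?gt_eqF// scale1r mulrCA.
have -> : m 0 * u x = \int[L]_z (u x * wave m 0 z).
  rewrite RintegralZl//; last exact/integrable_decaying/decaying_wave.
  have := fourier_inversion 0 0 tm; rewrite cos0 mul1r => <-; rewrite mulrC;
    congr (_ * _).
  apply: eq_Rintegral => y _; congr (wave _ _ _).
  by rewrite /dotp big1 ?mulr0 ?subr0// => i _; rewrite mxE mulr0.
apply: (@Rintegral_cvg _ _ _ _ (M * C)) => [k|z|k z].
- apply: measurable_funM => //; apply: (measurableT_comp mu).
  exact: (measurableT_comp (measurable_subr x) (measurable_scale _)).
- apply: cvgM; last exact: cvg_cst.
  have cx : x - (c k)^-1 *: z @[k --> \oo] --> x.
    rewrite -[X in _ --> X]subr0 -(scale0r z).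
    by apply: cvgB; [exact: cvg_cst|exact: cvgZr_tmp].
  exact: (@cvg_comp _ _ _ (fun k : nat =>
    x - (c k)^-1 *: z) u _ (nbhs x) (nbhs (u x)) cx (cu x)).
- by rewrite normrM -mulrA ler_pM//; exact: wC.
Qed.

(** The convolution is even Hoelder continuous, with any exponent below 1; the exponent 1/2 is an
    arbitrary choice. *)
Lemma measurable_conv_wave m u M th : test_fun m -> measurable_fun setT u ->
  (forall x, `|u x| <= M) -> measurable_fun setT (conv u (wave m th)).
Proof.
move=> tm mu uM; apply: continuous_measurable_rV.
have h01 : 0 < (2^-1 : R) < 1 by apply/andP; split; lra.
have [E [E0 wE]] := wave_holder tm h01.
have M0 : 0 <= M := le_trans (normr_ge0 _) (uM 0).
apply: (@holder_continuous _ _ _ (M * (E * pi ^+ n)) 2^-1) => //.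
- by rewrite !mulr_ge0// exprn_ge0// pi_ge0.
- move=> x a a1; rewrite (_ : M * _ * _ = M * (E * `|a| `^ 2^-1 * pi ^+ n));
  last by ring.
  rewrite -Rintegral_weightV; apply: (conv_modulus _ mu uM) => //.
  + exact: decaying_wave.
  + exact: integrable_weightV.
  + by move=> y; exact: wE.
Qed.

Lemma decaying_conv_wave m1 m2 t s : test_fun m1 -> test_fun m2 ->
  decaying (conv (wave m1 t) (wave m2 s)).
Proof.
move=> tm1 tm2.
have [C w1C] := wave_decay 1 tm1; have [D w2D] := wave_decay 2 tm2.
have C0 : 0 <= C.
  have := le_trans (normr_ge0 _) (w1C 0 0).
  by rewrite pmulr_lge0// invr_gt0 exprn_gt0// weight_gt0.
have D0 : 0 <= D.
  have := le_trans (normr_ge0 _) (w2D 0 0).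
  by rewrite pmulr_lge0// invr_gt0 exprn_gt0// weight_gt0.
have w1B x : `|wave m1 t x| <= C.
  rewrite (le_trans (w1C _ _))// ler_piMr// invf_le1 ?exprn_gt0 ?weight_gt0//.
  by rewrite weight_ge1.
split; first exact: (measurable_conv_wave _ _ (measurable_wave t tm1) w1B).
exists (C * 2 ^+ n * D * pi ^+ n) => x.
rewrite mulrAC; apply: le_Rintegral_decaying.
  apply: measurable_funM; last exact: measurable_wave.
  exact: (measurableT_comp (measurable_wave t tm1) (measurable_subr x)).
move=> y; rewrite normrM.
apply: (@le_trans _ _ ((C * (2 ^+ n * weight y / weight x)) * (D / weight y ^+
  2))).
  rewrite ler_pM//; rewrite (le_trans (w1C _ _))// ler_wpM2l//.
  exact: weight_subV.
rewrite [leLHS](_ : _ = C * 2 ^+ n * D / weight x / weight y)//.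
by field; rewrite !gt_eqF ?weight_gt0.
Qed.

(** As the symbols multiply to [m1], the kernel of [m1] is its own convolution with that of [m2];
    associativity hands the second factor to [conv u]. Reproducing lets a bound on [conv u] replace
    the bound on [u]. *)
Lemma conv_reproduce m1 m2 u M th x : measurable_fun setT u -> (forall x,
  `|u x| <= M) ->
  test_fun m1 -> test_fun m2 -> (forall xi, m1 xi * m2 xi = m1 xi) ->
  conv u (wave m1 th) x = conv (conv u (wave m1 th)) (wave m2 0) x -
    conv (conv u (wave m1 (th - pi / 2))) (wave m2 (- (pi / 2))) x.
Proof.
move=> mu uM tm1 tm2 m12.
have [C w1C] := wave_decay 1 tm1; have [D w2D] := wave_decay 2 tm2.
have mw1 t := measurable_wave t tm1; have mw2 t := measurable_wave t tm2.
have dw1 t := decaying_wave t tm1; have dw2 t := decaying_wave t tm2.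
have wB t y : `|wave m1 t y| <= C.
  rewrite (le_trans (w1C t y))// ler_piMr ?invf_le1 ?exprn_gt0 ?weight_gt0
    ?weight_ge1//.
  have := le_trans (normr_ge0 _) (w1C 0 0).
  by rewrite pmulr_lge0// invr_gt0 exprn_gt0// weight_gt0.
have E t s := conv_assoc x mu uM (mw1 t) (w1C t) (mw2 s) (w2D s).
rewrite {2 4}/conv -!E -RintegralB//; last 2 first.
- exact/integrable_decaying/(decaying_conv _ mu uM)/decaying_conv_wave.
- exact/integrable_decaying/(decaying_conv _ mu uM)/decaying_conv_wave.
apply: eq_Rintegral => z _; rewrite -mulrBr; congr (_ * _).
rewrite -RintegralB//; last 2 first.
- exact/integrable_decaying/(decaying_conv _ (mw1 _) (wB _)).
- exact/integrable_decaying/(decaying_conv _ (mw1 _) (wB _)).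
rewrite -wave_mul//; last exact: test_fun_decaying.
by congr (wave _ _ _); apply/funext => xi; rewrite m12.
Qed.

End bernstein.

(** * Bounds for O-RV functions *)

Section orv_bounds.
Context {R : realType}.
Variable w : R -> R.
Hypothesis w_gt0 : forall x, 0 < x -> 0 < w x.
Hypothesis w_nd : forall x y, 0 < x -> x <= y -> w x <= w y.

Lemma at_right0P (A : set R) :
  (0^'+ A) <-> exists2 d, 0 < d & forall x, 0 < x -> x < d -> A x.
Proof.
split=> [/nbhs_ballP[d d0 dA]|[d d0 dA]].
  exists d => // x x0 xd; apply: dA => //=.
  by rewrite /ball/= sub0r normrN gtr0_norm.
apply/nbhs_ballP; exists d => // x; rewrite /ball/= sub0r normrN => xd x0.
by apply: dA => //; rewrite (le_lt_trans (ler_norm x)).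
Qed.

Let rho e := fine (orv_r1 w e).

Lemma orv_r1_lt e M : orv_at_zero w -> 0 < e -> rho e < M ->
  exists2 d, 0 < d & forall x, 0 < x -> x < d -> w (e * x) <= M * w x.
Proof.
move=> horv e0 eM.
have : (orv_r1 w e < M%:E)%E.
  have := horv e e0; rewrite /rho in eM; case: (orv_r1 w e) eM => [r||]//=.
  by rewrite ltNyr.
move=> /ereal_inf_lt[_ [A /at_right0P[d d0 dA] <-] AM].
exists d => // x x0 xd; rewrite -ler_pdivrMr ?w_gt0// -lee_fin ltW//.
apply: le_lt_trans AM; apply: ereal_sup_ubound; exists x => //; exact: dA.
Qed.

Lemma orv_r1_le e M d : 0 < e -> 0 < d ->
  (forall x : R, 0 < x -> x < d -> w (e * x) <= M * w x) -> rho e <= M.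
Proof.
move=> e0 d0 dM.
have M0 : 0 <= M.
  have d20 : 0 < d / 2 by rewrite divr_gt0.
  rewrite -(pmulr_lge0 _ (w_gt0 d20)) (le_trans _ (dM _ d20 _))//.
    by rewrite ltW// w_gt0// mulr_gt0.
  by rewrite ltr_pdivrMr// ltr_pMr// ltr1n.
have : (orv_r1 w e <= M%:E)%E.
  apply: (@le_trans _ _ (ereal_sup ((fun x =>
    (w (e * x) / w x)%:E) @` [set x | 0 < x < d]))).
    apply: ereal_inf_lbound; exists [set x | 0 < x < d] => //.
    by apply/at_right0P; exists d => // x /= -> ->.
  apply: ge_ereal_sup => _ [x /= /andP[x0 xd] <-].
  by rewrite lee_fin ler_pdivrMr ?w_gt0// dM.
by rewrite /rho; case: (orv_r1 w e).
Qed.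

(** Monotonicity of [w]. Its logarithm is then nonnegative, which bounds from below the set whose
    infimum is taken in [orv_q1_bound]. *)
Lemma orv_r1_ge1 e : orv_at_zero w -> 1 <= e -> 1 <= rho e.
Proof.
move=> horv e1; have e0 : 0 < e by exact: lt_le_trans e1.
rewrite leNgt; apply/negP => r1.
have [|d d0 dM] := @orv_r1_lt e ((rho e + 1) / 2) horv e0; first by lra.
have d20 : 0 < d / 2 by rewrite divr_gt0.
have := dM _ d20; rewrite ltr_pdivrMr// ltr_pMr// ltr1n => /(_ isT).
apply/negP; rewrite -ltNge (@lt_le_trans _ _ (w (d / 2)))//.
  by rewrite gtr_pMl ?w_gt0//; lra.
by apply: w_nd => //; rewrite ler_peMl// ltW.
Qed.

Lemma log_scale (e1 e : R) : 1 < e1 -> 1 <= e -> exists2 t,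
  0 <= t & e = e1 `^ t.
Proof.
move=> e11 e_ge1; have l0 : 0 < ln e1 by rewrite ln_gt0.
exists (ln e / ln e1); first by rewrite divr_ge0 ?ln_ge0// ltW.
rewrite /powR gt_eqF ?(lt_trans _ e11)// divfK ?gt_eqF// lnK// posrE.
exact: lt_le_trans e_ge1.
Qed.

(** Write e = e1^t and iterate the one-step bound floor(t) + 1 times, rounding up by monotonicity;
    the extra step costs the factor e1^a. *)
Lemma growth_iter (e1 a d : R) : 1 < e1 -> 0 < a ->
  (forall x : R, 0 < x -> x < d -> w (e1 * x) <= e1 `^ a * w x) ->
  forall e x : R, 1 <= e -> 0 < x -> e * x < d ->
    w (e * x) <= e1 `^ a * e `^ a * w x.
Proof.
move=> e11 a0 dM e x e_ge1 x0 ed.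
have e10 : 0 < e1 by exact: lt_trans e11.
have [t t0 eE] := log_scale e11 e_ge1.
have iter n : e1 ^+ n * x < d -> w (e1 ^+ n.+1 * x) <= (e1 `^ a) ^+ n.+1 * w x.
  elim: n => [|n IH]; first by rewrite mul1r !expr1; exact: dM.
  move=> nd; rewrite exprS -mulrA (le_trans (dM _ _ _))//.
    by rewrite mulr_gt0// exprn_gt0.
  rewrite [(e1 `^ a) ^+ n.+2]exprS -mulrA ler_wpM2l ?powR_ge0// IH//.
  by rewrite (le_lt_trans _ nd)// ler_pM2r// ler_weXn2l// ltW.
have /andP[nt tn] := truncn_itv t0.
set n := Num.truncn t in nt tn.
have ne : e1 ^+ n <= e.
  by rewrite -powR_mulrn ?(ltW e10)// eE ler_powR// ltW.
have en : e <= e1 ^+ n.+1.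
  by rewrite -powR_mulrn ?(ltW e10)// eE ler_powR// ltW.
apply: (@le_trans _ _ (w (e1 ^+ n.+1 * x))).
  by apply: w_nd; [rewrite mulr_gt0// (lt_le_trans _ e_ge1)|rewrite ler_pM2r].
apply: (le_trans (iter n _)).
  by rewrite (le_lt_trans _ ed)// ler_pM2r.
rewrite ler_pM2r ?w_gt0// exprS ler_wpM2l ?powR_ge0//.
rewrite -powR_mulrn ?powR_ge0// eE -!powRrM mulrC.
by rewrite ler_powR ?(ltW e11)// ler_pM2r.
Qed.

(** As in [growth_iter], but monotonicity now requires rounding the exponent down, and the missing
    step costs e1^(-a). *)
Lemma decrease_iter (e1 a d : R) : 0 < e1 < 1 -> 0 < a ->
  (forall x : R, 0 < x -> x < d -> w (e1 * x) <= e1 `^ a * w x) ->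
  forall e x : R, 0 < e -> e <= 1 -> 0 < x -> x < d ->
    w (e * x) <= e1 `^ (- a) * e `^ a * w x.
Proof.
move=> /andP[e10 e11] a0 dM e x e0 e_le1 x0 xd.
have [t t0 eE] : exists2 t, 0 <= t & e = e1 `^ t.
  have [||t t0 tE] := @log_scale e1^-1 e^-1; rewrite ?invf_gt1 ?invf_ge1//.
  exists t => //; rewrite -[LHS]invrK tE -(powR_inv1 (ltW e10)) -powRrM mulN1r.
  by rewrite powRN invrK.
have iter n : w (e1 ^+ n * x) <= (e1 `^ a) ^+ n * w x.
  elim: n => [|n IH]; first by rewrite !expr0 !mul1r.
  rewrite exprS -mulrA (le_trans (dM _ _ _))//.
  - by rewrite mulr_gt0// exprn_gt0.
  - by rewrite (le_lt_trans _ xd)// ger_pMl// exprn_ile1// ltW.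
  - by rewrite [(e1 `^ a) ^+ n.+1]exprS -mulrA ler_wpM2l// powR_ge0.
have /andP[nt tn] := truncn_itv t0.
set n := Num.truncn t in nt tn.
have en : e <= e1 ^+ n.
  by have e11l := ltW e11; rewrite -powR_mulrn ?(ltW e10)//
    eE ger_powR ?e10 ?e11l.
apply: (@le_trans _ _ (w (e1 ^+ n * x))).
  by apply: w_nd; [rewrite mulr_gt0|rewrite ler_pM2r].
apply: (le_trans (iter n)).
rewrite ler_pM2r ?w_gt0// -powR_mulrn ?powR_ge0// eE -!powRrM -powRD;
  last first.
  by rewrite (lt0r_neq0 e10) implybT.
rewrite ger_powR ?e10 ?(ltW e11)//.
by rewrite -natr1 in tn; nra.
Qed.

(** On [d/2, 1] monotonicity confines [w] up to the factor [K]. The three terms of the constant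
    belong to the cases e x < d, then x >= d/2, and finally x < d/2 with e x >= d, where one passes
    through the point d/2. *)
Lemma growth_bound q : 0 < q ->
  (exists e1 a d, [/\ 1 < e1, 0 < a <= q, 0 < d &
    forall x : R, 0 < x -> x < d -> w (e1 * x) <= e1 `^ a * w x]) ->
  exists2 C, 0 < C & forall e x : R, 1 <= e -> 0 < x -> e * x <= 1 ->
    w (e * x) <= C * e `^ q * w x.
Proof.
move=> q0 [e1 [a [d [e11 /andP[a0 aq] d0 dM]]]].
have it := growth_iter e11 a0 dM.
have d20 : 0 < d / 2 by rewrite divr_gt0.
pose C0 := e1 `^ a; pose K := w 1 / w (d / 2).
have K0 : 0 < K by rewrite divr_gt0 ?w_gt0.
have C00 : 0 < C0 by rewrite powR_gt0// (lt_trans _ e11).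
exists (C0 + K + K * C0); first by rewrite !addr_gt0// mulr_gt0.
move=> e x e_ge1 x0 ex.
have e0 : 0 < e by exact: lt_le_trans e_ge1.
have eaq : e `^ a <= e `^ q by rewrite ler_powR.
have eq1 : 1 <= e `^ q by rewrite -(powRr0 e) ler_powR// ltW.
have wx := w_gt0 x0.
have weq : w x <= e `^ q * w x by rewrite ler_peMl// ltW.
have w1 : w (e * x) <= K * w (d / 2).
  by rewrite divfK ?lt0r_neq0 ?w_gt0// w_nd// mulr_gt0.
rewrite -mulrA; set T := e `^ q * w x in weq *.
have T0 : 0 < T by rewrite mulr_gt0// (lt_le_trans _ eq1).
have itT e' : 1 <= e' -> e' <= e -> e' * x < d -> w (e' * x) <= C0 * T.
  move=> e'1 e'e e'd; rewrite (le_trans (it _ _ e'1 x0 e'd))//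
    -mulrA ler_pM2l//.
  rewrite ler_pM2r// (le_trans _ eaq)// ge0_ler_powR ?nnegrE ?(ltW a0)//.
    by rewrite (le_trans _ e'1).
  exact: ltW.
have KT : 0 < K * T by rewrite mulr_gt0.
have CT : 0 < C0 * T by rewrite mulr_gt0.
have KCT : 0 < K * (C0 * T) by rewrite mulr_gt0.
rewrite !mulrDl -(mulrA K).
have [exd|exd] := ltP (e * x) d.
  by have := itT _ e_ge1 (lexx e) exd; lra.
have [xd|xd] := leP (d / 2) x.
  have : K * w (d / 2) <= K * T by rewrite ler_pM2l// (le_trans _ weq)// w_nd.
  by lra.
have e'E : d / 2 = d / 2 / x * x by rewrite divfK// lt0r_neq0.
have : w (d / 2) <= C0 * T.
  rewrite e'E; apply: itT.
  - by rewrite ler_pdivlMr// mul1r ltW.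
  - by rewrite ler_pdivrMr// (le_trans _ exd)// ler_pdivrMr// ler_pMr// ler1n.
  - by rewrite -e'E ltr_pdivrMr// ltr_pMr// ltr1n.
by rewrite -(ler_pM2l K0) => ?; lra.
Qed.

(** The three cases are x < d, then x >= d with e x <= d/2, where the decay starts from d/2, and x
    >= d with e x > d/2. In the last one e > d/2 because x <= 1, so that K e^p >= 1. *)
Lemma decrease_bound :
  (exists e1 p d, [/\ 0 < e1 < 1, 0 < p, 0 < d &
    forall x : R, 0 < x -> x < d -> w (e1 * x) <= e1 `^ p * w x]) ->
  exists p C, [/\ 0 < p, 0 < C & forall e x : R,
    0 < e -> e <= 1 -> 0 < x -> x <= 1 ->
    w (e * x) <= C * e `^ p * w x].
Proof.
move=> [e1 [p [d [e1_01 p0 d0 dM]]]].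
have it := decrease_iter e1_01 p0 dM.
have /andP[e10 e11] := e1_01.
have d20 : 0 < d / 2 by rewrite divr_gt0.
pose C0 := e1 `^ (- p); pose K := (d / 2) `^ (- p).
have C00 : 0 < C0 by rewrite powR_gt0.
have K0 : 0 < K by rewrite powR_gt0.
exists p, (C0 + C0 * K + K); split => //; first by rewrite !addr_gt0// mulr_gt0.
move=> e x e0 e_le1 x0 x1; have wx := w_gt0 x0.
have ep : 0 < e `^ p by rewrite powR_gt0.
rewrite -mulrA; set T := e `^ p * w x.
have T0 : 0 < T by rewrite mulr_gt0.
have KT : 0 < K * T by rewrite mulr_gt0.
have CT : 0 < C0 * T by rewrite mulr_gt0.
have CKT : 0 < C0 * (K * T) by rewrite mulr_gt0.
rewrite !mulrDl -(mulrA C0).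
have [xd|xd] := ltP x d.
  by have := it _ _ e0 e_le1 x0 xd; rewrite -mulrA -/C0 -/T; lra.
have ex0 : 0 < e * x by rewrite mulr_gt0.
have [exd|exd] := leP (e * x) (d / 2).
  have d2d : d / 2 < d by rewrite ltr_pdivrMr// ltr_pMr// ltr1n.
  pose e' := e * x / (d / 2).
  have e'0 : 0 < e' by rewrite divr_gt0.
  have e'1 : e' <= 1 by rewrite ler_pdivrMr// mul1r.
  have e'E : e * x = e' * (d / 2) by rewrite divfK// lt0r_neq0.
  have : w (e * x) <= C0 * (K * T).
    rewrite e'E (le_trans (it _ _ e'0 e'1 d20 d2d))// -mulrA ler_pM2l//.
    rewrite /T mulrA ler_pM// ?powR_ge0 ?(ltW (w_gt0 _))//; last first.
      by apply: w_nd => //; rewrite (le_trans _ xd)// ltW.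
    rewrite /e' powRM ?invr_ge0 ?(ltW ex0) ?(ltW d20)// mulrC.
    rewrite -powR_inv1 ?(ltW d20)// -powRrM mulN1r ler_pM2l//.
    rewrite ge0_ler_powR ?nnegrE ?(ltW p0) ?(ltW ex0) ?(ltW e0)//.
    by rewrite ger_pMr.
  lra.
have : w (e * x) <= K * T.
  apply: (@le_trans _ _ (w x)); first by apply: w_nd => //; rewrite ger_pMl.
  rewrite /T mulrA ler_peMl ?(ltW wx)// /K powRN mulrC ler_pdivlMr ?powR_gt0//
    mul1r.
  rewrite ge0_ler_powR ?nnegrE ?(ltW p0) ?(ltW d20) ?(ltW e0)//.
  by rewrite (le_trans (ltW exd))// ger_pMr.
lra.
Qed.

Lemma orv_p1_bound : orv_at_zero w -> 0 < orv_p1 w ->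
  exists e1 p d, [/\ 0 < e1 < 1, 0 < p, 0 < d &
    forall x : R, 0 < x -> x < d -> w (e1 * x) <= e1 `^ p * w x].
Proof.
move=> horv p1.
have [e1 [e101 re1]] : exists e1, 0 < e1 < 1 /\ rho e1 < 1.
  (* If no ratio below 1 had limsup below 1, monotonicity would make [rho] equal to 1 on (0, 1), and
     the limit defining [orv_p1] would be 0. *)
  apply: contrapT => H.
  have r1 e : 0 < e -> e < 1 -> rho e = 1.
    move=> e0 e1; apply/eqP; rewrite eq_le; apply/andP; split.
      apply: (@orv_r1_le _ _ 1) => // x x0 _; rewrite mul1r w_nd ?mulr_gt0//.
      by rewrite ger_pMl// ltW.
    by rewrite leNgt; apply/negP => re; apply: H; exists e; rewrite e0 e1.
  move: p1; rewrite /orv_p1 (_ : lim _ = 0) ?ltxx//.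
  apply: cvg_lim => //; apply: cvg_near_cst.
  apply/at_right0P; exists 1 => // x x0 x1.
  by rewrite -/(rho x) r1// ln1 mul0r.
have /andP[e10 e11] := e101.
(* A value strictly between [rho e1] and 1, made positive by the maximum so that it can be written
   as e1^p with p = ln M / ln e1. *)
pose M := (Num.max (rho e1) 0 + 1) / 2.
have M0 : 0 < M by rewrite divr_gt0// ltr_wpDl// le_max lexx orbT.
have M1 : M < 1 by rewrite ltr_pdivrMr//
  mul1r -[2]/(1 + 1) ltrD2r gt_max re1 ltr01.
have rM : rho e1 < M.
  rewrite ltr_pdivlMr//; have : rho e1 <= Num.max (rho e1) 0 by rewrite le_max
    lexx.
  lra.
have [d d0 dM] := orv_r1_lt horv e10 rM.
exists e1, (ln M / ln e1), d; split => //.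
  by rewrite nmulr_rgt0 ?invr_lt0 ln_lt0// M0.
move=> x x0 xd; rewrite /powR gt_eqF// divfK ?lt_eqF ?ln_lt0//.
by rewrite lnK ?posrE// dM.
Qed.

(* Fekete's lemma for the submultiplicative function [orv_r1 w]: the limit
   defining [orv_q1 w] exists and is an infimum. *)
Lemma orv_q1_bound q : orv_at_zero w -> 0 < orv_q1 w < q ->
  exists e1 a d, [/\ 1 < e1, 0 < a <= q, 0 < d &
    forall x : R, 0 < x -> x < d -> w (e1 * x) <= e1 `^ a * w x].
Proof.
move=> horv /andP[q10 q1q].
pose S := [set ln (rho e) / ln e | e in [set e : R | 1 < e]].
have S0 : lbound S 0.
  move=> _ [e /= e1 <-]; rewrite divr_ge0 ?ln_ge0 ?(ltW e1)//.
  by rewrite orv_r1_ge1// ltW.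
have Sinf : has_inf S.
  split; last by exists 0.
  by exists (ln (rho 2) / ln 2); exists 2 => //=; rewrite ltr1n.
have near_inf a : inf S < a -> exists e1 d, [/\ 1 < e1, 0 < d &
    forall x : R, 0 < x -> x < d -> w (e1 * x) <= e1 `^ a * w x].
  move=> ha; have ha' : 0 < a - inf S by rewrite subr_gt0.
  have [_ [e1 /= e11 <-]] := inf_adherent ha' Sinf.
  rewrite addrC subrK ltr_pdivrMr ?ln_gt0// => le.
  have e10 : 0 < e1 by exact: lt_trans e11.
  have r0 : 0 < rho e1 by rewrite (lt_le_trans _ (orv_r1_ge1 horv (ltW e11))).
  have [|d d0 dM] := @orv_r1_lt e1 (e1 `^ a) horv e10.
    by rewrite -ltr_ln ?posrE ?powR_gt0// ln_powR.
  by exists e1, d.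
(* [lim] is a total function, so convergence has to be shown. No quotient is below the infimum;
   conversely [growth_iter] bounds [rho e] by e1^a e^a with [a] just above the infimum. *)
have Sq1 : orv_q1 w = inf S.
  apply: cvg_lim => //; apply/cvgrPdist_le => eta eta0.
  pose a := inf S + eta / 2.
  have eta2 : 0 < eta / 2 by rewrite divr_gt0.
  have aS : inf S < a by rewrite ltrDl.
  have iS0 : 0 <= inf S by apply: lb_le_inf => //; exact: Sinf.1.
  have a0 : 0 < a by exact: le_lt_trans aS.
  have [e1 [d [e11 d0 dM]]] := near_inf a aS.
  have it := growth_iter e11 a0 dM.
  near=> e.
  have e_gt1 : 1 < e by near: e; exact: nbhs_pinfty_gt.
  have e0 : 0 < e by exact: lt_trans e_gt1.
  have lne : 0 < ln e by rewrite ln_gt0.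
  have ein : inf S <= ln (rho e) / ln e.
    by apply: ge_inf; [exists 0|exists e].
  rewrite distrC ger0_norm ?subr_ge0// lerBlDl ler_pdivrMr//.
  have re : rho e <= e1 `^ a * e `^ a.
    apply: (@orv_r1_le _ _ (d / e)) => //; first by rewrite divr_gt0.
    move=> x x0; rewrite ltr_pdivlMr// mulrC => exd.
    by apply: it => //; exact: ltW.
  have e10 : 0 < e1 by exact: lt_trans e11.
  have r0 : 0 < rho e by rewrite (lt_le_trans _ (orv_r1_ge1 horv (ltW e_gt1))).
  have := re; rewrite -ler_ln ?posrE ?mulr_gt0 ?powR_gt0//
    lnM ?posrE ?powR_gt0// !ln_powR.
  move=> /le_trans; apply.
  (* For large [e] the constant e1^a is at most e^(eta/2), the second half of the tolerance. *)
  have : a * ln e1 <= eta / 2 * ln e.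
    rewrite -ler_pdivrMl// -[leLHS]expRK ler_ln ?posrE ?expR_gt0//.
  by rewrite /a; lra.
have qS : inf S < q by rewrite -Sq1.
have [e1 [d [e11 d0 dM]]] := near_inf q qS.
by exists e1, q, d; split; rewrite ?lexx ?andbT// (lt_trans q10).
Unshelve. all: by end_near. Qed.

End orv_bounds.

(** * Comparison of the two norms, and tails of Levy measures *)

Section levy.
Context {R : realType} {d : nat}.
Implicit Types (x y : 'rV[R]_d) (nu : {measure set 'rV[R]_d -> \bar R}).

Lemma measurable_enorm : measurable_fun setT (@enorm R d).
Proof.
apply: (@measurableT_comp _ _ _ _ _ _ (@Num.sqrt R)).
  apply: continuous_measurable_fun; exact: sqrt_continuous.
by apply: measurable_sum => i; apply: measurable_funM; exact: measurable_coord.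
Qed.

Lemma dotp_ge0 x : 0 <= dotp x x.
Proof. by apply: sumr_ge0 => i _; rewrite -expr2 sqr_ge0. Qed.

Lemma normr_le_enorm x : `|x| <= enorm x.
Proof.
rewrite [leLHS]/Num.Def.normr/= mx_normrE; apply: bigmax_le;
  first exact: sqrtr_ge0.
move=> [i j] _ /=; rewrite ord1 -sqrtr_sqr ler_sqrt ?dotp_ge0//.
rewrite /dotp (bigD1 j)//= expr2 lerDl.
by apply: sumr_ge0 => k _; rewrite -expr2 sqr_ge0.
Qed.

Lemma enorm_le_normr x : enorm x <= d%:R * `|x|.
Proof.
have dx0 : 0 <= d%:R * `|x| by rewrite mulr_ge0.
rewrite -[leRHS]ger0_norm// -sqrtr_sqr ler_sqrt ?sqr_ge0//.
rewrite (le_trans (ler_norm _))// (le_trans (norm_dotp_le _ _))//.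
rewrite exprMn -expr2 ler_wpM2r ?sqr_ge0// -natrX ler_nat -mulnn.
by case: (d) => // k; rewrite leq_pmulr.
Qed.

Lemma enorm_gt0 x : x != 0 -> 0 < enorm x.
Proof. by move=> x0; rewrite (lt_le_trans _ (normr_le_enorm x))//
  normr_gt0. Qed.

Lemma enormZ (c : R) x : enorm (c *: x) = `|c| * enorm x.
Proof.
rewrite /enorm dotpZl dotpZr mulrA -expr2 sqrtrM ?sqr_ge0//.
by rewrite sqrtr_sqr.
Qed.

Lemma measurable_tail (r : R) : measurable [set y : 'rV[R]_d | r < enorm y].
Proof.
have := measurable_enorm measurableT (measurable_itv `]r, +oo[).
rewrite setTI; congr (measurable _); apply/seteqP; split => y /=;
  rewrite in_itv/= andbT//.
Qed.

(** Chebyshev's inequality: on the tail min(|y|^2, 1) is at least min(r^2, 1), and its integral is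
    finite. *)
Lemma levy_tail_fin alpha nu (r : R) : levy_class alpha nu -> 0 < r ->
  (levy_tail nu r < +oo)%E.
Proof.
move=> [_ nuint _ _ _] r0.
pose c := Num.min (r ^+ 2) 1.
have c0 : 0 < c by rewrite /c lt_min exprn_gt0 ?ltr01.
have mA := measurable_tail r.
have mm : measurable_fun setT (fun y : 'rV[R]_d =>
  (Num.min (enorm y ^+ 2) 1)%:E).
  apply/measurable_EFinP; apply: measurable_minr => //.
  by apply: measurable_funX; exact: measurable_enorm.
have mD : measurable [set y : 'rV[R]_d | y != 0].
  rewrite (_ : mkset _ = [set y | 0 < enorm y]); first exact: measurable_tail.
  apply/seteqP; split => y /=; first exact: enorm_gt0.
  apply: contraTneq => ->; rewrite /enorm /dotp big1 ?sqrtr0 ?ltxx// => i _.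
  by rewrite mxE mul0r.
have : (c%:E * levy_tail nu r < +oo)%E.
  apply: le_lt_trans nuint; rewrite -integral_cst//.
  apply: (@le_trans _ _ (\int[nu]_(y in [set y | (r < enorm y)%R]) (Num.min
    (enorm y ^+ 2) 1)%:E)%E).
    apply: ge0_le_integral => //.
    - by move=> y _; rewrite lee_fin ltW.
    - exact: measurable_funS mm.
    - move=> y /= ry; rewrite lee_fin /c le_min !ge_min lexx orbT andbT.
      by apply/orP; left; rewrite lerXn2r ?nnegrE ?sqrtr_ge0 ?(ltW r0) ?(ltW
        ry).
  apply: ge0_subset_integral => //.
  - exact: measurable_funS mm.
  - by move=> y _; rewrite lee_fin le_min sqr_ge0 ler01.
  - move=> y /= ry; apply: contraTneq ry => ->.
    rewrite /enorm /dotp big1 ?sqrtr0 -?leNgt ?ltW// => i _.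
    by rewrite mxE mul0r.
by case: (levy_tail nu r) => [s||]//; rewrite ?ltry// gt0_muley ?lte_fin.
Qed.

Lemma levy_scale_gt0 alpha nu : levy_class alpha nu ->
  (forall r : R, 0 < r -> (0 < levy_tail nu r)%E) ->
  forall r : R, 0 < r -> 0 < levy_scale nu r.
Proof.
move=> hnu ht r r0; rewrite /levy_scale invr_gt0 fine_gt0// ht//=.
exact: levy_tail_fin hnu r0.
Qed.

Lemma levy_scale_nd alpha nu : levy_class alpha nu ->
  (forall r : R, 0 < r -> (0 < levy_tail nu r)%E) ->
  forall r s : R, 0 < r -> r <= s -> levy_scale nu r <= levy_scale nu s.
Proof.
move=> hnu ht r s r0 rs; have s0 := lt_le_trans r0 rs.
have fr := levy_tail_fin hnu r0; have fs := levy_tail_fin hnu s0.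
rewrite /levy_scale lef_pV2 ?posrE ?fine_gt0 ?ht ?fr ?fs//.
rewrite fine_le ?ge0_fin_numE ?measure_ge0//.
apply: le_measure; rewrite ?inE; try exact: measurable_tail.
by move=> y /=; exact: le_lt_trans.
Qed.

End levy.

(** * Littlewood-Paley symbols *)

(** The difference g - f vanishes near [x], so it is differentiable there with differential 0, and
    [g] is [f] plus this difference. *)
Lemma near_eq_differentiable (R : realType) (V : normedModType R) (f g : V ->
  R) (x : V) :
  (\near x, f x = g x) -> differentiable f x -> differentiable g x.
Proof.
move=> fg df; pose h : V -> R := g - f.
have h0 : \near x, h x = 0.
  by apply: filterS fg => y fgy; rewrite /h !fctE fgy subrr.
have hE : h \o shift x = cst (h x) + (0 : V -> R) +o_ 0 id.
  apply/eqaddoP => _/posnumP[e]; rewrite (nbhs_singleton h0).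
  near=> y.
  have -> : (h \o shift x - (cst 0 + 0)) y = 0.
    rewrite !fctE /= addr0 subr0; near: y.
    by move: h0; rewrite (near_shift 0 x)/= subr0.
  by rewrite normr0 mulr_ge0.
have dE : 'd h x = 0 :> (V -> R) by apply: diff_unique;
  [exact: cst_continuous|exact: hE].
have dh : differentiable h x.
  by apply/diff_locallyP; rewrite dE; split; [exact: cst_continuous|exact: hE].
have -> : g = f + h by rewrite /h addrC subrK.
exact: differentiableD.
Unshelve. all: by end_near. Qed.

Lemma near_right_neq (R : realType) (a c : R) : \forall t \near a^'+, t != c.
Proof.
have [ca|ac] := leP c a.
  near=> t; have : a < t by near: t; exact: nbhs_right_gt.
  by move=> /(le_lt_trans ca); rewrite lt_def => /andP[].
near=> t; have : t < c by near: t; exact: nbhs_right_lt.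
by rewrite lt_neqAle => /andP[].
Unshelve. all: by end_near. Qed.

Section lp_symbol.
Context {R : realType} {d : nat}.
Implicit Types (x xi : 'rV[R]_d).
Variables (N : R) (phi : 'rV[R]_d -> R).
Hypothesis hN : 1 < N.
Hypothesis hphi : lp_generator N phi.

Let N0 : 0 < N. Proof. exact: lt_trans hN. Qed.

Lemma continuous_enorm : continuous (@enorm R d).
Proof.
move=> x; apply: (@continuous_comp _ _ _ (fun x : 'rV[R]_d =>
  dotp x x) (@Num.sqrt R)).
  apply: continuous_big => [|i _ y]; first exact: add_continuous.
  by apply: (@continuousM _ _ (fun v : 'rV[R]_d =>
    v ord0 i) (fun v : 'rV[R]_d => v ord0 i)); exact: coord_continuous.
exact: sqrt_continuous.
Qed.

Lemma enorm0 : enorm (0 : 'rV[R]_d) = 0.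
Proof. by rewrite /enorm /dotp big1 ?sqrtr0// => i _; rewrite mxE mul0r. Qed.

Lemma smooth_phi : smooth phi. Proof. by case: hphi. Qed.

Lemma phi_out xi : ~~ (N^-1 <= enorm xi <= N) -> phi xi = 0.
Proof.
case: hphi => _ _ sp _ _ xiN; apply: contrapT => pxi.
have : supp phi xi by apply: subset_closure; apply/eqP.
by rewrite sp /= => xiN'; move: xiN; rewrite xiN'.
Qed.

Lemma phi_gt0 xi : N^-1 < enorm xi < N -> 0 < phi xi.
Proof.
case: hphi => _ _ sp pos _ /andP[x1 x2]; apply: pos.
rewrite /interior sp; near=> y.
rewrite /= !ltW//; near: y.
  by apply: (cvgr_lt _ (@continuous_enorm xi)).
by apply: (cvgr_gt _ (@continuous_enorm xi)).
Unshelve. all: by end_near. Qed.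

(** Away from the two bounding spheres the sign is known. A point on a sphere is approached along
    its ray by t xi with t decreasing to 1, which avoids both spheres, and continuity concludes. *)
Lemma phi_ge0 xi : 0 <= phi xi.
Proof.
have off y : enorm y != N^-1 -> enorm y != N -> 0 <= phi y.
  move=> y1 y2; have [yN|yN] := boolP (N^-1 <= enorm y <= N);
    last by rewrite phi_out.
  apply/ltW/phi_gt0; move: yN; rewrite !le_eqVlt [N^-1 == _]eq_sym (negbTE y1)
    (negbTE y2)//.
have cphi : (phi (t *: xi)) @[t --> (1 : R)^'+] --> phi xi.
  apply: cvg_at_right_filter.
  have := @smooth_continuous _ _ _ smooth_phi (1 *: xi).
  have ct : t *: xi @[t --> (1 : R)] --> (1 : R) *: xi by apply: cvgZr_tmp;
    exact: cvg_id.
  move=> c; rewrite -[X in phi X]scale1r.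
  exact: (@cvg_comp _ _ _ (fun t : R => t *: xi) phi _ (nbhs (1 *: xi)) (nbhs
    (phi (1 *: xi))) ct c).
have [->|xi0] := eqVneq xi 0.
  by apply: off; rewrite enorm0 eq_sym gt_eqF// invr_gt0.
have e0 : 0 < enorm xi by exact: enorm_gt0.
apply: (cvgr_to_ge cphi).
near=> t.
have t1 : 1 < t by near: t; exact: nbhs_right_gt.
have t0 : 0 < t by exact: lt_trans t1.
have tE c : t != c / enorm xi -> enorm (t *: xi) != c.
  by rewrite enormZ gtr0_norm//; apply: contraNneq => <-;
    rewrite mulfK// gt_eqF.
apply: off; apply: tE; near: t; exact: near_right_neq.
Unshelve. all: by end_near. Qed.

Lemma phi_lt xi : enorm xi < N^-1 -> phi xi = 0.
Proof. by move=> xN; rewrite phi_out// negb_and -ltNge xN. Qed.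

Lemma phi_gt xi : N < enorm xi -> phi xi = 0.
Proof. by move=> xN; rewrite phi_out// negb_and -!ltNge xN orbT. Qed.

Lemma enorm_scaleV k xi : enorm (N ^- k *: xi) = N ^- k * enorm xi.
Proof. by rewrite enormZ ger0_norm// invr_ge0 exprn_ge0// ltW. Qed.

Lemma phi_eventually0 xi : exists K, forall k,
  (K <= k)%N -> phi (N ^- k *: xi) = 0.
Proof.
have : N^-1 ^+ k * enorm xi @[k --> \oo] --> 0 * enorm xi.
  apply: cvgM; last exact: cvg_cst.
  by apply: cvg_expr; rewrite gtr0_norm ?invr_gt0// invf_lt1.
rewrite mul0r => h.
have Ni : 0 < N^-1 by rewrite invr_gt0.
have [K _ KP] := cvgr_lt _ h _ Ni.
by exists K => k /KP; rewrite /= exprVn -enorm_scaleV => /phi_lt.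
Qed.

Definition chi := lp_symbol N phi 0.

Lemma chiE xi K : (0 < K)%N -> (forall k,
  (K <= k)%N -> phi (N ^- k *: xi) = 0) ->
  chi xi = 1 - \sum_(1 <= k < K) phi (N ^- k *: xi).
Proof.
move=> K0 Kphi; rewrite /chi/=; congr (1 - _).
apply: cvg_lim => //; apply: cvg_near_cst; exists K => // n /= Kn.
rewrite (@big_cat_nat _ _ _ K)//= [X in _ + X]big1_seq ?addr0// => k.
by rewrite mem_index_iota => /andP[_ /andP[Kk _]]; exact: Kphi.
Qed.

Lemma chi_lt xi : enorm xi < N -> chi xi = 1 - phi (N^-1 *: xi).
Proof.
move=> xN; rewrite (@chiE _ 2)// => [|k k2]; first by rewrite big_nat1 expr1.
case: k k2 => // -[//|k] _.
apply: phi_lt; rewrite enorm_scaleV ltr_pdivrMl ?exprn_gt0//.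
rewrite (lt_le_trans xN)// exprSr mulfK ?gt_eqF// exprS.
by rewrite ler_peMr ?(ltW N0)// exprn_ege1// ltW.
Qed.

(** For |xi| > 1 the terms of negative index in the partition of unity vanish, so subtracting those
    of positive index from 1 leaves the term of index 0. *)
Lemma chi_gt xi : 1 < enorm xi -> chi xi = phi xi.
Proof.
move=> x1; have [K Kphi] := phi_eventually0 xi.
have K1phi k : (K.+1 <= k)%N -> phi (N ^- k *: xi) = 0 by move=> /ltnW;
  exact: Kphi.
rewrite (@chiE _ K.+1)//.
have xi0 : xi != 0.
  by apply: contraTneq x1 => ->; rewrite enorm0 ltr10.
case: hphi => _ _ _ _ /(_ xi xi0).
have -> : \esum_(j in [set: int]) (phi ((N ^ (- j)) *: xi))%:E =
    \esum_(j in Posz @` `I_K.+1) (phi ((N ^ (- j)) *: xi))%:E.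
  rewrite [RHS]esum_mkcond; apply: eq_esum => j _; case: ifPn => //.
  rewrite notin_setE /= => jK; congr EFin.
  case: j jK => k jK.
    rewrite -exprnN; apply: K1phi; rewrite ltnNge; apply/negP => kK.
    by apply: jK; exists k.
  rewrite NegzE opprK -exprnP; apply: phi_gt.
  rewrite enormZ ger0_norm ?exprn_ge0 ?(ltW N0)// exprS -mulrA ltr_pMr//.
  by rewrite (lt_le_trans x1)// ler_peMl ?exprn_ege1 ?(ltW hN)//
    (le_trans _ (ltW x1)).
rewrite esum_image; last by move=> k l _ _ [].
rewrite esum_fset//; last by move=> k _; rewrite lee_fin phi_ge0.
rewrite -fsbig_ord sumEFin => -[]; rewrite -(big_mkord xpredT (fun k =>
  phi (N ^ (- k%:Z) *: xi))).
rewrite big_ltn// oppr0 expr0z scale1r => <-; apply/eqP; rewrite subr_eq;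
  apply/eqP; congr (_ + _).
by apply: eq_big_nat => k _; rewrite exprnN.
Qed.

Lemma chi_scale xi : chi (N^-1 *: xi) = chi xi + phi (N^-1 *: xi).
Proof.
have [K Kphi] := phi_eventually0 xi.
rewrite (@chiE xi K.+2)//; last by move=> k /ltnW/ltnW; exact: Kphi.
have Es k : N ^- k *: (N^-1 *: xi) = N ^- k.+1 *: xi.
  by rewrite scalerA -invfM -exprSr.
rewrite (@chiE _ K.+1)//; last first.
  by move=> k /ltnW Kk; rewrite Es; apply: Kphi; exact: leqW.
rewrite [in RHS]big_ltn// expr1 big_add1/=.
under eq_bigr do rewrite Es.
by rewrite opprD addrA addrAC subrK.
Qed.

Lemma chi0 : chi 0 = 1.
Proof.
by rewrite chi_lt ?enorm0// scaler0 phi_lt ?subr0// enorm0 invr_gt0.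
Qed.

Lemma lp_symbolS j : lp_symbol N phi j.+1 =
  (fun xi => dilate (N ^+ j.+1) chi xi - dilate (N ^+ j) chi xi).
Proof.
apply/funext => xi; rewrite /dilate/= exprS invfM -scalerA chi_scale.
by rewrite addrC addKr.
Qed.

(* With [j.+1] in place of [j.+2] this would depend on the values of [phi] on the
   boundary of its support. *)
Lemma lp_symbol_mul j xi :
  lp_symbol N phi j xi * dilate (N ^+ j.+2) chi xi = lp_symbol N phi j xi.
Proof.
have [xN|xN] := leP (enorm xi) (N ^+ j.+1).
  have x1 : enorm (N ^- j.+2 *: xi) <= N^-1.
    by rewrite enorm_scaleV ler_pdivrMl ?exprn_gt0// exprSr mulfK ?gt_eqF.
  have N1 : N^-1 < 1 by rewrite invf_lt1.
  rewrite /dilate chi_lt; last by rewrite (le_lt_trans x1)// (lt_trans N1).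
  rewrite phi_lt ?subr0 ?mulr1// enormZ gtr0_norm ?invr_gt0//.
  rewrite gtr_pMr ?invr_gt0//; exact: le_lt_trans N1.
suff -> : lp_symbol N phi j xi = 0 by rewrite mul0r.
case: j xN => [|j] xN.
  rewrite expr1 in xN; rewrite -[lp_symbol _ _ _]/chi.
  by rewrite (chi_gt (lt_trans hN xN)) phi_gt.
rewrite /= phi_gt// enorm_scaleV ltr_pdivlMl ?exprn_gt0//.
by rewrite -exprSr.
Qed.

Lemma partial_cst s (c : R) : exists c', partial s (fun _ : 'rV[R]_d =>
  c) = cst c'.
Proof.
elim: s => [|i s [c' IH]]; first by exists c.
exists 0; rewrite /= -/(partial s _) IH; apply/funext => x; exact: derive_cst.
Qed.

Lemma smooth_cst (c : R) : smooth (fun _ : 'rV[R]_d => c).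
Proof. by move=> s x; have [c' ->] := partial_cst s c;
  exact: differentiable_cst. Qed.

Lemma phi_partial_bounded s : exists B : R, forall x, `|partial s phi x| <= B.
Proof.
have [sphi cphi _ _ _] := hphi.
have cp : continuous (partial s phi).
  by move=> x; apply: differentiable_continuous; exact: sphi.
have cK : compact (partial s phi @` supp phi).
  by apply: continuous_compact => //; exact: continuous_subspaceT.
have [M [_ MP]] := compact_bounded cK.
have [c cE] := partial_cst s 0.
exists (Num.max (M + 1) `|c|) => x.
have [xs|xs] := pselect (supp phi x).
  rewrite le_max; apply/orP; left; apply: MP; first by rewrite ltrDl.
  by exists x.
suff -> : partial s phi x = c by rewrite le_max lexx orbT.
have : \near x, partial s phi x = partial s (fun=> 0) x.
  apply: near_eq_partial.
  have : nbhs x (~` supp phi).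
    by apply: open_nbhs_nbhs; split => //; apply: closed_openC;
      exact: closed_closure.
  apply: filterS => y ys; apply: contrapT => py; apply: ys.
  by apply: subset_closure; apply/eqP.
by move=> /nbhs_singleton ->; rewrite cE.
Qed.

(** The open sets |xi| < N and |xi| > 1 overlap and cover the space; on each of them [chi] agrees
    with a smooth expression in [phi], by [chi_lt] and [chi_gt]. *)
Lemma chi_test : test_fun chi.
Proof.
have sc : smooth (fun x => 1 - phi (N^-1 *: x)).
  apply: smoothB; first exact: smooth_cst.
  have := smooth_affine N^-1 0 smooth_phi.
  by under eq_fun do rewrite addr0.
have near_lt x : enorm x < N -> \near x, 1 - phi (N^-1 *: x) = chi x.
  move=> xN; near=> y; rewrite chi_lt//; near: y.
  by apply: (cvgr_lt _ (@continuous_enorm x)).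
have near_gt x : 1 < enorm x -> \near x, phi x = chi x.
  move=> xN; near=> y; rewrite chi_gt//; near: y.
  by apply: (cvgr_gt _ (@continuous_enorm x)).
have lt_gt x : enorm x < N \/ 1 < enorm x.
  by have [|xN] := ltP (enorm x) N; [left|right; exact: lt_le_trans xN].
split.
- move=> s x; case: (lt_gt x) => xN.
    by apply: near_eq_differentiable (near_eq_partial s (near_lt x xN)) _;
      exact: sc.
  by apply: near_eq_differentiable (near_eq_partial s (near_gt x xN)) _;
    exact: smooth_phi.
- move=> s; have [B phiB] := phi_partial_bounded s.
  have [c cE] := partial_cst s 1.
  exists (Num.max B (`|c| + `|N^-1 ^+ size s| * B)) => x; case: (lt_gt x) => xN.
    rewrite -(nbhs_singleton (near_eq_partial s (near_lt x xN))).
    rewrite partialB; last 2 first.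
    - exact: smooth_cst.
    - have := smooth_affine N^-1 0 smooth_phi.
      by under eq_fun do rewrite addr0.
    have := @partial_affine _ _ phi s N^-1 0 smooth_phi.
    under eq_fun do rewrite addr0.
    move=> ->; rewrite cE le_max; apply/orP; right.
    by rewrite (le_trans (ler_normB _ _))// lerD2l normrM ler_wpM2l.
  by rewrite -(nbhs_singleton (near_eq_partial s (near_gt x xN))) le_max phiB.
- exists N => x xN; have xN' : N < enorm x by exact: lt_le_trans
  (normr_le_enorm x).
  by rewrite chi_gt ?phi_gt// (lt_trans _ xN').
Unshelve. all: by end_near. Qed.

Lemma lp_symbol_test j : test_fun (lp_symbol N phi j).
Proof.
case: j => [|j]; first exact: chi_test.
rewrite lp_symbolS; apply: test_funB; apply: test_fun_dilate;
  rewrite ?exprn_gt0//;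
  exact: chi_test.
Qed.

End lp_symbol.

(** * Equivalence of the norms *)

Lemma powR_lt (R : realType) (a x y : R) : 1 < a -> x < y -> a `^ x < a `^ y.
Proof.
move=> a1 xy; have a0 : 0 < a by exact: lt_trans a1.
by rewrite /powR gt_eqF// ltr_expR ltr_pM2r// ln_gt0.
Qed.

(** With truncated subtraction the exponent is the distance |j - k|. [P] is a closed-form majorant
    of (1 - r) times the partial sums, increasing along both branches. *)
Lemma sum_two_sided_geometric (R : realType) (r : R) k J : 0 <= r < 1 ->
  \sum_(j < J) r ^+ ((j - k) + (k - j)) <= 2 / (1 - r).
Proof.
move=> /andP[r0 r1]; have r10 : 0 < 1 - r by rewrite subr_gt0.
pose P j := if (j <= k)%N then r ^+ (k - j).+1 else 2 - r ^+ (j - k).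
rewrite ler_pdivlMr//; apply: (@le_trans _ _ (P J)); last first.
  rewrite /P; case: ifPn => _; last by rewrite gerBl exprn_ge0.
  by rewrite (@le_trans _ _ 1)// ?exprn_ile1 ?(ltW r1)// ler1n.
elim: J => [|J IH]; first by rewrite big_ord0 mul0r /P leq0n exprn_ge0.
rewrite big_ord_recr/= mulrDl (le_trans (lerD IH (lexx _)))// /P.
have [Jk|kJ|->] := ltngtP J k.
- rewrite (eqP (ltnW Jk : (J - k)%N == 0)) add0n subnSK// exprS; lra.
- rewrite (eqP (ltnW kJ : (k - J)%N == 0)) addn0.
  by rewrite subSn 1?ltnW// exprS; lra.
- rewrite subnn addn0 expr0 subSnn !expr1; lra.
Qed.

Lemma sum_telescope (R : zmodType) (v S : nat -> R) J :
  v 0%N = S 0%N -> (forall j, v j.+1 = S j.+1 - S j) ->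
    \sum_(j < J.+1) v j = S J.
Proof.
move=> v0 vS; elim: J => [|J IH]; first by rewrite big_ord1.
by rewrite big_ord_recr/= IH vS addrC subrK.
Qed.

(** Combines the bounds on the two real convolutions. With [E + 1] instead of [E] the same
    right-hand side also absorbs the trivial bound in [bernstein_sym]. *)
Lemma norm_sub_sub_le (R : realDomainType) (a a' b b' B E T : R) : 0 <= B ->
  0 <= T ->
  `|a - b| <= B * (E * T) -> `|a' - b'| <= B * (E * T) ->
  `|a - a' - (b - b')| <= 2 * (B * ((E + 1) * T)).
Proof.
move=> B0 T0 ab ab'; rewrite (_ : _ - _ - _ = (a - b) - (a' - b'));
  last by ring.
rewrite (le_trans (ler_normB _ _))// mulr_natl mulr2n.
have EE : B * (E * T) <= B * ((E + 1) * T) by rewrite ler_wpM2l// ler_wpM2r//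
  lerDl.
by apply: lerD; [exact: le_trans ab EE|exact: le_trans ab' EE].
Qed.

(** * Real and imaginary parts of the Littlewood-Paley kernels *)

Section complex_kernel.
Context {R : realType} {d : nat}.
Implicit Types (u f : 'rV[R]_d -> R).
Local Open Scope complex_scope.

Lemma inv_fourierE f x : inv_fourier (fun xi => (f xi)%:C) x =
  wave f 0 x +i* wave f (- (pi / 2)) x.
Proof.
rewrite /inv_fourier /cintegral /wave; congr (_ +i* _);
  apply: eq_Rintegral => xi _ /=.
  by rewrite mulr0 subr0 addr0 mulrC.
by rewrite mulr0 add0r cosB cos_pihalf sin_pihalf mulr0 add0r mulr1 mulrC.
Qed.

Lemma convolutionE u f g x : convolution u (fun y => f y +i* g y) x =
  conv u f x +i* conv u g x.
Proof.
rewrite /convolution /cintegral /conv; congr (_ +i* _);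
  apply: eq_Rintegral => y _ /=.
  by rewrite mul0r subr0.
by rewrite mul0r addr0.
Qed.

Lemma normc_ge (a b : R) : `|a| <= ComplexField.Normc.normc (a +i* b) /\
  `|b| <= ComplexField.Normc.normc (a +i* b).
Proof.
split; rewrite /ComplexField.Normc.normc -sqrtr_sqr ler_sqrt ?addr_ge0
  ?sqr_ge0//.
  by rewrite lerDl sqr_ge0.
by rewrite lerDr sqr_ge0.
Qed.

Lemma normc_le (a b : R) : ComplexField.Normc.normc (a +i* b) <= `|a| + `|b|.
Proof.
rewrite /ComplexField.Normc.normc -[leRHS]ger0_norm ?addr_ge0// -sqrtr_sqr.
rewrite ler_sqrt ?sqr_ge0// sqrrD !real_normK ?num_real// lerD2r lerDl.
by rewrite mulrn_wge0// mulr_ge0.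
Qed.

Lemma lp_kernel_conv N phi j u x :
  convolution u (lp_kernel N phi j) x =
  conv u (wave (lp_symbol N phi j) 0) x +i* conv u (wave (lp_symbol N phi j) (-
    (pi / 2))) x.
Proof.
have -> : lp_kernel N phi j = (fun y => wave (lp_symbol N phi j) 0 y +i*
    wave (lp_symbol N phi j) (- (pi / 2)) y).
  by apply/funext => y; exact: inv_fourierE.
exact: convolutionE.
Qed.

End complex_kernel.

(** * The two inequalities, from power bounds on w alone *)

Section equivalence.
Context {R : realType} {d : nat}.
Variables (N : R) (phi : 'rV[R]_d -> R).
Hypothesis hN : 1 < N.
Hypothesis hphi : lp_generator N phi.
Variables (w : R -> R) (beta q p C1 C2 : R).
Hypothesis w_gt0 : forall x, 0 < x -> 0 < w x.
Hypothesis w_nd : forall x y, 0 < x -> x <= y -> w x <= w y.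
Hypothesis beta0 : 0 < beta.
Hypothesis q0 : 0 < q.
Hypothesis bq : beta * q < 1.
Hypothesis p0 : 0 < p.
Hypothesis C10 : 0 < C1.
Hypothesis C20 : 0 < C2.
Hypothesis growth : forall e x : R, 1 <= e -> 0 < x -> e * x <= 1 ->
  w (e * x) <= C1 * e `^ q * w x.
Hypothesis decrease : forall e x : R, 0 < e -> e <= 1 -> 0 < x -> x <= 1 ->
  w (e * x) <= C2 * e `^ p * w x.

Implicit Types (u : 'rV[R]_d -> R) (x h y : 'rV[R]_d) (A B M th t : R).

Local Notation sym := (lp_symbol N phi).
Local Notation chi := (chi N phi).

Let N0 : 0 < N. Proof. exact: lt_trans hN. Qed.

Let W j := w (N ^- j) `^ beta.

Let Nj0 j : 0 < N ^- j. Proof. by rewrite invr_gt0 exprn_gt0. Qed.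

Let Nj1 j : N ^- j <= 1. Proof. by rewrite invf_le1 ?exprn_gt0// exprn_ege1//
  ltW. Qed.

Let W0 j : 0 < W j. Proof. by rewrite powR_gt0// w_gt0. Qed.

Lemma conv_sym0 u th x : conv u (wave (sym 0) th) x =
  conv u (wave (dilate (N ^+ 0) chi) th) x.
Proof.
suff -> : dilate (N ^+ 0) chi = chi by [].
by apply/funext => xi; rewrite /dilate expr0 invr1 scale1r.
Qed.

Lemma conv_symS u M th x j : measurable_fun setT u -> (forall x, `|u x| <= M) ->
  conv u (wave (sym j.+1) th) x =
  conv u (wave (dilate (N ^+ j.+1) chi) th) x - conv u (wave (dilate (N ^+ j)
    chi) th) x.
Proof.
move=> mu uM.
have td k : test_fun (dilate (N ^+ k) chi).
  by apply: test_fun_dilate; [rewrite exprn_gt0|exact: chi_test].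
rewrite /conv -RintegralB//; last 2 first.
- exact/integrable_decaying/(decaying_conv _ mu uM)/decaying_wave.
- exact/integrable_decaying/(decaying_conv _ mu uM)/decaying_wave.
apply: eq_Rintegral => y _; rewrite -mulrBr; congr (_ * _).
by rewrite lp_symbolS// waveB//; exact/test_fun_decaying.
Qed.

Lemma sum_conv_sym u M x J : measurable_fun setT u -> (forall x, `|u x| <= M) ->
  \sum_(j < J.+1) conv u (wave (sym j) 0) x = conv u (wave (dilate (N ^+ J)
    chi) 0) x.
Proof.
move=> mu uM.
apply: (@sum_telescope _ (fun j => conv u (wave (sym j) 0) x)
  (fun j => conv u (wave (dilate (N ^+ j) chi) 0) x)); first exact: conv_sym0.
by move=> j; exact: (conv_symS _ _ _ mu uM).
Qed.

Lemma cvg_sum_conv_sym u M x : continuous u -> (forall x, `|u x| <= M) ->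
  \sum_(j < J.+1) conv u (wave (sym j) 0) x @[J --> \oo] --> u x.
Proof.
move=> cu uM; have mu := continuous_measurable_rV cu.
under eq_cvg do rewrite (sum_conv_sym _ _ mu uM).
have c0 k : 0 < N ^+ k by rewrite exprn_gt0.
have cy : (N ^+ k)^-1 @[k --> \oo] --> 0.
  rewrite (_ : (fun k => _) = fun k => N^-1 ^+ k); last by apply/funext => k;
    rewrite exprVn.
  by apply: cvg_expr; rewrite gtr0_norm ?invr_gt0// invf_lt1.
have := @conv_dilate_cvg _ _ _ _ _ _ x (chi_test hN hphi) cu uM c0 cy.
by rewrite chi0// mul1r.
Qed.

Lemma exprn_powR (a b : R) k : 0 < a -> (a ^+ k) `^ b = (a `^ b) ^+ k.
Proof.
by move=> a0; rewrite -powR_mulrn ?(ltW a0)// -powRrM mulrC powRrM powR_mulrn//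
  powR_ge0.
Qed.

Lemma invr_powR (a b : R) : 0 < a -> (a^-1) `^ b = (a `^ b)^-1.
Proof. by move=> a0; rewrite -(powR_inv1 (ltW a0)) -powRrM mulN1r powRN. Qed.

Lemma W_le_growth j k : (j <= k)%N ->
  W j <= C1 `^ beta * (N `^ (q * beta)) ^+ (k - j) * W k.
Proof.
move=> jk; rewrite /W -exprn_powR//.
have kj1 : 1 <= N ^+ (k - j) by rewrite exprn_ege1// ltW.
have E : N ^+ (k - j) * N ^- k = N ^- j.
  by rewrite -{2}(subnK jk) exprD invfM mulrA mulfV ?mul1r// expf_neq0// gt_eqF.
have := growth kj1 (Nj0 k); rewrite E => /(_ (Nj1 j)) H.
rewrite powRrM -!powRM ?powR_ge0 ?mulr_ge0 ?powR_ge0 ?(ltW C10) ?(ltW (w_gt0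
  _))//.
rewrite ge0_ler_powR ?nnegrE ?(ltW beta0) ?(ltW (w_gt0 _))//.
by rewrite !mulr_ge0 ?powR_ge0 ?(ltW C10) ?(ltW (w_gt0 _)).
Qed.

Lemma W_le_decrease j k : (k <= j)%N ->
  W j <= C2 `^ beta * (N `^ (- (p * beta))) ^+ (j - k) * W k.
Proof.
move=> kj; rewrite /W -exprn_powR//.
have E : N ^- (j - k) * N ^- k = N ^- j by rewrite -invfM -exprD subnK.
have := decrease (Nj0 (j - k)) (Nj1 _) (Nj0 k) (Nj1 k); rewrite E => H.
rewrite powRN.
have -> : ((N ^+ (j - k)) `^ (p * beta))^-1 = ((N ^- (j - k)) `^ p) `^ beta.
  by rewrite -powRrM invr_powR// exprn_gt0.
rewrite -!powRM ?mulr_ge0 ?powR_ge0 ?(ltW C20) ?(ltW (w_gt0 _))//.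
rewrite ge0_ler_powR ?nnegrE ?(ltW beta0) ?(ltW (w_gt0 _))//.
by rewrite !mulr_ge0 ?powR_ge0 ?(ltW C20) ?(ltW (w_gt0 _)).
Qed.

Lemma bernstein_sym t : 0 < t < 1 -> exists E, 0 <= E /\
  forall u M B j x h, measurable_fun setT u -> (forall x, `|u x| <= M) ->
    (forall x, `|conv u (wave (sym j) 0) x| <= B) ->
    (forall x, `|conv u (wave (sym j) (- (pi / 2))) x| <= B) ->
    `|conv u (wave (sym j) 0) (x + h) - conv u (wave (sym j) 0) x| <=
      B * (E * (N ^+ j * `|h|) `^ t).
Proof.
move=> t01; have /andP[t0 t1] := t01.
have [E [E0 EP]] := bernstein (chi_test hN hphi) t01.
(* The 2 counts the two real convolutions of [conv_reproduce]; the power of N^2 comes from the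
   reproducing symbol, which lives at scale j + 2. *)
exists (2 * (E + 1) * (N ^+ 2) `^ t); split;
  first by rewrite !mulr_ge0 ?addr_ge0 ?powR_ge0.
move=> u M B j x h mu uM v0B v1B.
have c0 : 0 < N ^+ j.+2 by rewrite exprn_gt0.
have B0 : 0 <= B := le_trans (normr_ge0 _) (v0B 0).
have -> : B * (2 * (E + 1) * (N ^+ 2) `^ t * (N ^+ j * `|h|) `^ t) =
    2 * (B * ((E + 1) * (N ^+ j.+2 * `|h|) `^ t)).
  have -> : N ^+ j.+2 * `|h| = N ^+ 2 * (N ^+ j * `|h|) by rewrite mulrA -exprD.
  rewrite [in RHS]powRM ?mulr_ge0 ?exprn_ge0 ?(ltW N0)//; ring.
have ts := lp_symbol_test hN hphi j.
have tc : test_fun (dilate (N ^+ j.+2) chi) by apply: test_fun_dilate => //;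
  exact: chi_test.
have mv th := measurable_conv_wave th ts mu uM.
(* Beyond the range of [bernstein] the power of [N ^+ j.+2 * |h|] is at least 1, and the triangle
   inequality is enough. *)
have [ch|ch] := leP (N ^+ j.+2 * `|h|) 1.
  have rep y := conv_reproduce 0 y mu uM ts tc (lp_symbol_mul hN hphi j).
  rewrite !rep sub0r.
  have H0 := EP _ _ _ 0 x h c0 (mv 0) v0B ch.
  have H1 := EP _ _ _ (- (pi / 2)) x h c0 (mv (- (pi / 2))) v1B ch.
  exact: (norm_sub_sub_le B0 (powR_ge0 _ _) H0 H1).
rewrite (le_trans (ler_normB _ _))// mulr_natl mulr2n.
have T1 : 1 <= (N ^+ j.+2 * `|h|) `^ t.
  rewrite [X in X <= _](_ : 1 = 1 `^ t); last by rewrite powR1.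
  by rewrite ge0_ler_powR ?nnegrE ?(ltW t0) ?(ltW ch)// (le_trans _ (ltW ch)).
have : B <= B * ((E + 1) * (N ^+ j.+2 * `|h|) `^ t).
  by rewrite ler_peMr// (le_trans T1)// ler_peMl ?powR_ge0// lerDr.
by move=> H; rewrite lerD// (le_trans _ H).
Qed.

Lemma dyadic_scale (e : R) : 0 < e -> e <= 1 -> exists k,
  N ^- k.+1 < e <= N ^- k.
Proof.
move=> e0 e1.
have ei1 : 1 <= e^-1 by rewrite invf_ge1.
have [t t0 tE] := log_scale hN ei1.
have /andP[kt tk] := truncn_itv t0; set k := Num.truncn t in kt tk.
exists k; rewrite -[e]invrK tE; apply/andP; split.
  rewrite ltf_pV2 ?posrE ?powR_gt0 ?exprn_gt0//.
  by rewrite -powR_mulrn ?(ltW N0)// powR_lt.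
rewrite lef_pV2 ?posrE ?powR_gt0 ?exprn_gt0//.
by rewrite -powR_mulrn ?(ltW N0)// ler_powR// ltW.
Qed.

Lemma geometric_series_le (v : nat -> R) (l D r : R) k : 0 <= r < 1 -> 0 <= D ->
  (forall j, `|v j| <= D * r ^+ ((j - k) + (k - j))) ->
  \sum_(j < J.+1) v j @[J --> \oo] --> l -> `|l| <= D * (2 / (1 - r)).
Proof.
move=> r01 D0 vD vl; apply: (cvgr_to_le (cvg_norm vl)); apply: nearW => J.
rewrite (le_trans (ler_norm_sum _ _ _))//.
apply: (@le_trans _ _ (D * \sum_(j < J.+1) r ^+ ((j - k) + (k - j)))).
  by rewrite mulr_sumr; apply: ler_sum.
by rewrite ler_wpM2l// sum_two_sided_geometric.
Qed.

Lemma holder_le_besov : exists C, 0 <= C /\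
  forall u M B, continuous u -> (forall x, `|u x| <= M) ->
    (forall j x, `|conv u (wave (sym j) 0) x| <= B * W j) ->
    (forall j x, `|conv u (wave (sym j) (- (pi / 2))) x| <= B * W j) ->
    (forall x, `|u x| <= C * B) /\
    (forall x h, h != 0 -> `|u (x + h) - u x| <= C * B * w (enorm h) `^ beta).
Proof.
(* The midpoint of beta q and 1: the Bernstein gain must beat the growth of [W] while staying below
   exponent 1. *)
pose t := (q * beta + 1) / 2.
have qb0 : 0 < q * beta by rewrite mulr_gt0.
have qb1 : q * beta < 1 by rewrite mulrC.
have t01 : 0 < t < 1 by rewrite /t; apply/andP; split; lra.
have /andP[t0 t1] := t01.
have tqb : q * beta < t by rewrite /t; lra.
have [E [E0 bern]] := bernstein_sym t01.
(* Ratios of the two geometric tails: [r1] for j <= k, where the growth of [W] meets the Bernstein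
   gain, and [r2] for j > k, where [W] itself decays. *)
pose r1 := N `^ (q * beta - t); pose r2 := N `^ (- (p * beta)).
pose r := Num.max r1 r2.
have Npow (s : R) : s < 0 -> N `^ s < 1 by move=> s0;
  rewrite -(powRr0 N) powR_lt.
have r01 : 0 <= r < 1.
  rewrite le_max powR_ge0/= gt_max !Npow//; first by rewrite oppr_lt0 mulr_gt0.
  by rewrite subr_lt0.
have /andP[r0 rlt1] := r01.
pose G := 2 / (1 - r).
have G0 : 0 <= G by rewrite divr_ge0// subr_ge0 ltW.
pose K := (E + 2) * C1 `^ beta + 2 * C2 `^ beta.
have K0 : 0 <= K by rewrite addr_ge0 ?mulr_ge0 ?powR_ge0 ?addr_ge0.
have W_decr j k : (k <= j)%N -> W j <= C2 `^ beta * r ^+ (j - k) * W k.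
  move=> kj; rewrite (le_trans (W_le_decrease kj))// ler_wpM2r ?(ltW (W0 k))//.
  by rewrite ler_wpM2l ?powR_ge0// lerXn2r ?nnegrE ?powR_ge0// le_max lexx orbT.
(* The price of replacing N^-k by |h|, which exceeds N^-(k+1): one step in the growth of [W]. *)
pose D1 := C1 `^ beta * N `^ (q * beta).
have D10 : 0 <= D1 by rewrite mulr_ge0 ?powR_ge0.
(* Constant for the sup norm, from the decay of [W] counted from index 0. Below, [A1] serves
   increments with |h| > 1 and [A2] those with |h| <= 1. *)
pose A0 := C2 `^ beta * W 0 * G.
have A00 : 0 <= A0 by apply: mulr_ge0 => //;
  rewrite mulr_ge0 ?powR_ge0 ?(ltW (W0 0)).
have w10 : 0 < w 1 `^ beta by rewrite powR_gt0// w_gt0.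
pose A1 := 2 * A0 / w 1 `^ beta; pose A2 := K * D1 * G.
have A10 : 0 <= A1.
  by apply: mulr_ge0; [exact: mulr_ge0|rewrite invr_ge0 ltW].
have A20 : 0 <= A2 by apply: mulr_ge0 => //; exact: mulr_ge0.
exists (A0 + A1 + A2); split; first by apply: addr_ge0 => //; exact: addr_ge0.
move=> u M B cu uM v0B v1B.
have mu := continuous_measurable_rV cu.
have B0 : 0 <= B.
  by have := le_trans (normr_ge0 _) (v0B 0 0); rewrite pmulr_lge0// W0.
have uA x : `|u x| <= A0 * B.
  have vD j : `|conv u (wave (sym j) 0) x| <= B * (C2 `^ beta * W 0) * r ^+ ((j
    - 0) + (0 - j)).
    rewrite (le_trans (v0B j x))// sub0n addn0 -mulrA ler_wpM2l//.
    by rewrite mulrAC W_decr.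
  have D0 : 0 <= B * (C2 `^ beta * W 0) by rewrite !mulr_ge0 ?powR_ge0 ?(ltW
    (W0 0)).
  rewrite (le_trans (geometric_series_le r01 D0 vD (cvg_sum_conv_sym cu uM)))//
    -/G.
  by rewrite (_ : B * _ * G = A0 * B)// /A0; ring.
have AC : A0 * B <= (A0 + A1 + A2) * B.
  by rewrite ler_wpM2r// -addrA lerDl addr_ge0.
split=> [x|x h h0]; first by rewrite (le_trans (uA x)).
have e0 : 0 < enorm h by exact: enorm_gt0.
have n0 : 0 < `|h| by rewrite normr_gt0.
have we0 : 0 < w (enorm h) `^ beta by rewrite powR_gt0// w_gt0.
(* For |h| > 1 twice the sup norm suffices, because w(|h|) is then at least w(1). *)
have [h1|h1] := leP `|h| 1; last first.
  apply: (@le_trans _ _ (A1 * B * w (enorm h) `^ beta)); last first.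
    rewrite ler_wpM2r ?(ltW we0)// ler_wpM2r// addrAC lerDr.
    exact: addr_ge0.
  apply: (@le_trans _ _ (2 * (A0 * B))).
    by rewrite mulr_natl mulr2n (le_trans (ler_normB _ _))// lerD.
  rewrite (_ : A1 * _ * _ = 2 * (A0 * B) * (w (enorm h) `^ beta / w 1 `^
    beta)); last by rewrite /A1; ring.
  apply: ler_peMr; first by apply: mulr_ge0 => //; exact: mulr_ge0.
  rewrite ler_pdivlMr// mul1r.
  rewrite ge0_ler_powR ?nnegrE ?(ltW beta0) ?(ltW (w_gt0 _))// w_nd//.
  by rewrite ltW// (lt_le_trans h1)// normr_le_enorm.
have [k /andP[kh hk]] := dyadic_scale n0 h1.
have vD j : `|conv u (wave (sym j) 0) (x + h) - conv u (wave (sym j) 0) x| <=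
    B * (K * W k) * r ^+ ((j - k) + (k - j)).
  have [jk|kj] := leqP j k.
    rewrite (le_trans (bern _ _ _ j x h mu uM (v0B j) (v1B j)))//.
    rewrite (eqP (jk : (j - k)%N == 0)) add0n -!mulrA ler_wpM2l//.
    have hN1 : N ^+ j * `|h| <= N ^- (k - j).
      apply: (@le_trans _ _ (N ^+ j * N ^- k));
        first by rewrite ler_pM2l// exprn_gt0.
      rewrite -{1}(subnK jk) exprD invfM mulrCA mulfV ?mulr1//.
      by rewrite expf_neq0// gt_eqF.
    have H2 : (N ^+ j * `|h|) `^ t <= (N `^ (- t)) ^+ (k - j).
      rewrite -exprn_powR// powRN -invr_powR ?exprn_gt0//.
      by rewrite ge0_ler_powR ?nnegrE ?(ltW t0) ?mulr_ge0 ?exprn_ge0 ?(ltW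
        N0)// ltW.
    apply: (@le_trans _ _ (C1 `^ beta * N `^ (q * beta) ^+ (k - j) * W k *
        (E * (N `^ (- t)) ^+ (k - j)))).
      by rewrite ler_pM ?(ltW (W0 j)) ?mulr_ge0 ?powR_ge0 ?W_le_growth//
        ler_wpM2l.
    rewrite [leLHS](_ : _ = E * C1 `^ beta * (N `^ (q * beta) * N `^ (- t)) ^+
      (k - j) * W k); last first.
      by rewrite exprMn; ring.
    rewrite -powRD; last by rewrite (lt0r_neq0 N0) implybT.
    rewrite [leRHS](_ : _ = K * r ^+ (k - j) * W k); last by ring.
    rewrite ler_wpM2r ?(ltW (W0 k))//; apply: ler_pM.
    + by rewrite mulr_ge0 ?powR_ge0.
    + by rewrite exprn_ge0 ?powR_ge0.
    + by rewrite /K mulrDl -addrA lerDl addr_ge0 ?mulr_ge0 ?powR_ge0.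
    + by rewrite lerXn2r ?nnegrE ?powR_ge0// le_max lexx.
  rewrite (eqP (ltnW kj : (k - j)%N == 0)) addn0.
  rewrite (le_trans (ler_normB _ _))//.
  apply: (@le_trans _ _ (2 * (B * W j)));
    first by rewrite mulr_natl mulr2n lerD.
  rewrite mulrCA -!mulrA ler_wpM2l//.
  apply: (@le_trans _ _ (2 * (C2 `^ beta * r ^+ (j - k) * W k))).
    by rewrite ler_wpM2l// W_decr// ltnW.
  rewrite (_ : 2 * _ = 2 * C2 `^ beta * (W k * r ^+ (j - k))); last by ring.
  rewrite ler_wpM2r ?mulr_ge0 ?exprn_ge0 ?(ltW (W0 k))//.
  by rewrite /K lerDr mulr_ge0 ?powR_ge0 ?addr_ge0.
have D0 : 0 <= B * (K * W k) by rewrite !mulr_ge0 ?(ltW (W0 k)).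
have cv : \sum_(j < J.+1) (conv u (wave (sym j) 0) (x + h) - conv u (wave (sym
  j) 0) x)
    @[J --> \oo] --> u (x + h) - u x.
  under eq_cvg do rewrite sumrB.
  by apply: cvgB; exact: cvg_sum_conv_sym cu uM.
rewrite (le_trans (geometric_series_le r01 D0 vD cv))// -/G.
have Wk : W k <= D1 * w (enorm h) `^ beta.
  have := W_le_growth (leqnSn k); rewrite subSnn expr1 => /le_trans; apply.
  rewrite ler_wpM2l//.
  rewrite ge0_ler_powR ?nnegrE ?(ltW beta0) ?(ltW (w_gt0 _))// w_nd//.
  by rewrite (le_trans (ltW kh))// normr_le_enorm.
apply: (@le_trans _ _ (A2 * B * w (enorm h) `^ beta)); last first.
  rewrite ler_wpM2r ?(ltW we0)// ler_wpM2r// lerDr.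
  exact: addr_ge0.
rewrite (_ : A2 * _ * _ = B * (K * (D1 * w (enorm h) `^ beta)) * G);
  last by rewrite /A2; ring.
by rewrite ler_wpM2r// ler_wpM2l// ler_wpM2l.
Qed.

(** Since beta q < 1, the power law for [w] is weakened to a linear one, which the first moment of
    the kernel can integrate. The factor d comes from passing from the Euclidean to the max norm. *)
Lemma modulus_le : exists C, 0 <= C /\
  forall u H x y j, (forall x, `|u x| <= H) ->
    (forall x h, h != 0 -> `|u (x + h) - u x| <= H * w (enorm h) `^ beta) ->
    `|u (x - y) - u x| <= C * H * W j * (1 + N ^+ j * `|y|).
Proof.
pose D := C1 `^ beta; pose w1 := w 1 `^ beta.
have D0 : 0 < D by exact: powR_gt0.
have w10 : 0 < w1 by rewrite powR_gt0// w_gt0.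
have grow e j : 1 <= e -> e * N ^- j <= 1 ->
  w (e * N ^- j) `^ beta <= D * e * W j.
  move=> e1 ej; have e0 : 0 < e by exact: lt_le_trans e1.
  have H := growth e1 (Nj0 j) ej.
  apply: (@le_trans _ _ ((C1 * e `^ q * w (N ^- j)) `^ beta)).
    rewrite ge0_ler_powR ?nnegrE ?(ltW beta0) ?(ltW (w_gt0 _)) ?mulr_gt0//.
    by rewrite !mulr_ge0 ?powR_ge0 ?(ltW C10) ?(ltW (w_gt0 _)).
  rewrite powRM ?mulr_ge0 ?powR_ge0 ?(ltW C10) ?(ltW (w_gt0 _))//.
  rewrite powRM ?powR_ge0 ?(ltW C10)// ler_wpM2r ?powR_ge0//.
  rewrite ler_wpM2l ?(ltW D0)// -powRrM.
  by rewrite ler1_powR// mulrC ltW.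
have dN : 0 <= D * d%:R by rewrite mulr_ge0 ?(ltW D0).
have dN2 : 0 <= 2 * D * d%:R / w1.
  by apply: mulr_ge0; [rewrite mulr_ge0 ?mulr_ge0 ?(ltW D0)|rewrite invr_ge0
    ltW].
exists (1 + D * d%:R + 2 * D * d%:R / w1); split.
  by apply: addr_ge0 => //; apply: addr_ge0.
move=> u H x y j uH uw.
have H0 : 0 <= H := le_trans (normr_ge0 _) (uH 0).
have HW : 0 <= H * W j by rewrite mulr_ge0 ?(ltW (W0 j)).
have Ny : 0 <= N ^+ j * `|y| by rewrite mulr_ge0 ?exprn_ge0 ?(ltW N0).
rewrite (_ : _ * H * W j * _ = H * W j * ((1 + D * d%:R + 2 * D * d%:R / w1) *
  (1 + N ^+ j * `|y|))); last by ring.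
have [->|y0] := eqVneq y 0.
  rewrite subr0 subrr normr0 mulr_ge0// mulr_ge0//.
    by apply: addr_ge0 => //; apply: addr_ge0.
  by rewrite addr_ge0// mulr_ge0 ?exprn_ge0 ?(ltW N0).
have ny0 : - y != 0 by rewrite oppr_eq0.
have eN : enorm (- y) = enorm y by rewrite -scaleN1r enormZ normrN1 mul1r.
have := uw x (- y) ny0; rewrite eN => uy.
have e0 : 0 < enorm y by exact: enorm_gt0.
have ed : N ^+ j * enorm y <= d%:R * (N ^+ j * `|y|).
  by rewrite mulrCA ler_wpM2l ?exprn_ge0 ?(ltW N0)// enorm_le_normr.
have NjK e : (N ^+ j * e) * N ^- j = e by rewrite mulrAC mulfV ?mul1r//
  expf_neq0// gt_eqF.
pose Y := N ^+ j * `|y|.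
have bigE : (1 + D * d%:R + 2 * D * d%:R / w1) * (1 + Y) =
  1 + (D * d%:R * Y) + (2 * D * d%:R / w1 * Y) + (Y + D * d%:R + 2 * D * d%:R /
    w1) by ring.
have rest0 : 0 <= Y + D * d%:R + 2 * D * d%:R / w1.
  by apply: addr_ge0 => //; apply: addr_ge0.
have DY : 0 <= D * d%:R * Y by exact: mulr_ge0.
have D2Y : 0 <= 2 * D * d%:R / w1 * Y by exact: mulr_ge0.
rewrite -/Y bigE.
(* Below the scale N^-j monotonicity of [w] is enough. *)
have [ej|ej] := leP (enorm y) (N ^- j).
  rewrite (le_trans uy)// -mulrA ler_wpM2l//.
  apply: (@le_trans _ _ (W j)).
    by rewrite ge0_ler_powR ?nnegrE ?(ltW beta0) ?(ltW (w_gt0 _))// w_nd.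
  by rewrite ler_peMr ?(ltW (W0 j))//; lra.
have e1 : 1 <= N ^+ j * enorm y.
  by rewrite -ler_pdivrMl ?exprn_gt0// mulr1 ltW.
(* Between N^-j and 1 the growth bound applies with ratio N^j |y|. *)
have [ey|ey] := leP (enorm y) 1.
  rewrite (le_trans uy)// -mulrA ler_wpM2l// -{1}(NjK (enorm y)).
  rewrite (le_trans (grow _ j e1 _)) ?NjK// mulrC ler_wpM2l ?(ltW (W0 j))//.
  apply: (@le_trans _ _ (D * d%:R * Y));
    first by rewrite -mulrA ler_wpM2l ?(ltW D0).
  by lra.
(* Beyond distance 1 the increment is at most 2 H. Growth with ratio N^j gives w(1)^beta <= D N^j
   W_j, and N^j is at most N^j |y|. *)
have Nj : 1 <= N ^+ j by rewrite exprn_ege1// ltW.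
have := grow (N ^+ j) j Nj; rewrite mulfV ?expf_neq0 ?gt_eqF// lexx =>
  /(_ isT) wj.
apply: (@le_trans _ _ (H * 2)).
  by rewrite mulrC mulr_natl mulr2n (le_trans (ler_normB _ _))// lerD.
rewrite -mulrA ler_wpM2l//.
apply: (@le_trans _ _ (W j * (2 * D * d%:R / w1 * Y))); last first.
  by rewrite ler_wpM2l ?(ltW (W0 j))//; lra.
rewrite (_ : W j * _ = 2 * (W j * (D * (d%:R * Y))) / w1); last by ring.
rewrite -mulrA ler_peMr// ler_pdivlMr// mul1r (le_trans wj)//.
rewrite mulrC ler_wpM2l ?(ltW (W0 j))// ler_wpM2l ?(ltW D0)// (le_trans _ ed)//.
by rewrite ler_peMr ?exprn_ge0 ?(ltW N0)// ltW.
Qed.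

(** Both dilates of the kernel of chi reproduce cos(th) u(x) up to the error of [conv_moment]; in
    their difference this main term cancels. For index 0 it remains and is paid for by the term
    [(W 0)^-1]. *)
Lemma besov_le_holder : exists C, 0 <= C /\
  forall u H, continuous u -> (forall x, `|u x| <= H) ->
    (forall x h, h != 0 -> `|u (x + h) - u x| <= H * w (enorm h) `^ beta) ->
    forall j th x, `|conv u (wave (sym j) th) x| <= C * H * W j.
Proof.
have [Cm [Cm0 mod]] := modulus_le.
have [D [D0 mom]] := conv_moment (chi_test hN hphi).
have CD : 0 <= Cm * D by exact: mulr_ge0.
exists (Cm * D + (W 0)^-1 + Cm * D * N); split.
  apply: addr_ge0; last by rewrite mulr_ge0 ?(ltW N0).
  by apply: addr_ge0 => //; rewrite invr_ge0 ltW.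
move=> u H cu uH uw j th x.
have mu := continuous_measurable_rV cu.
have H0 : 0 <= H := le_trans (normr_ge0 _) (uH 0).
have HW k : 0 <= H * W k by rewrite mulr_ge0 ?(ltW (W0 k)).
have c0 k : 0 < N ^+ k by rewrite exprn_gt0.
have mk k := mom (N ^+ k) u H (Cm * H * W k) th x (c0 k) mu uH (fun y =>
  mod u H x y k uH uw).
case: j => [|j].
  rewrite conv_sym0; have := mk 0%N; rewrite chi0// mulr1.
  set a := conv _ _ _; move=> aH.
  have cu1 : `|cos th * u x| <= H.
    by rewrite normrM -[leRHS]mul1r ler_pM// ler_norml cos_geN1 cos_le1.
  rewrite -(subrK (cos th * u x) a) (le_trans (ler_normD _ _))//.
  rewrite (_ : _ * H * W 0 = Cm * H * W 0 * D + H * ((W 0)^-1 * W 0) + Cm * D *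
    N * (H * W 0)); last by ring.
  rewrite mulVf ?lt0r_neq0// mulr1.
  have : 0 <= Cm * D * N * (H * W 0) by apply: mulr_ge0 => //;
    exact: mulr_ge0 CD (ltW N0).
  by move: aH cu1; lra.
rewrite (conv_symS _ _ _ mu uH).
(* The coarser dilate N^j must be measured against [W j.+1], not [W j]; enlarging the slope to
   N^(j+1) costs a factor N. *)
have mod' y : `|u (x - y) - u x| <= Cm * H * W j.+1 * N * (1 + N ^+ j * `|y|).
  rewrite (le_trans (mod u H x y j.+1 uH uw))// -[leRHS]mulrA ler_wpM2l//.
    by rewrite mulr_ge0 ?mulr_ge0 ?(ltW (W0 _)).
  by rewrite mulrDr mulr1 exprS -mulrA lerD2r ltW.
have mj := mom (N ^+ j) u H (Cm * H * W j.+1 * N) th x (c0 j) mu uH mod'.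
apply: (le_trans (ler_distD (cos th * chi 0 * u x) _ _)).
rewrite [X in _ + X]distrC; apply: (le_trans (lerD (mk j.+1) mj)).
rewrite [leRHS](_ : _ = Cm * H * W j.+1 * D + Cm * H * W j.+1 * N * D + (W
  0)^-1 * (H * W j.+1)); last by ring.
by rewrite lerDl mulr_ge0// invr_ge0 ltW.
Qed.

End equivalence.

Theorem proposition1 (R : realType) (d : nat) (hd : (0 < d)%N)
    (alpha : R) (halpha : 0 < alpha < 2)
    (nu : {measure set 'rV[R]_d -> \bar R})
    (hnu : levy_class alpha nu)
    (htail : forall r : R, 0 < r -> (0 < levy_tail nu r)%E)
    (horv : orv_at_zero (levy_scale nu))
    (hA : cond_A alpha (levy_scale nu))
    (hC : cond_C (levy_scale nu))
    (N : R) (hN : 1 < N)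
    (phi : 'rV[R]_d -> R) (hphi : lp_generator N phi)
    (beta : R) (hbeta : 0 < beta < (orv_q1 (levy_scale nu))^-1) :
  exists C : R, 0 < C /\
    forall u : 'rV[R]_d -> R, Cb_infty u ->
      ((C^-1)%:E * holder_norm (levy_scale nu) beta u <=
         besov_norm (levy_scale nu) beta N phi u)%E /\
      (besov_norm (levy_scale nu) beta N phi u <=
         C%:E * holder_norm (levy_scale nu) beta u)%E.
Proof.
have wgt := levy_scale_gt0 hnu htail.
have wnd := levy_scale_nd hnu htail.
have /andP[beta0 betaq] := hbeta.
have [p10 p1q1] : 0 < orv_p1 (levy_scale nu) /\
    orv_p1 (levy_scale nu) <= orv_q1 (levy_scale nu).
  case: hA => A1 A2 A3; have [a1|a1|a1] := ltgtP alpha 1.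
  - by have [? ? _] := A1 a1.
  - by have [? ? _] := A3 a1; split => //; apply: lt_trans ltr01 _.
  - by have [? ? _] := A2 a1; split => //; apply: lt_le_trans ltr01 _.
move: wgt wnd horv hbeta betaq p10 p1q1 {hA hC htail hnu}.
move: (levy_scale nu) => w wgt wnd horv hbeta betaq p10 p1q1.
have q10 : 0 < orv_q1 w by exact: lt_le_trans p1q1.
(* Strictly above the index, as [orv_q1_bound] needs, and strictly below 1/beta. *)
pose q := (orv_q1 w + beta^-1) / 2.
have q1b : orv_q1 w < beta^-1 by rewrite -[ltLHS]invrK ltf_pV2 ?posrE ?invr_gt0.
have q1q : 0 < orv_q1 w < q by rewrite q10 /q; lra.
have q0 : 0 < q by case/andP: q1q => ? ?; exact: lt_trans q10 _.
have bq : beta * q < 1.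
  by rewrite -ltr_pdivlMl// mulr1 /q; lra.
have [C1 C10 growth] := growth_bound wgt wnd q0 (orv_q1_bound wgt wnd horv q1q).
have [p [C2 [p0 C20 decrease]]] := decrease_bound wgt wnd (orv_p1_bound wgt wnd
  horv p10).
have [CL [CL0 low]] := holder_le_besov hN hphi wgt wnd beta0 q0 bq p0 C10 C20
  growth decrease.
have [CU [CU0 up]] := besov_le_holder hN hphi wgt wnd beta0 bq C10 growth.
(* One 2 stands for the sup norm and the seminorm, the other for the real and imaginary parts; the 1
   makes [C] positive. *)
pose C := 2 * CL + 2 * CU + 1.
have C0 : 0 < C by rewrite ltr_wpDl// addr_ge0 ?mulr_ge0.
exists C; split => // u [su bu].
have cu : continuous u := smooth_continuous su.
have [M uM] : exists M, forall x, `|u x| <= M.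
  have [M [_ HM]] := bu [::]; exists (M + 1) => x.
  by apply: (HM (M + 1)) => //; rewrite ltrDl.
have Nj0 j : 0 < N ^- j by rewrite invr_gt0 exprn_gt0// (lt_trans _ hN).
have sup_ge0 (f : 'rV[R]_d -> R) : (0 <= sup_norm f)%E.
  apply: (@le_trans _ _ (`|f 0|)%:E); first by rewrite lee_fin.
  by apply: ereal_sup_ubound; exists 0.
split.
  have B0 : (0 <= besov_norm w beta N phi u)%E.
    apply: (@le_trans _ _ ((w (N ^- 0) `^ (- beta))%:E * sup_norm (fun x =>
      ComplexField.Normc.normc (convolution u (lp_kernel N phi 0) x)))%E).
      by rewrite mule_ge0// lee_fin powR_ge0.
    by apply: ereal_sup_ubound; exists 0%N.
  have vB B j x : (besov_norm w beta N phi u <= B%:E)%E ->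
      ComplexField.Normc.normc (convolution u (lp_kernel N phi j) x) <= B * w
        (N ^- j) `^ beta.
    move=> uB; have Wj : 0 < w (N ^- j) `^ beta by rewrite powR_gt0// wgt.
    rewrite -ler_pdivrMr// mulrC -powRN -lee_fin; apply: le_trans uB.
    apply: (@le_trans _ _ ((w (N ^- j) `^ (- beta))%:E * sup_norm (fun x =>
      ComplexField.Normc.normc (convolution u (lp_kernel N phi j) x)))%E);
        last first.
      by apply: ereal_sup_ubound; exists j.
    rewrite EFinM lee_wpmul2l ?lee_fin ?powR_ge0//.
    apply: ereal_sup_ubound; exists x => //; congr EFin; apply: ger0_norm.
    exact: sqrtr_ge0.
  case: (besov_norm w beta N phi u) B0 vB => [B| |]//; last by move=> _ _;
    rewrite leey.
  rewrite lee_fin => B0 /(_ B _ _ (lexx _))vB.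
  have v0B j x : `|conv u (wave (lp_symbol N phi j) 0) x| <= B * w (N ^- j) `^
    beta.
    by apply: le_trans (vB j x); rewrite lp_kernel_conv;
      exact: (normc_ge _ _).1.
  have v1B j x : `|conv u (wave (lp_symbol N phi j) (- (pi / 2))) x| <= B * w
    (N ^- j) `^ beta.
    by apply: le_trans (vB j x); rewrite lp_kernel_conv;
      exact: (normc_ge _ _).2.
  have [uB uhB] := low u M B cu uM v0B v1B.
  have : (holder_norm w beta u <= (C * B)%:E)%E.
    apply: (@le_trans _ _ ((CL * B)%:E + (CL * B)%:E)%E); last first.
      rewrite -EFinD lee_fin -mulrDl ler_wpM2r// /C.
      by move: CL0 CU0; lra.
    rewrite /holder_norm; apply: leeD.
      by apply: ge_ereal_sup => _ [x _ <-]; rewrite lee_fin.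
    apply: ge_ereal_sup => _ [[x h] /= h0 <-]; rewrite lee_fin.
    rewrite ler_pdivrMr ?powR_gt0 ?wgt ?enorm_gt0//.
    exact: uhB.
  move=> /(lee_wpmul2l (_ : 0 <= (C^-1)%:E)%E) => /(_ _)/le_trans; apply.
    by rewrite lee_fin invr_ge0 ltW.
  by rewrite -EFinM mulKf// gt_eqF.
have su0 := sup_ge0 u.
have H0 : (0 <= holder_seminorm w beta u)%E.
  (* Positive dimension provides a nonzero vector; the supremum over an empty set would be -oo. *)
  have [x x0] : exists x : 'rV[R]_d, x != 0.
    exists (const_mx 1); apply/eqP => /rowP /(_ (Ordinal hd)); rewrite !mxE.
    by apply/eqP; rewrite oner_eq0.
  apply: (@le_trans _ _ (`|u (0 + x) - u 0| / w (enorm x) `^ beta)%:E).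
    by rewrite lee_fin divr_ge0// powR_ge0.
  by apply: ereal_sup_ubound; exists (0, x).
have uS S : (sup_norm u <= S%:E)%E -> forall x, `|u x| <= S.
  move=> uS x; rewrite -lee_fin; apply: le_trans uS.
  by apply: ereal_sup_ubound; exists x.
have uHS S : (holder_seminorm w beta u <= S%:E)%E ->
    forall x h, h != 0 -> `|u (x + h) - u x| <= S * w (enorm h) `^ beta.
  move=> uHS x h h0; rewrite -ler_pdivrMr ?powR_gt0 ?wgt ?enorm_gt0// -lee_fin.
  by apply: le_trans uHS; apply: ereal_sup_ubound; exists (x, h).
rewrite /holder_norm.
(* If either part of the Hoelder norm is infinite, so is their sum, both being nonnegative, and the
   bound is trivial. *)
case: (sup_norm u) su0 uS => [S1| |]//; last first.
  by move=> _ _; rewrite addye ?gt0_muley ?lte_fin ?leey// gt_eqF//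
    (lt_le_trans _ H0)// ltNy0.
move=> S10 /(_ S1 (lexx _)) uS; rewrite lee_fin in S10.
case: (holder_seminorm w beta u) H0 uHS => [S2| |]//; last first.
  by move=> _ _; rewrite gt0_muley ?lte_fin ?leey.
move=> S20 /(_ S2 (lexx _)) uHS; rewrite lee_fin in S20.
have uS' x : `|u x| <= S1 + S2 by rewrite (le_trans (uS x))// lerDl.
have uHS' x h : h != 0 -> `|u (x + h) - u x| <= (S1 + S2) * w (enorm h) `^ beta.
  by move=> h0; rewrite (le_trans (uHS x h h0))// ler_wpM2r ?powR_ge0// lerDr.
have vS := up u (S1 + S2) cu uS' uHS'.
apply: ge_ereal_sup => _ [j _ <-].
have Wj : 0 < w (N ^- j) `^ beta by rewrite powR_gt0// wgt.
apply: (@le_trans _ _ ((w (N ^- j) `^ (- beta))%:E * (2 * (CU * (S1 + S2) * w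
  (N ^- j) `^ beta))%:E)%E).
  rewrite lee_wpmul2l ?lee_fin ?powR_ge0//.
  apply: ge_ereal_sup => _ [x _ <-]; rewrite lee_fin ger0_norm;
    last exact: sqrtr_ge0.
  rewrite lp_kernel_conv (le_trans (normc_le _ _))// mulr_natl mulr2n.
  by apply: lerD; exact: vS.
rewrite -EFinD -!EFinM lee_fin powRN.
rewrite [leLHS](_ : _ = 2 * CU * (S1 + S2)); last by field; rewrite gt_eqF.
rewrite ler_wpM2r ?addr_ge0// /C; by move: CL0; lra.
Qed.
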